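(* Fix an integer $k\ge 2$. For a precolored graph $G$ (with precoloring classes $U_0,\ldots,U_{k-1},F_1,\ldots,F_k,I$) and $R\subseteq V(G)$, let $$\rho_G^k(R):=\sum_{j=0}^{k-1}C_{U,j}|U_j\cap R|+\sum_{j=1}^kC_{F,j}|F_j\cap R|+C_I|I\cap R|-C_E|E(G[R])|.$$ If a precolored graph $G$ is $(I,F_k)$-critical, then $\rho_G^k(V(G))\le -3$.
   Context: All graphs are finite and simple. Fix an integer $k\ge 2$. Coefficients: - $C_E:=3k-1$ if $k$ is even, and $C_E:=3k-2$ if $k$ is odd; - $C_{U,j}:=\frac{3C_E-3}{2}-3j$ for $0\le j\le k$; - $C_{F,j}:=C_E-3j$ for $1\le j\le \lfloor\frac{k+1}{2}\rfloor$; - $C_{F,j}:=3(k-j)$ for $\lfloor\frac{k+3}{2}\rfloor\le j\le k$; - $C_I:=\frac{C_E-3}{2}$. A precoloring of a graph $G$ is a partition of $V(G)$ into (possibly empty) sets $U_0,U_1,\ldots,U_{k-1},F_1,F_2,\ldots,F_k$, and $I$. A vertex in $F_j$ is thought of as already colored $F$ and having $j-1$ additional fake neighbors colored $F$; a vertex in $U_j$ is uncolored but has $j$ fake neighbors colored $F$; a vertex in $I$ is already colored $I$. An $(I,F_k)$-coloring of a precolored graph $G$ is a partition of $V(G)$ into sets $I'$ and $F'$ such that $I'$ is an independent set, $G[F']$ is a forest, $I\subseteq I'$, $\bigcup_{j=1}^kF_j\subseteq F'$, and each component of $G[F']$ has at most $k$ vertices when fake neighbors are included; that is, for each component, the sum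 over its vertices $v$ of the weight of $v$ is at most $k$, where $v$ has weight $j+1$ if $v\in U_j$ and weight $j$ if $v\in F_j$. A precolored graph $G$ is $(I,F_k)$-critical if $G$ has no $(I,F_k)$-coloring, but every proper subgraph of $G$ (with the inherited precoloring) does and, furthermore, for any vertex precolored $U_j$ (with $j\ge 1$) or $F_j$ (with $j\ge 2$), reducing $j$ by 1 for that vertex (moving it to $U_{j-1}$, respectively $F_{j-1}$) yields a precolored graph that has an $(I,F_k)$-coloring. *)

(* Defs.v *)
From HB Require Import structures.
From mathcomp Require Import all_boot all_order all_algebra.
From mathcomp Require Import zify.

Set Implicit Arguments.
Unset Strict Implicit.
Unset Printing Implicit Defensive.

Import Order.TTheory GRing.Theory Num.Theory.
Local Open Scope ring_scope.

(* Vertices are drawn from an ambient finite type, so that a graph and all of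
   its subgraphs inhabit the same type and share a precoloring. *)
Record graph (T : finType) := Graph {
  vertices : {set T};
  edges : {set {set T}};
  edgesP : forall A, A \in edges -> A \subset vertices /\ #|A| = 2
}.

Section Graphs.
Variable T : finType.
Implicit Types (G H : graph T) (R S : {set T}).

Definition adj G : rel T := fun x y => [set x; y] \in edges G.

Definition subgraph H G : bool :=
  (vertices H \subset vertices G) && (edges H \subset edges G).

Definition proper_subgraph H G : bool := subgraph H G && ~~ subgraph G H.

Lemma induced_subproof G R A : A \in [set A in edges G | A \subset R] ->
  A \subset vertices G :&: R /\ #|A| = 2.
Proof.
rewrite inE => /andP[/edgesP[AV A2] AR].
by split; rewrite // subsetI AV AR.
Qed.

Definition induced G R : graph T := Graph (@induced_subproof G R).

Definition independent G S : Prop :=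
  forall x y, x \in S -> y \in S -> ~~ adj G x y.

Definition forest G : Prop :=
  forall s : seq T, (3 <= size s)%N -> ~ ucycle (adj G) s.

Definition component G (x : T) : {set T} :=
  [set y in vertices G | connect (adj G) x y].

End Graphs.

Inductive precolor := PU of nat | PF of nat | PI.

Definition precolor_code (p : precolor) : option (nat + nat) :=
  match p with PU j => Some (inl j) | PF j => Some (inr j) | PI => None end.
Definition precolor_decode (o : option (nat + nat)) : precolor :=
  match o with
  | Some (inl j) => PU j | Some (inr j) => PF j | None => PI
  end.
Lemma precolor_codeK : cancel precolor_code precolor_decode.
Proof. by case. Qed.
HB.instance Definition _ := Countable.copy precolor (can_type precolor_codeK).

Definition valid_precolor (k : nat) (p : precolor) : bool :=
  match p with
  | PU j => (j < k)%N
  | PF j => (1 <= j <= k)%N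
  | PI => true
  end.

(* The number of vertices a vertex of class p accounts for, fake neighbors
   included, once it is colored F.  The value at PI is irrelevant, since such
   a vertex is never colored F. *)
Definition weight (p : precolor) : nat :=
  match p with PU j => j.+1 | PF j => j | PI => 0%N end.

Definition reducible (p : precolor) : bool :=
  match p with PU j => (1 <= j)%N | PF j => (2 <= j)%N | PI => false end.

Definition reduce_precolor (p : precolor) : precolor :=
  match p with PU j => PU j.-1 | PF j => PF j.-1 | PI => PI end.

Section Precolorings.
Variable T : finType.
(* Only the values of c on vertices G matter in what follows. *)
Implicit Types (G H : graph T) (c : T -> precolor) (R : {set T}).

Definition precoloring (k : nat) G c : Prop :=
  forall x, x \in vertices G -> valid_precolor k (c x).

Definition precolor_class G c (p : precolor) : {set T} :=
  [set x in vertices G | c x == p].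

Definition IF_coloring (k : nat) G c (I' F' : {set T}) : Prop :=
  [/\ I' :|: F' = vertices G /\ [disjoint I' & F'],
      independent G I' /\ forest (induced G F'),
      precolor_class G c PI \subset I',
      forall j, (1 <= j <= k)%N -> precolor_class G c (PF j) \subset F'
    & forall x, x \in F' ->
        (\sum_(v in component (induced G F') x) weight (c v) <= k)%N].

Definition IF_colorable (k : nat) G c : Prop :=
  exists I' F' : {set T}, IF_coloring k G c I' F'.

Definition reduce_at c (x : T) : T -> precolor :=
  fun y => if y == x then reduce_precolor (c y) else c y.

Definition IF_critical (k : nat) G c : Prop :=
  [/\ ~ IF_colorable k G c,
      forall H, proper_subgraph H G -> IF_colorable k H c
    & forall x, x \in vertices G -> reducible (c x) ->
        IF_colorable k G (reduce_at c x)].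

End Precolorings.

Definition C_E (k : nat) : int :=
  if odd k then 3 * k%:Z - 2 else 3 * k%:Z - 1.

(* C_E k is odd, so the integer divisions by 2 below are exact; see C_UE and
   C_IE. *)
Definition C_U (k j : nat) : int := divz (3 * C_E k - 3) 2 - 3 * j%:Z.

Definition C_F (k j : nat) : int :=
  if (j <= (k + 1) %/ 2)%N then C_E k - 3 * j%:Z else 3 * (k%:Z - j%:Z).

Definition C_I (k : nat) : int := divz (C_E k - 3) 2.

Lemma C_UE k j : 2 * (C_U k j + 3 * j%:Z) = 3 * C_E k - 3.
Proof. rewrite /C_U /C_E; case: ifP; lia. Qed.

Lemma C_IE k : 2 * C_I k = C_E k - 3.
Proof. rewrite /C_I /C_E; case: ifP; lia. Qed.

Definition rho (T : finType) (k : nat) (G : graph T) (c : T -> precolor)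
    (R : {set T}) : int :=
  \sum_(0 <= j < k) C_U k j * #|precolor_class G c (PU j) :&: R|%:Z
  + \sum_(1 <= j < k.+1) C_F k j * #|precolor_class G c (PF j) :&: R|%:Z
  + C_I k * #|precolor_class G c PI :&: R|%:Z
  - C_E k * #|edges (induced G R)|%:Z.

(* Main.v *)
(* The potential method.  In a minimal counterexample [G] (fewest edges) one
   deletes edges and changes the precoloring; if the result is not colorable,
   induction yields a set [W] of potential at most -3 there, and computing its
   potential in [G] gives a set of low potential.  Such sets are excluded by
   the gap lemma: a proper vertex set [R] spanning an edge has potential more
   than [C_I].  Indeed, take [R] of least potential [r <= C_I] and a boundary
   vertex [x] of [R].  As [r] is least, [R] still has a coloring after [x] gets
   [t], about [r / 3], extra fake neighbors.  Recording this coloring in the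
   precoloring, with [x] in class F_(k-t) and the other vertices of [R] in F_k
   and I, and deleting the edges inside [R], leaves an uncolorable graph; the
   set that induction provides there, joined with [R], is too low.

   With m the integer part of k / 2, the gap lemma leaves as the only vertices
   with a positive contribution to the potential the special ones, of degree 2
   and class U_(m-1).  They are pairwise nonadjacent and have neighbors in U
   only.  Splitting the surplus of each between its two neighbors leaves at
   most four nonspecial vertices to check when k is odd, and at most two edges
   between nonspecial vertices when k is even; these graphs are colored by hand. *)

Require Import Defs.
From mathcomp Require Import all_boot all_order all_algebra.
From mathcomp Require Import zify.
From Stdlib Require Import Classical.

Import Order.TTheory GRing.Theory Num.Theory.
Local Open Scope ring_scope.

Set Implicit Arguments.
Unset Strict Implicit.
Unset Printing Implicit Defensive.

(** * Forests with small components *)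

Section SmallForests.
Variables (T : finType) (k : nat).
Implicit Types (e : rel T) (w : T -> nat) (F : {set T}).

(** The coefficients are a price list fitted to the threshold [C_I k] of the gap lemma. A fake
    neighbor costs at most 3; turning [PU 0] into [PI] costs exactly [C_E k], one edge; turning
    [PU j] into [PF j.+1] costs at most [C_I k + 3]. As induction supplies -3, a set W that misses a
    vertex contradicts the gap lemma after one vertex is forced to F, or after m fake neighbors are
    reserved, because 3m - 3 <= C_I. When the price is higher, or when W may be everything, deleted
    vertices and edges are put back, each edge lowering the potential by [C_E k].

    Reserving is the device that extends colorings: fake neighbors added to a vertex keep room in
    its component for a deleted vertex of that weight, which is later reattached as a leaf. For a
    vertex of degree 2 in class U_j, reserving at both neighbors is affordable up to j = m - 2; at j
    = m - 1 the inequality just fails, and this is where the special vertices come from. *)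

Definition restr e F : rel T := [rel u v | [&& u \in F, v \in F & e u v]].

(** The relation and the weights are arbitrary, so that reserved fake neighbors are simply a larger
    weight and comparing two precolorings means comparing two functions [w]. *)
Definition small_forest e w F : Prop :=
  (forall s, (3 <= size s)%N -> ~ ucycle (restr e F) s) /\
  (forall x, x \in F -> (\sum_(v | connect (restr e F) x v) w v <= k)%N).

Lemma connect_invariant (e : rel T) (P : pred T) x y :
  P x -> (forall u v, P u -> e u v -> P v) -> connect e x y -> P y.
Proof.
move=> Px He /connectP [p ep ->].
elim: p x Px ep => //= z p IH x Px /andP [exz ep]; apply: IH ep.
exact: He exz.
Qed.

Lemma connect_last_edge (e : rel T) x y :
  connect e x y -> x = y \/ exists z, e z y.
Proof.
move=> /connectP [p]; case/lastP: p => [_ ->|p z]; first by left.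
rewrite rcons_path last_rcons => /andP [_ h] ->; right; by exists (last x p).
Qed.

Lemma restr_sym e F : symmetric e -> symmetric (restr e F).
Proof. by move=> He u v; rewrite /restr /= He andbCA. Qed.

Lemma connect_restrS e F u v : u \in F -> connect (restr e F) u v -> v \in F.
Proof.
by move=> uF; apply: (@connect_invariant _ [in F]) => // a b _ /and3P [].
Qed.

(** Used contrapositively: a vertex with at most one neighbor in F lies on no cycle, which gives
    acyclicity for leaves and stars. It also shows that all vertices of a cycle of [restr e F] lie
    in F. *)
Lemma ucycle_two_neighbors (e : rel T) s x :
  (3 <= size s)%N -> ucycle e s -> x \in s ->
  exists a b, [/\ a \in s, b \in s, a != b, e x a & e b x].
Proof.
move=> s3 /andP [cs us] xs; have [i p Hs] := rot_to xs.
have us' : uniq (x :: p) by rewrite -Hs rot_uniq.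
have cs' : cycle e (x :: p) by rewrite -Hs rot_cycle.
have sz : size (x :: p) = size s by rewrite -Hs size_rot.
have mem z : z \in x :: p -> z \in s by rewrite -Hs mem_rot.
case: p {Hs} us' cs' sz mem => [|a p] us' cs' sz mem; first by move: s3; rewrite -sz.
case/lastP: p us' cs' sz mem => [|p b] us' cs' sz mem; first by move: s3; rewrite -sz.
exists a, b; move: cs' us'; rewrite /= !rcons_path last_rcons /=.
rewrite !inE !mem_rcons !inE => /and3P [exa /andP [_ _] ebx] /and3P [_ h _].
split => //; first by apply: mem; rewrite !inE eqxx orbT.
- by apply: mem; rewrite !inE mem_rcons !inE eqxx !orbT.
- by apply: contra h => /eqP ->; rewrite eqxx.
Qed.

Lemma sub_small_forest e e' w w' F F' :
  small_forest e w F -> F' \subset F ->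
  {in F' &, forall u v, e' u v -> e u v} -> {in F', forall u, (w' u <= w u)%N} ->
  small_forest e' w' F'.
Proof.
move=> [Hc Hw] sF se sw; have sr : subrel (restr e' F') (restr e F).
  move=> u v /and3P [uF vF euv]; rewrite /restr /=.
  by rewrite !(subsetP sF) // se.
split=> [s s3 /andP [cs us]|x xF].
  by apply: (Hc s s3); rewrite /ucycle us andbT (sub_cycle sr).
apply: leq_trans (Hw x (subsetP sF _ xF)).
rewrite [leqRHS](bigID (fun v => connect (restr e' F') x v)) /=.
apply: leq_trans (leq_addr _ _).
rewrite [leqRHS](eq_bigl (fun v => connect (restr e' F') x v)); last first.
  move=> v /=; apply: andb_idl; apply: connect_sub => a b h.
  by apply: connect1; apply: sr.
by apply: leq_sum => v /(connect_restrS xF) /sw.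
Qed.

Lemma small_forest_set1 e w F x :
  small_forest e w F -> x \in F -> (w x <= k)%N.
Proof.
move=> [_ Hw] xF; apply: leq_trans (Hw x xF).
by rewrite (bigD1 x) ?connect0 //= leq_addr.
Qed.

(* Adding the leaf [v] to [x]: the weight of [v] was reserved at [x]. *)
Lemma small_forest_leaf e w w' F v x :
  symmetric e -> irreflexive e ->
  small_forest e w F -> x \in F -> v \notin F ->
  {in F, forall u, e v u -> u = x} ->
  {in F, forall u, (w' u + (u == x) * w' v <= w u)%N} ->
  small_forest e w' (v |: F).
Proof.
move=> es ei H xF vF Hv Hw'.
have [Hc Hw] := H.
have Hx := Hw' x xF; rewrite eqxx mul1n in Hx.
have wv : (w' v <= k)%N.
  by have := small_forest_set1 H xF; move: Hx; lia.
have nb u : restr e (v |: F) v u -> u = x.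
  move=> /and3P [_]; rewrite in_setU1 => /orP [/eqP ->|]; first by rewrite ei.
  exact: Hv.
have sr := restr_sym (v |: F) es.
split.
  move=> s s3 Us; have [cs us] := andP Us.
  have vs : v \notin s.
    apply/negP => vs.
    have [a [b [_ _ /eqP ab va vb]]] := ucycle_two_neighbors s3 Us vs.
    by apply: ab; rewrite (nb _ va) (nb b) // sr.
  apply: (Hc s s3); rewrite /ucycle us andbT.
  apply: sub_in_cycle cs; last by apply/allP => z zs; exact: zs.
  move=> a b; rewrite !unfold_in => ha hb; rewrite /restr /= !in_setU1.
  have/negPf -> : a != v by apply: contraNneq vs => <-.
  by have/negPf -> : b != v by apply: contraNneq vs => <-.
have stepF u z : u \in F -> z \in F -> restr e (v |: F) u z -> restr e F u z.
  by move=> uF zF /and3P [_ _ h]; rewrite /restr /= uF zF.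
(* The new component of y is the old one, plus v only if x belongs to it; the weight of v is
   therefore charged once, to the reserve at x. *)
have compF y z : y \in F -> connect (restr e (v |: F)) y z ->
    connect (restr e F) y z || ((z == v) && connect (restr e F) y x).
  move=> yF; apply: (@connect_invariant _
    (fun z => connect (restr e F) y z || ((z == v) && connect (restr e F) y x))).
    by rewrite connect0.
  move=> a b /orP [ya|/andP [/eqP -> yx]] ab; last by rewrite (nb _ ab) yx.
  have aF := connect_restrS yF ya.
  have [bv|bv] := eqVneq b v.
    by rewrite bv sr in ab; rewrite -(nb _ ab) ya orbT.
  have bF : b \in F by case/and3P: ab => _; rewrite in_setU1 (negPf bv).
  by rewrite (connect_trans ya) // connect1 // stepF.
have bound y : y \in F -> (\sum_(z | connect (restr e (v |: F)) y z) w' z <= k)%N.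
  move=> yF; apply: leq_trans (Hw y yF).
  have [yx|yx] := boolP (connect (restr e F) y x).
    apply: (@leq_trans (w' v + \sum_(z | connect (restr e F) y z) w' z)).
      rewrite (bigID (pred1 v)) /= leq_add //.
        rewrite (big_andbC) big_mkcondr /= big_pred1_eq.
        by case: ifP.
      rewrite [leqRHS]big_mkcond [leqLHS]big_mkcond; apply: leq_sum => z _.
      case: ifP => // /andP [h /negPf zv]; move: (compF _ _ yF h).
      by rewrite zv orbF => ->.
    rewrite (bigD1 x) //= [leqRHS](bigD1 x) //=.
    have : (\sum_(z | connect (restr e F) y z && (z != x)) w' z <=
            \sum_(z | connect (restr e F) y z && (z != x)) w z)%N.
      apply: leq_sum => z /andP [/(connect_restrS yF) zF zx].
      by have := Hw' z zF; rewrite (negPf zx); lia.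
    move: Hx; lia.
  rewrite [leqRHS]big_mkcond [leqLHS]big_mkcond; apply: leq_sum => z _.
  case: ifP => // h; move: (compF _ _ yF h); rewrite (negPf yx) andbF orbF => hz.
  by rewrite hz; have := Hw' z (connect_restrS yF hz); lia.
move=> y; rewrite in_setU1 => /orP [/eqP ->|]; last exact: bound.
(* Adjacency of v and x is not assumed: v shares the component of x, or is a component by itself. *)
have [vx|vx] := boolP (restr e (v |: F) v x).
  have := bound x xF; rewrite (eq_bigl (fun z => connect (restr e (v |: F)) v z)) //.
  move=> z; have cs := sym_connect_sym sr.
  by apply: same_connect; [exact: cs|rewrite cs connect1].
rewrite (big_pred1 v) // => z.
apply/idP/eqP => [|->]; last exact: connect0.
move=> h; apply/eqP; apply: (@connect_invariant _ (pred1 v) v z _ _ h) => //= a b /eqP -> ab.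
by case/negP: vx; rewrite -(nb _ ab).
Qed.

End SmallForests.

Section SmallForestConstructions.
Variables (T : finType) (k : nat).
Implicit Types (e : rel T) (w : T -> nat) (F A B : {set T}).

Lemma small_forest_isolated e w F v :
  symmetric e -> irreflexive e -> small_forest k e w F ->
  {in F, forall u, ~~ e v u} -> (w v <= k)%N -> small_forest k e w (v |: F).
Proof.
move=> es ei [Hc Hw] Hv wv.
have re : restr e (v |: F) =2 restr e F.
  move=> a b; rewrite /restr /= !in_setU1.
  have [->|av] := eqVneq a v; have [->|bv] := eqVneq b v; rewrite /= ?ei ?andbF //.
    by have [bF|_] := boolP (b \in F); rewrite ?andbF // (negPf (Hv b bF)) !andbF.
  by have [aF|_] := boolP (a \in F); rewrite ?andbF // (es a v) (negPf (Hv a aF)) !andbF.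
split=> [s s3|y]; first by rewrite /ucycle (eq_cycle re); exact: Hc.
rewrite (eq_bigl _ _ (eq_connect re y)) in_setU1.
have [yF|yF] := boolP (y \in F); first by rewrite Hw.
rewrite orbF => /eqP ->; have [/Hw //|vF] := boolP (v \in F).
rewrite (big_pred1 v) // => z; apply/idP/eqP => [h|->]; last exact: connect0.
apply/eqP; apply: (@connect_invariant _ _ (pred1 v) v z _ _ h) => //= a b /eqP -> /and3P [].
by rewrite (negPf vF).
Qed.

(** If every edge has an end of degree at most 1, no cycle exists and each component is the closed
    neighborhood of a center, so its weight is bounded by the hypothesis at that center. *)
Lemma small_forest_star e w F :
  symmetric e -> irreflexive e ->
  {in F &, forall u v, e u v ->
     (#|[set z in F | e u z]| <= 1)%N || (#|[set z in F | e v z]| <= 1)%N} ->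
  {in F, forall c, (w c + \sum_(v in F | e c v) w v <= k)%N} ->
  small_forest k e w F.
Proof.
move=> es ei Hd Hw.
have one u a b : (#|[set z in F | e u z]| <= 1)%N ->
    restr e F u a -> restr e F u b -> a = b.
  move=> /card_le1_eqP h /and3P [_ aF ua] /and3P [_ bF ub].
  by apply: h; rewrite inE ?aF ?bF.
have sr := restr_sym F es.
split=> [s s3 Us|x xF].
  have nbr u : u \in s -> (1 < #|[set z in F | e u z]|)%N.
    move=> us; have [a [b [_ _ ab ua bu]]] := ucycle_two_neighbors s3 Us us.
    rewrite ltnNge; apply/negP => h; case/eqP: ab; apply: (one _ _ _ h ua).
    by rewrite sr.
  have [u us] : exists u, u \in s by case: (s) s3 => // a l _; exists a; rewrite mem_head.
  have [a [_ [as_ _ _ /and3P [uF aF ua] _]]] := ucycle_two_neighbors s3 Us us.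
  by case/orP: (Hd u a uF aF ua); rewrite leqNgt nbr.
pose nb c := [set v in F | e c v].
(* The center is x if x has two neighbors, otherwise its neighbor if there is one. *)
have [c [cF xc cl]] : exists c, [/\ c \in F, (x == c) || e c x &
    forall u v, (u == c) || e c u -> restr e F u v -> (v == c) || e c v].
  have star c : c \in F -> (forall u, e c u -> u \in F -> (#|nb u| <= 1)%N) ->
      forall u v, (u == c) || e c u -> restr e F u v -> (v == c) || e c v.
    move=> cF h u v /orP [/eqP ->|cu] uv; first by case/and3P: uv => _ _ ->; rewrite orbT.
    have uF : u \in F by case/and3P: uv.
    rewrite (one u v c (h u cu uF) uv) ?eqxx //.
    by rewrite sr /restr /= cF uF.
  have [x2|x1] := ltnP 1 #|nb x|.
    exists x; rewrite eqxx; split=> //; apply: star => // u xu uF.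
    by case/orP: (Hd x u xF uF xu) => //; rewrite leqNgt x2.
  have [y yx|nx] := pickP [pred y | restr e F x y].
    have yF : y \in F by case/and3P: yx.
    have xy : e x y by case/and3P: yx.
    have [y2|y1] := ltnP 1 #|nb y|.
      exists y; rewrite yF es xy orbT; split=> //; apply: star => // u yu uF.
      by case/orP: (Hd y u yF uF yu) => //; rewrite leqNgt y2.
    exists y; rewrite yF es xy orbT; split=> //; apply: star => // u yu uF.
    suff -> : u = x by [].
    by apply: (one y _ _ y1); rewrite /restr /= yF ?uF ?xF // es.
  exists x; rewrite eqxx; split=> //; apply: star => // u xu uF.
  by have := nx u; rewrite /restr /= xF uF xu.
apply: leq_trans (Hw c cF).
apply: (@leq_trans (\sum_(v in F | (v == c) || e c v) w v)).
  rewrite [leqRHS]big_mkcond [leqLHS]big_mkcond; apply: leq_sum => v _.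
  case: ifP => // xv.
  by rewrite (connect_restrS xF xv) (@connect_invariant _ _ (fun v => (v == c) || e c v) _ _ xc cl xv).
rewrite (bigD1 c) /= ?cF ?eqxx // leq_add2l.
rewrite [leqRHS]big_mkcond [leqLHS]big_mkcond; apply: leq_sum => v _.
by case: (v \in F); case: (v == c); case: (e c v).
Qed.

Lemma path_all_invariant (r : rel T) (P : pred T) a p :
  path r a p -> P a -> (forall u v, P u -> v \in p -> r u v -> P v) -> all P (a :: p).
Proof.
elim: p a => [|b p IH] a /=; first by move=> _ ->.
move=> /andP [ab bp] Pa H; rewrite Pa /=; apply: IH => //.
  by apply: H Pa _ ab; rewrite mem_head.
by move=> u v Pu vp; apply: H => //; rewrite in_cons vp orbT.
Qed.

(* Two pieces meeting in a single vertex: a cycle passes through [x] at most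
   once, hence stays in one piece. *)
Lemma small_forest_glue e w wA wB A B x :
  symmetric e -> small_forest k e wA A -> small_forest k e wB B ->
  (x \in A) = (x \in B) ->
  (forall u, u \in A -> u \in B -> u = x) ->
  (forall u v, u \in A -> v \in B -> e u v -> u = x \/ v = x) ->
  {in A, forall u, (w u <= wA u)%N} -> {in B, forall u, (w u <= wB u)%N} ->
  (k + w x <= wA x + wB x)%N ->
  small_forest k e w (A :|: B).
Proof.
move=> es [HcA HwA] [HcB HwB] xAB AB eAB wA' wB' wx.
set r := restr e (A :|: B).
have sr := restr_sym (A :|: B) es.
have xA_of_r u : r u x -> x \in A.
  by move=> /and3P [_]; rewrite in_setU -xAB orbb.
have stepA u v : u \in A -> u != x -> r u v -> v \in A /\ restr e A u v.
  move=> uA ux /and3P [_ vAB uv].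
  have vA : v \in A.
    move: vAB; rewrite in_setU => /orP [//|vB].
    by case: (eAB u v uA vB uv) ux => [->|vx]; rewrite ?eqxx // => _; move: vB; rewrite vx -xAB.
  by split=> //; rewrite /restr /= uA vA.
have stepB u v : u \in B -> u != x -> r u v -> v \in B /\ restr e B u v.
  move=> uB ux /and3P [_ vAB uv].
  have vB : v \in B.
    move: vAB; rewrite in_setU => /orP [vA|//]; rewrite es in uv.
    by case: (eAB v u vA uB uv) ux => [vx|->]; rewrite ?eqxx // => _; move: vA; rewrite vx xAB.
  by split=> //; rewrite /restr /= uB vB.
split.
  move=> s s3 /andP [cs us].
  have sub : all (mem (A :|: B)) s.
    apply/allP => y ys.
    have U : ucycle r s by rewrite /ucycle cs.
    by have [a [_ [_ _ _ /and3P [yAB _ _] _]]] := ucycle_two_neighbors s3 U ys.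
  have side : all (mem A) s \/ all (mem B) s.
    (* The cycle is rotated to start at x if it meets x. What remains is a path avoiding x, and such
       a path cannot change sides. *)
    have [a [p [i [Hs px xs]]]] : exists a p i, [/\ rot i s = x :: a :: p \/ rot i s = a :: p,
        x \notin a :: p & path r a p].
      have [xs|xs] := boolP (x \in s).
        have [i p Hs] := rot_to xs.
        have cs' : cycle r (x :: p) by rewrite -Hs rot_cycle.
        have us' : uniq (x :: p) by rewrite -Hs rot_uniq.
        case: p cs' us' Hs => [|a p] cs' us' Hs.
          by move: s3; rewrite -(size_rot i) Hs.
        exists a, p, i; split; [by left|by case/andP: us'|].
        by move: cs' => /= /andP [_]; rewrite rcons_path => /andP [].
      case: s s3 cs us sub xs => // a p _ cs us sub xs.
      exists a, p, 0; split; [by right; rewrite rot0|by []|].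
      by move: cs => /=; rewrite rcons_path => /andP [].
    have ax : a != x by apply: contraNneq px => ->; rewrite mem_head.
    have nx v : v \in p -> v != x.
      by move=> vp; apply: contraNneq px => <-; rewrite in_cons vp orbT.
    have : a \in A :|: B.
      by apply: (allP sub); rewrite -(mem_rot i); case: Hs => ->; rewrite !inE eqxx ?orbT.
    have fin (C : {set T}) : (x \in s -> x \in C) ->
      all [pred v | (v \in C) && (v != x)] (a :: p) -> all (mem C) s.
      move=> xC h; apply/allP => y ys.
      have yi : y \in rot i s by rewrite mem_rot.
      have [yx|yx] := eqVneq y x; first by rewrite yx; apply: xC; rewrite -yx.
      have yap : y \in a :: p by case: Hs yi => -> //; rewrite in_cons (negPf yx).
      by have /andP [] := allP h y yap.
    have xs' : x \in s -> (x \in A) && (x \in B).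
      by move=> /(allP sub); rewrite /= in_setU -xAB orbb => ->.
    rewrite in_setU => /orP [aA|aB]; [left|right]; apply: fin;
      try by move=> /xs' /andP [].
      apply: path_all_invariant xs _ _; first by rewrite /= aA.
      by move=> u v /andP [uA ux] vp uv; rewrite /= nx // (stepA u v uA ux uv).1.
    apply: path_all_invariant xs _ _; first by rewrite /= aB.
    by move=> u v /andP [uB ux] vp uv; rewrite /= nx // (stepB u v uB ux uv).1.
  case: side => h; [apply: (HcA s s3)|apply: (HcB s s3)]; rewrite /ucycle us andbT;
    by apply: (sub_in_cycle _ h) cs => u v uC vC /and3P [_ _ uv]; apply/and3P.
move=> y yAB.
have [yx|yx] := boolP (connect r y x).
  have xB : x \in B.
    rewrite -xAB; have [yx'|[z /xA_of_r //]] := connect_last_edge yx.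
    by move: yAB; rewrite yx' in_setU -xAB orbb.
  have xA : x \in A by rewrite xAB.
  (* The component of x is covered by its components in the two pieces; x is counted in both, which
     the inequality on [w x] compensates. *)
  pose Z v := connect (restr e A) x v || connect (restr e B) x v.
  have sub v : connect r y v -> Z v.
    move=> yv; have xv : connect r x v.
      by apply: connect_trans yv; rewrite (sym_connect_sym sr).
    apply: (@connect_invariant _ r Z x v _ _ xv); first by rewrite /Z connect0.
    move=> a b Za ab.
    have [ax|ax] := eqVneq a x.
      have bAB : b \in A :|: B by case/and3P: ab.
      have eab : e x b by case/and3P: ab => _ _; rewrite ax.
      move: bAB; rewrite in_setU => /orP [bA|bB]; rewrite /Z.
        by rewrite connect1 // /restr /= xA bA.
      by rewrite [X in _ || X]connect1 ?orbT // /restr /= xB bB.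
    case/orP: Za => xa; rewrite /Z.
      by rewrite (connect_trans xa) // connect1 // (stepA a b (connect_restrS xA xa) ax ab).2.
    by rewrite [X in _ || X](connect_trans xa) ?orbT // connect1 // (stepB a b (connect_restrS xB xa) ax ab).2.
  have hA := HwA x xA; have hB := HwB x xB.
  rewrite (bigD1 x) ?connect0 //= in hA; rewrite (bigD1 x) ?connect0 //= in hB.
  have sum : (\sum_(v | connect r y v) w v <= w x +
      \sum_(v | connect (restr e A) x v && (v != x)) wA v +
      \sum_(v | connect (restr e B) x v && (v != x)) wB v)%N.
    rewrite (bigD1 x) //= -addnA leq_add2l.
    rewrite [leqLHS]big_mkcond [X in (_ <= X + _)%N]big_mkcond [X in (_ <= _ + X)%N]big_mkcond -big_split.
    apply: leq_sum => v _ /=; case: ifP => // /andP [/sub /orP [] h ->]; rewrite h /=.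
      by apply: leq_trans (wA' v (connect_restrS xA h)) (leq_addr _ _).
    by apply: leq_trans (wB' v (connect_restrS xB h)) (leq_addl _ _).
  apply: leq_trans sum _; move: hA hB wx.
  set a1 := (\sum_(v | connect (restr e A) x v && (v != x)) wA v)%N.
  set b1 := (\sum_(v | connect (restr e B) x v && (v != x)) wB v)%N.
  lia.
have ny v : connect r y v -> v != x by move=> yv; apply: contraNneq yx => <-.
move: (yAB); rewrite in_setU => /orP [yA|yB].
  apply: leq_trans (HwA y yA); rewrite [leqRHS]big_mkcond [leqLHS]big_mkcond.
  apply: leq_sum => v _; case: ifP => // yv.
  have : connect (restr e A) y v && connect r y v.
    apply: (@connect_invariant _ r (fun v => connect (restr e A) y v && connect r y v) y v _ _ yv).
      by rewrite !connect0.
    move=> a b /andP [ya yra] ab; rewrite (connect_trans yra (connect1 ab)) andbT.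
    rewrite (connect_trans ya) // connect1 //.
    exact: (stepA a b (connect_restrS yA ya) (ny _ yra) ab).2.
  by move=> /andP [h _]; rewrite h wA' // (connect_restrS yA h).
apply: leq_trans (HwB y yB); rewrite [leqRHS]big_mkcond [leqLHS]big_mkcond.
apply: leq_sum => v _; case: ifP => // yv.
have : connect (restr e B) y v && connect r y v.
  apply: (@connect_invariant _ r (fun v => connect (restr e B) y v && connect r y v) y v _ _ yv).
    by rewrite !connect0.
  move=> a b /andP [ya yra] ab; rewrite (connect_trans yra (connect1 ab)) andbT.
  rewrite (connect_trans ya) // connect1 //.
  exact: (stepB a b (connect_restrS yB ya) (ny _ yra) ab).2.
by move=> /andP [h _]; rewrite h wB' // (connect_restrS yB h).
Qed.

End SmallForestConstructions.

(** * Coefficients and precolorings *)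

Lemma half_double_odd k : k = (2 * k./2 + odd k)%N.
Proof. by rewrite -[LHS]odd_double_half addnC mul2n. Qed.

Lemma C_E_half k : C_E k = 6 * (k./2)%:Z - 1 + 2 * (odd k)%:Z.
Proof. rewrite /C_E; have := half_double_odd k; case: (odd k); lia. Qed.

Lemma C_I_half k : C_I k = 3 * (k./2)%:Z - 2 + (odd k)%:Z.
Proof. have := C_IE k; rewrite C_E_half; lia. Qed.

Lemma C_U_half k j : C_U k j = 9 * (k./2)%:Z - 3 + 3 * (odd k)%:Z - 3 * j%:Z.
Proof. have := C_UE k j; rewrite C_E_half; lia. Qed.

(* [C_F] raised by 1 at [j = (k + 1) / 2] when [k] is odd.  The bound on
   critical graphs survives this change, and the induction needs it. *)
Definition coef (k : nat) (p : precolor) : int :=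
  match p with
  | PU j => C_U k j
  | PF j => if (j <= k./2)%N then C_E k - 3 * j%:Z
            else 3 * (k%:Z - j%:Z) - (odd k && (j == k./2.+1))%:Z
  | PI => C_I k
  end.
Arguments coef : simpl never.

Ltac coef_lia k :=
  rewrite /coef ?C_I_half ?C_U_half ?C_E_half;
  have := half_double_odd k; case: (odd k);
  repeat (case: ifP; try lia); lia.

Lemma C_E_ge5 k : (2 <= k)%N -> 5 <= C_E k.
Proof. by move=> k2; coef_lia k. Qed.

Lemma C_E_ge0 k : (2 <= k)%N -> 0 <= C_E k.
Proof. by move=> /C_E_ge5; apply: le_trans. Qed.

Lemma C_F_le_coef k j : (j <= k)%N -> C_F k j <= coef k (PF j).
Proof.
move=> jk; rewrite /C_F.
have -> : (j <= (k + 1) %/ 2)%N = (j <= k./2 + odd k)%N.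
  by have := half_double_odd k; case: (odd k); lia.
coef_lia k.
Qed.

Lemma coef_ge0 k p : (2 <= k)%N -> valid_precolor k p -> 0 <= coef k p.
Proof. by move=> k2; case: p => [j|j|] /=; try move=> jk; coef_lia k. Qed.

(* Adding [t] fake neighbors; an uncolored vertex that could no longer be
   colored F becomes I. *)
Definition inc (k t : nat) (p : precolor) : precolor :=
  match p with
  | PU j => if (j + t < k)%N then PU (j + t) else PI
  | PF j => PF (j + t)
  | PI => PI
  end.

Definition inc_valid (k t : nat) (p : precolor) : bool :=
  if p is PF j then (j + t <= k)%N else true.

Lemma valid_inc k t p :
  valid_precolor k p -> inc_valid k t p -> valid_precolor k (inc k t p).
Proof. by case: p => [j|j|] //=; [case: ifP|lia]. Qed.

Lemma inc0 k p : valid_precolor k p -> inc k 0 p = p.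
Proof. by case: p => [j|j|] //=; rewrite addn0 // => ->. Qed.

(** The critical case is [PU j] overflowing to [PI]: the price is [C_E k - 3j], and [j + t >= k]
    makes it at most 3t because [C_E k < 3k]. Where the formula for [PF] changes, the coefficient
    falls by less than 3 per step. *)
Lemma coef_inc k t p :
  (2 <= k)%N -> valid_precolor k p -> inc_valid k t p ->
  coef k p - coef k (inc k t p) <= 3 * t%:Z.
Proof.
move=> k2; case: p => [j|j|] /=; last by lia.
- by move=> jk _; case: ifP; coef_lia k.
- by move=> jk jt; coef_lia k.
Qed.

Lemma weight_inc k t p : inc k t p != PI -> p != PI ->
  weight (inc k t p) = (weight p + t)%N.
Proof. by case: p => [j|j|] //=; case: ifP. Qed.

(** * Colorings and critical graphs *)

Section Colorings.
Variables (T : finType) (k : nat).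
Implicit Types (G H : graph T) (c : T -> precolor) (F V W : {set T}).

Lemma adj_sym G : symmetric (adj G).
Proof. by move=> x y; rewrite /adj setUC. Qed.

Lemma adj_irr G : irreflexive (adj G).
Proof.
move=> x; apply/negP => /edgesP [_]; by rewrite setUid cards1.
Qed.

Lemma adj_neq G x y : adj G x y -> x != y.
Proof. by move=> xy; apply/eqP => E; rewrite E adj_irr in xy. Qed.

Lemma adj_vertices G x y : adj G x y -> x \in vertices G /\ y \in vertices G.
Proof. by move=> /edgesP [/subsetP h _]; split; apply: h; rewrite !inE eqxx ?orbT. Qed.

Lemma card_edge G A : A \in edges G -> #|A| = 2%N.
Proof. by case/edgesP. Qed.

Lemma edge_adj G A : A \in edges G -> exists x y, [/\ A = [set x; y] & adj G x y].
Proof.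
move=> AG; have /eqP/cards2P [x [y [_ E]]] := card_edge AG.
by exists x, y; rewrite /adj -E.
Qed.

Lemma pair_in (x y : T) (A : {set T}) : [set x; y] \subset A = (x \in A) && (y \in A).
Proof. by rewrite subUset !sub1set. Qed.

Lemma mkgraph_subproof V (E : {set {set T}}) A :
  A \in [set A in E | (A \subset V) && (#|A| == 2%N)] -> A \subset V /\ #|A| = 2.
Proof. by rewrite inE => /and3P [_ ? /eqP]. Qed.

(** Filtering E yields a graph for any vertex set and any edge family, so that edges can be deleted
    without side conditions. *)
Definition mkgraph V (E : {set {set T}}) : graph T := Graph (@mkgraph_subproof V E).

Lemma adj_mkgraph V (E : {set {set T}}) x y :
  adj (mkgraph V E) x y = [&& [set x; y] \in E, x \in V, y \in V & x != y].
Proof. by rewrite /adj inE pair_in cards2 -andbA; case: (x != y). Qed.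

(* A coloring is determined by its set [F] of vertices colored F. *)
Definition good G c F : Prop :=
  [/\ F \subset vertices G,
      forall u v, adj G u v -> (u \in F) || (v \in F),
      forall u, u \in vertices G -> c u = PI -> u \notin F,
      forall u j, u \in vertices G -> c u = PF j -> u \in F
    & small_forest k (adj G) (fun u => weight (c u)) F].

Definition colorable G c : Prop := exists F, good G c F.

Lemma restr_induced G F : adj (induced G F) =2 restr (adj G) F.
Proof.
move=> x y; rewrite /adj /restr /= inE pair_in /adj; by rewrite andbC andbA.
Qed.

Lemma component_induced G F x : F \subset vertices G -> x \in F ->
  component (induced G F) x = [set y | connect (restr (adj G) F) x y].
Proof.
move=> FV xF; apply/setP => y; rewrite !inE /= (eq_connect (restr_induced G F)).
case h: (connect _ x y); rewrite ?andbF // andbT.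
have yF := connect_restrS xF h.
by rewrite yF (subsetP FV).
Qed.

Lemma colorableP G c : precoloring k G c -> IF_colorable k G c <-> colorable G c.
Proof.
move=> hc; split=> [[I [F [[IF dis] [ind fo] sI sF w]]]|[F [FV hit noI hF [fo w]]]].
  have FV : F \subset vertices G by rewrite -IF subsetUr.
  have inI u : u \in vertices G -> u \notin F -> u \in I.
    by rewrite -IF inE => /orP [//|->].
  exists F; split=> //.
  - move=> u v uv; have [uV vV] := adj_vertices uv.
    apply/negPn/negP; rewrite negb_or => /andP [uF vF].
    by have := ind u v (inI _ uV uF) (inI _ vV vF); rewrite uv.
  - move=> u uV cu; have : u \in I by apply: (subsetP sI); rewrite inE uV cu eqxx.
    by move=> uI; rewrite (disjointFr dis uI).
  - move=> u j uV cu; apply: (subsetP (sF j _)); last by rewrite inE uV cu eqxx.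
    by have := hc u uV; rewrite cu.
  - split=> [s s3 /andP [cs us]|x xF].
      apply: (fo s s3); rewrite /ucycle us andbT.
      by rewrite (eq_cycle (restr_induced G F)).
    have := w x xF; rewrite component_induced //.
    by congr (_ <= _)%N; apply: eq_bigl => y; rewrite inE.
exists (vertices G :\: F), F; split.
- split; first by apply/setP => x; rewrite !inE; have [/(subsetP FV) ->|_] := boolP (x \in F); rewrite ?orbT ?orbF.
  by rewrite -setI_eq0; apply/eqP/setP => x; rewrite !inE andbAC andNb.
- split.
    move=> x y; rewrite !inE => /andP [xF _] /andP [yF _].
    by apply/negP => /hit; rewrite (negPf xF) (negPf yF).
  move=> s s3; rewrite /ucycle (eq_cycle (restr_induced G F)); exact: fo.
- by apply/subsetP => x; rewrite !inE => /andP [xV /eqP cx]; rewrite xV noI.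
- by move=> j _; apply/subsetP => x; rewrite !inE => /andP [xV /eqP cx]; apply: hF cx.
move=> x xF; rewrite component_induced //; apply: leq_trans (w x xF).
by rewrite leq_eqVlt; apply/orP; left; apply/eqP/eq_bigl => y; rewrite inE.
Qed.

Lemma eq_colorable G c c' :
  {in vertices G, c =1 c'} -> colorable G c -> colorable G c'.
Proof.
move=> E [F [FV hit noI hF sf]]; exists F; split=> //.
- by move=> u uV; rewrite -E //; apply: noI.
- by move=> u j uV; rewrite -E //; apply: hF.
by apply: (sub_small_forest sf) => // u uF; rewrite E // (subsetP FV).
Qed.

Definition critical G c : Prop :=
  ~ colorable G c /\ forall H, proper_subgraph H G -> colorable H c.

Lemma subgraph_trans G1 G2 G3 : subgraph G1 G2 -> subgraph G2 G3 -> subgraph G1 G3.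
Proof.
move=> /andP [a b] /andP [c d].
by rewrite /subgraph (subset_trans a c) (subset_trans b d).
Qed.

Lemma subgraph_refl G : subgraph G G.
Proof. by rewrite /subgraph !subxx. Qed.

Lemma exists_critical G c : ~ colorable G c ->
  exists H, subgraph H G /\ critical H c.
Proof.
have [n] := ubnP (#|vertices G| + #|edges G|)%N.
elim: n G => // n IH G Gn nG.
have [allc|nall] := classic (forall H, proper_subgraph H G -> colorable H c).
  by exists G; rewrite subgraph_refl.
have [H nH'] := not_all_ex_not _ _ nall; have [HG nH] := imply_to_and _ _ nH'.
have [/andP [sv se] ns] := andP HG.
have small : (#|vertices H| + #|edges H| < n)%N.
  rewrite ltnS in Gn; apply: leq_trans Gn.
  have cv := subset_leq_card sv; have ce := subset_leq_card se.
  rewrite ltn_neqAle leq_add // andbT; apply: contraNneq ns => E.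
  have Ev : #|vertices H| = #|vertices G| by lia.
  have Ee : #|edges H| = #|edges G| by lia.
  have -> : subgraph G H = (vertices H == vertices G) && (edges H == edges G).
    by rewrite !eqEsubset sv se.
  by rewrite !eqEcard sv se Ev Ee !leqnn.
have [H' [H'H cH']] := IH H small nH.
by exists H'; split=> //; apply: subgraph_trans H'H (proj1 (andP HG)).
Qed.

(* A vertex without neighbors can always be added to a coloring. *)
Lemma critical_neighbor G c v : (0 < k)%N -> precoloring k G c -> critical G c ->
  v \in vertices G -> exists u, adj G v u.
Proof.
move=> k0 hc [nG crit] vG; apply: NNPP => iso; apply: nG.
have nv u : ~~ adj G v u by apply/negP => vu; apply: iso; exists u.
pose H := mkgraph (vertices G :\ v) (edges G).
have [|F [FV hit noI hF sf]] := crit H.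
  rewrite /proper_subgraph /subgraph /= subD1set /=; apply/andP; split.
    by apply/subsetP => A; rewrite inE => /and3P [].
  apply/negP => /andP [/subsetP /(_ v vG)]; by rewrite !inE eqxx.
have HG u w : adj G u w -> adj H u w.
  move=> uw; have [uG wG] := adj_vertices uw.
  rewrite adj_mkgraph (adj_neq uw) !inE uG wG !andbT; apply/and3P; split=> //.
    by apply: contraTneq uw => ->; rewrite nv.
  by apply: contraTneq uw => ->; rewrite adj_sym nv.
have hit' u w : adj G u w -> (u \in F) || (w \in F) by move=> /HG /hit.
have vF : v \notin F by apply/negP => /(subsetP FV); rewrite !inE eqxx.
have sf' : small_forest k (adj G) (fun u => weight (c u)) F.
  by apply: (sub_small_forest sf) => // u w _ _; apply: HG.
have FG : F \subset vertices G by apply: subset_trans FV (subD1set _ _).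
have [cv|cv] := eqVneq (c v) PI.
  exists F; split=> // [u uG cu|u j uG cu].
    by have [->//|uv] := eqVneq u v; apply: noI cu; rewrite !inE uv.
  have [uv|uv] := eqVneq u v; first by rewrite uv cv in cu.
  by apply: hF cu; rewrite !inE uv.
exists (v |: F); split.
- by rewrite subUset sub1set vG.
- by move=> u w /hit' /orP [] h; rewrite !inE h ?orbT.
- move=> u uG cu; have uv : u != v by apply: contraNneq cv => <-; rewrite cu.
  by rewrite !inE (negPf uv) noI // !inE uv.
- move=> u j uG cu; have [->|uv] := eqVneq u v; first by rewrite !inE eqxx.
  by rewrite !inE (hF u j) ?orbT // !inE uv.
apply: small_forest_isolated => //; [exact: adj_sym|exact: adj_irr|].
by have := hc v vG; case: (c v) cv => //= j _ /andP [].
Qed.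

(** The potential of the statement with [coef] in place of [C_F]; a sum over vertices makes the
    effect of changing one class immediate. *)
Definition pot G c W : int :=
  \sum_(v in W) coef k (c v) - C_E k * #|[set A in edges G | A \subset W]|%:Z.

End Colorings.

(** * Reductions *)

Section Reductions.
Variables (T : finType) (k : nat) (G : graph T) (c : T -> precolor).
Hypotheses (k2 : (2 <= k)%N) (hc : precoloring k G c).
Hypothesis G_critical : critical k G c.
Hypothesis IH : forall (H : graph T) c', (#|edges H| < #|edges G|)%N ->
  precoloring k H c' -> critical k H c' -> pot k H c' (vertices H) <= -3.

Let V := vertices G.

Lemma pot_le_edges (W : {set T}) (L : seq {set T}) :
  uniq L -> all (fun A => (A \in edges G) && (A \subset W)) L ->
  pot k G c W <= \sum_(v in W) coef k (c v) - C_E k * (size L)%:Z.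
Proof.
move=> uL aL; rewrite /pot lerD2l lerN2 ler_wpM2l ?C_E_ge0 //.
rewrite lez_nat -(card_uniqP uL); apply: subset_leq_card.
by apply/subsetP => A /(allP aL); rewrite inE.
Qed.

Lemma colorable_del (E' : {set {set T}}) :
  E' \proper edges G -> colorable k (mkgraph V E') c.
Proof.
move=> pE; apply: (proj2 G_critical).
have [sE nE] := andP pE.
rewrite /proper_subgraph /subgraph /= !subxx /=; apply/andP; split.
  by apply/subsetP => A; rewrite inE => /andP [/(subsetP sE)].
apply: contra nE => /subsetP h; apply/subsetP => A /h.
by rewrite inE => /andP [].
Qed.

(* Deleting edges and changing the precoloring of [G] so that no coloring
   exists leaves, by induction, a set of potential at most -3 in the new graph,
   spanning a critical subgraph.  The last clause evaluates this bound in [G]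
   after adding vertices [X] and recovering edges [L]. *)
Lemma reduction (E' : {set {set T}}) c' :
  E' \proper edges G -> {in V, forall v, valid_precolor k (c' v)} ->
  ~ colorable k (mkgraph V E') c' ->
  exists W : {set T},
  [/\ W \subset V,
      {in W, forall v, exists2 u, u \in W & [set v; u] \in E'},
      exists2 v, v \in W & c' v != c v
    & forall (X : {set T}) (L : seq {set T}), [disjoint W & X] -> uniq L ->
        all (fun A => [&& A \in edges G, A \subset W :|: X &
                          ~~ ((A \in E') && (A \subset W))]) L ->
        pot k G c (W :|: X) <= -3 + \sum_(v in W) (coef k (c v) - coef k (c' v))
                                + \sum_(v in X) coef k (c v) - C_E k * (size L)%:Z].
Proof.
move=> pE hc' ncol.
have [H [HG' Hcrit]] := exists_critical ncol.
have [HV HE] := andP HG'; rewrite /= in HV HE.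
have HE' : edges H \subset E'.
  by apply: subset_trans HE _; apply/subsetP => A; rewrite inE => /andP [].
have [sE nE] := andP pE.
have hcH : precoloring k H c' by move=> v /(subsetP HV); apply: hc'.
exists (vertices H); split=> //.
- move=> v vH; have [u vu] := critical_neighbor (ltnW k2) hcH Hcrit vH.
  exists u; first by have [] := adj_vertices vu.
  exact: (subsetP HE').
(* If no class changed on W, the critical subgraph would be a proper subgraph of G with the original
   precoloring, hence colorable. *)
- apply: NNPP => same; case: Hcrit => ncH _; apply: ncH.
  apply: (@eq_colorable _ k H c).
    by move=> v vH; apply/eqP/negPn/negP => h; apply: same; exists v; rewrite // eq_sym.
  apply: (proj2 G_critical); rewrite /proper_subgraph /subgraph HV /=.
  rewrite (subset_trans HE' sE) /=; apply: contra nE => /andP [_ h].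
  exact: subset_trans h HE'.
move=> X L dWX uL aL.
have lt : (#|edges H| < #|edges G|)%N.
  by apply: leq_ltn_trans (proper_card pE); apply: subset_leq_card.
have := IH lt hcH Hcrit; rewrite /pot.
set n := #|_|; have hn : (n <= #|[set A in E' | A \subset vertices H]|)%N.
  by apply: subset_leq_card; apply/subsetP => A; rewrite !inE => /andP [/(subsetP HE') -> ->].
have -> : \sum_(v in vertices H :|: X) coef k (c v) =
    \sum_(v in vertices H) coef k (c v) + \sum_(v in X) coef k (c v).
  by rewrite -bigU //=; apply: eq_bigl => v; rewrite !inE.
rewrite sumrB.
set m := #|[set A in edges G | _]|.
(* The edges of L are not among those already counted in W, so the two counts add. *)
have hm : (#|[set A in E' | A \subset vertices H]| + size L <= m)%N.
  rewrite -(card_uniqP uL) -cardUI.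
  rewrite [X in (_ + X)%N](_ : _ = 0%N) ?addn0; last first.
    apply: eq_card0 => A; rewrite !inE; apply/negP.
    by move=> /andP [h /(allP aL) /and3P [_ _]]; rewrite h.
  apply: subset_leq_card; apply/subsetP => A; rewrite !inE => /orP [/andP [AE AH]|/(allP aL)].
    by rewrite (subsetP sE) // (subset_trans AH) // subsetUl.
  by move=> /and3P [-> ->].
have : C_E k * (n%:Z + (size L)%:Z) <= C_E k * m%:Z.
  by rewrite ler_wpM2l ?C_E_ge0 // lez_nat; apply: leq_trans hm; rewrite leq_add2r.
rewrite mulrDr.
move: (\sum_(v in vertices H) coef k (c v)) (\sum_(v in vertices H) coef k (c' v)) => s s'.
move: (\sum_(v in X) _) => sX.
move: (C_E k * n%:Z) (C_E k * m%:Z) (C_E k * (size L)%:Z) => x y z.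
by clear; lia.
Qed.

End Reductions.

Lemma small_forest_disjoint (T : finType) k (e : rel T) w (A B : {set T}) :
  symmetric e -> small_forest k e w A -> small_forest k e w B ->
  (forall u v, u \in A -> v \in B -> u != v /\ ~~ e u v) ->
  small_forest k e w (A :|: B).
Proof.
move=> es [HcA HwA] [HcB HwB] AB.
set r := restr e (A :|: B).
have stepA u v : u \in A -> r u v -> (v \in A) && restr e A u v.
  move=> uA /and3P [_]; rewrite in_setU /restr /= uA => /orP [-> -> //|vB uv].
  by have [_ /negP] := AB u v uA vB.
have stepB u v : u \in B -> r u v -> (v \in B) && restr e B u v.
  move=> uB /and3P [_]; rewrite in_setU /restr /= uB => /orP [vA uv|-> -> //].
  by have [_ /negP] := AB v u vA uB; rewrite es.
split=> [[//|a p] s3 /andP [cs us]|y].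
  have pa : path r a p by move: cs; rewrite /= rcons_path => /andP [].
  have aAB : a \in A :|: B.
    have U : ucycle r (a :: p) by rewrite /ucycle cs.
    have [b [_ [_ _ _ /and3P [h _ _] _]]] := ucycle_two_neighbors s3 U (mem_head a p).
    exact: h.
  have side (C : {set T}) : all (mem C) (a :: p) -> ucycle (restr e C) (a :: p).
    move=> h; rewrite /ucycle us andbT; apply: (sub_in_cycle _ h) cs.
    by move=> u v uC vC /and3P [_ _ uv]; apply/and3P.
  move: aAB; rewrite in_setU => /orP [aA|aB].
    apply: (HcA _ s3); apply: side; apply: path_all_invariant pa aA _.
    by move=> u v uA _ /(stepA _ _ uA) /andP [].
  apply: (HcB _ s3); apply: side; apply: path_all_invariant pa aB _.
  by move=> u v uB _ /(stepB _ _ uB) /andP [].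
rewrite in_setU => /orP [yA|yB].
  apply: leq_trans (HwA y yA); rewrite [leqRHS]big_mkcond [leqLHS]big_mkcond.
  apply: leq_sum => v _; case: ifP => // yv.
  have -> // : connect (restr e A) y v.
  apply: (@connect_invariant _ r (fun v => connect (restr e A) y v) y v _ _ yv).
    exact: connect0.
  move=> a b ya /(stepA _ _ (connect_restrS yA ya)) /andP [_ ab].
  exact: connect_trans ya (connect1 ab).
apply: leq_trans (HwB y yB); rewrite [leqRHS]big_mkcond [leqLHS]big_mkcond.
apply: leq_sum => v _; case: ifP => // yv.
have -> // : connect (restr e B) y v.
apply: (@connect_invariant _ r (fun v => connect (restr e B) y v) y v _ _ yv).
  exact: connect0.
move=> a b ya /(stepB _ _ (connect_restrS yB ya)) /andP [_ ab].
exact: connect_trans ya (connect1 ab).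
Qed.

Lemma small_forest_pair (T : finType) k (e : rel T) w (F : {set T}) u v :
  small_forest k e w F -> u \in F -> v \in F -> u != v -> e u v -> (w u + w v <= k)%N.
Proof.
move=> [_ Hw] uF vF uv euv; apply: leq_trans (Hw u uF).
rewrite (bigD1 u) ?connect0 //= leq_add2l (bigD1 v) /= ?leq_addr //.
by rewrite eq_sym uv andbT connect1 // /restr /= uF vF.
Qed.

(** * Changing the class of a single vertex *)

Section PrecolorChange.
Variables (T : finType) (k : nat) (G : graph T) (c : T -> precolor).
Hypotheses (k2 : (2 <= k)%N) (hc : precoloring k G c).
Hypothesis G_critical : critical k G c.
Hypothesis IH : forall (H : graph T) c', (#|edges H| < #|edges G|)%N ->
  precoloring k H c' -> critical k H c' -> pot k H c' (vertices H) <= -3.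

Let V := vertices G.

Definition upd (c : T -> precolor) x p : T -> precolor :=
  fun u => if u == x then p else c u.

Lemma adj_sub (E' : {set {set T}}) u v : E' \subset edges G ->
  adj (mkgraph V E') u v = ([set u; v] \in E').
Proof.
move=> sE; rewrite adj_mkgraph; apply/idP/idP => [/andP []//|uvE].
have uv : adj G u v by apply: (subsetP sE).
by have [uV vV] := adj_vertices uv; rewrite uvE uV vV (adj_neq uv).
Qed.

Lemma disjoint_set0r (W : {set T}) : [disjoint W & set0].
Proof. by rewrite disjoints_subset setC0 subsetT. Qed.

Lemma upd_reduction (E' : {set {set T}}) x p :
  E' \proper edges G -> valid_precolor k p -> ~ colorable k (mkgraph V E') (upd c x p) ->
  exists W : {set T},
  [/\ W \subset V,
      {in W, forall v, exists2 u, u \in W & [set v; u] \in E'},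
      x \in W
    & forall (X : {set T}) (L : seq {set T}), [disjoint W & X] -> uniq L ->
        all (fun A => [&& A \in edges G, A \subset W :|: X &
                          ~~ ((A \in E') && (A \subset W))]) L ->
        pot k G c (W :|: X) <= -3 + (coef k (c x) - coef k p)
                                + \sum_(v in X) coef k (c v) - C_E k * (size L)%:Z].
Proof.
move=> pE vp ncol.
have hv : {in V, forall v, valid_precolor k (upd c x p v)}.
  by move=> v vV; rewrite /upd; case: ifP => // _; apply: hc.
have [W [WV nbW [v vW cv] HW]] := reduction k2 G_critical IH pE hv ncol.
have vx : v = x by apply/eqP; move: cv; rewrite /upd; case: (v == x); rewrite ?eqxx.
rewrite vx in vW; exists W; split=> // X L dX uL aL.
apply: le_trans (HW X L dX uL aL) _.
rewrite (bigD1 x) //= [X in -3 + (_ + X)]big1 ?addr0; last first.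
  by move=> u /andP [_ /negPf ux]; rewrite /upd ux subrr.
by rewrite /upd eqxx.
Qed.

Lemma upd_reduction0 (E' : {set {set T}}) x p :
  E' \proper edges G -> valid_precolor k p -> ~ colorable k (mkgraph V E') (upd c x p) ->
  exists W : {set T},
  [/\ W \subset V,
      {in W, forall v, exists2 u, u \in W & [set v; u] \in E'},
      x \in W,
      pot k G c W <= -3 + (coef k (c x) - coef k p)
    & forall (X : {set T}) (L : seq {set T}), [disjoint W & X] -> uniq L ->
        all (fun A => [&& A \in edges G, A \subset W :|: X &
                          ~~ ((A \in E') && (A \subset W))]) L ->
        pot k G c (W :|: X) <= -3 + (coef k (c x) - coef k p)
                                + \sum_(v in X) coef k (c v) - C_E k * (size L)%:Z].
Proof.
move=> pE vp ncol; have [W [WV nbW xW HW]] := upd_reduction pE vp ncol.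
exists W; split=> //; have := HW set0 [::] (disjoint_set0r W) isT isT.
by rewrite setU0 big_set0 mulr0 subr0 addr0.
Qed.

Lemma properD1_edges A : A \in edges G -> edges G :\ A \proper edges G.
Proof. exact: properD1. Qed.

(* An edge between a vertex colored F and a vertex colored I imposes nothing. *)
Lemma no_forced_edge x y j : adj G x y -> c x = PF j -> c y = PI -> False.
Proof.
move=> xy cx cy; apply: (proj1 G_critical).
have [xV yV] := adj_vertices xy.
have pE := properD1_edges xy; have [sE _] := andP pE.
have [F [FV hit noI hF sf]] := colorable_del G_critical pE.
have xF := hF _ _ xV cx; have yF := noI _ yV cy.
exists F; split=> //.
  move=> u v uv; have [E|ne] := eqVneq [set u; v] [set x; y].
    have : x \in [set u; v] by rewrite E !inE eqxx.
    by rewrite !inE => /orP [] /eqP <-; rewrite xF ?orbT.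
  by apply: hit; rewrite adj_sub // in_setD1 ne.
apply: (sub_small_forest sf) => // u v uF vF uv.
rewrite adj_sub // in_setD1 andbC; apply/andP; split=> //.
apply: contraNneq yF => E.
have : y \in [set u; v] by rewrite E !inE eqxx orbT.
by rewrite !inE => /orP [] /eqP ->.
Qed.

(* The vertex [x] precolored F keeps its weight when an edge [xy] is replaced
   by coloring [y] with I. *)
Lemma force_I_uncolorable x y i a : adj G x y -> c x = PF i -> c y = PU a ->
  ~ colorable k (mkgraph V (edges G :\ [set x; y])) (upd c y PI).
Proof.
move=> xy cx cy [F [FV hit noI hF sf]]; apply: (proj1 G_critical).
have [xV yV] := adj_vertices xy; have ne := adj_neq xy.
have pE := properD1_edges xy; have [sE _] := andP pE.
have yF : y \notin F by apply: noI; rewrite /upd ?eqxx.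
have xF : x \in F by apply: (hF x i) => //; rewrite /upd (negPf ne).
exists F; split=> //.
- move=> u v uv; have [E|nE] := eqVneq [set u; v] [set x; y].
    have : x \in [set u; v] by rewrite E !inE eqxx.
    by rewrite !inE => /orP [] /eqP <-; rewrite xF ?orbT.
  by apply: hit; rewrite adj_sub // in_setD1 nE.
- by move=> u uV cu; apply: noI => //; rewrite /upd; case: ifP.
- move=> u j uV cu; apply: (hF u j) => //; rewrite /upd; case: eqP => // E.
  by rewrite E cy in cu.
apply: (sub_small_forest sf) => // [u v uF vF uv|u uF].
  rewrite adj_sub // in_setD1 andbC; apply/andP; split=> //.
  apply: contraNneq yF => E.
  have : y \in [set u; v] by rewrite E !inE eqxx orbT.
  by rewrite !inE => /orP [] /eqP ->.
by rewrite /upd; case: eqP uF => // ->; rewrite (negPf yF).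
Qed.

Lemma pot_setD1 (R : {set T}) x : x \in R -> (forall u, u \in R -> ~~ adj G x u) ->
  pot k G c (R :\ x) = pot k G c R - coef k (c x).
Proof.
move=> xR nx; rewrite /pot (big_setD1 x xR) /=.
have -> : [set A in edges G | A \subset R :\ x] = [set A in edges G | A \subset R].
  apply/setP => A; rewrite !inE; case AG: (A \in edges G) => //=.
  rewrite subsetD1 andbC; case: (boolP (A \subset R)) => AR; rewrite ?andbF // andbT.
  apply/negP => xA; have [u [v [E uv]]] := edge_adj AG.
  move: AR xA uv; rewrite E pair_in !inE => /andP [uR vR] /orP [] /eqP <-.
    by rewrite (negPf (nx v vR)).
  by rewrite adj_sym (negPf (nx u uR)).
by rewrite addrAC [coef k (c x) + _]addrC addrK.
Qed.

End PrecolorChange.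

(** * The gap lemma *)

(** The witness is r / 3 rounded up, or 0 for negative r. The bound [3t <= r + 2] puts -3 + 3t below
    r, and [t <= k./2] holds because [C_I k] is at most 3m - 1. *)
Lemma ceil_third k (r : int) : (2 <= k)%N -> r <= C_I k ->
  exists t, [/\ (t <= k./2)%N, r <= 3 * t%:Z & t = 0%N \/ 3 * t%:Z <= r + 2].
Proof.
rewrite C_I_half => k2 hr; case: r hr => n hr; last by exists 0%N; split; [|lia|left].
exists ((n + 2) %/ 3)%N; have := half_double_odd k.
by case: (odd k) hr => hr kE; split; [lia|lia|right; lia|lia|lia|right; lia].
Qed.

(** The boundary vertex x, placed in class [PF (k - t)], has to pay for r. For k = 2m + 1, t = m and
    r = C_I = 3m - 1 this is an equality, whereas [C_F] would give only 3m - 2: this is where the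
    raised coefficient is needed. *)
Lemma coef_hub k t r : (2 <= k)%N -> (t <= k./2)%N -> r <= 3 * t%:Z -> r <= C_I k ->
  r <= coef k (PF (k - t)).
Proof.
rewrite C_I_half => k2 tk rt; coef_lia k.
Qed.

(** Since i > k - t >= k / 2, the coefficient is at most 3(k - i) <= 3(t - 1). *)
Lemma coef_overflow k t i (r : int) : (i <= k)%N -> (t <= k./2)%N -> (k < i + t)%N ->
  3 * t%:Z <= r + 2 -> coef k (PF i) <= r - 1.
Proof. by move=> ik tk it rt; coef_lia k. Qed.

Lemma coef_F_le k a : (2 <= k)%N -> (1 <= a)%N -> (a <= k)%N -> coef k (PF a) <= C_E k - 3.
Proof. by move=> k2 a1 ak; coef_lia k. Qed.

Lemma coef_U_I k a : coef k (PU a) - coef k PI = C_E k - 3 * a%:Z.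
Proof. coef_lia k. Qed.

Lemma C_I_le_E k : (2 <= k)%N -> C_I k <= C_E k - 3.
Proof. by move=> k2; rewrite C_I_half C_E_half; lia. Qed.

Section Gap.
Variables (T : finType) (k : nat) (G : graph T) (c : T -> precolor).
Hypotheses (k2 : (2 <= k)%N) (hc : precoloring k G c).
Hypothesis G_critical : critical k G c.
Hypothesis IH : forall (H : graph T) c', (#|edges H| < #|edges G|)%N ->
  precoloring k H c' -> critical k H c' -> pot k H c' (vertices H) <= -3.
Hypothesis Gpot : -3 < pot k G c (vertices G).

Let V := vertices G.

Definition spans_edge (R : {set T}) := [exists A in edges G, A \subset R].

Lemma spans_edge_adj (R : {set T}) x y : adj G x y -> x \in R -> y \in R -> spans_edge R.
Proof.
move=> xy xR yR; apply/existsP; exists [set x; y]; rewrite pair_in xR yR !andbT.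
exact: xy.
Qed.

(* [R] minimizes the potential among the proper sets spanning an edge. *)
Section Minimal.
Variables (R : {set T}) (t : nat).
Hypotheses (RV : R \proper V) (Redge : spans_edge R).
Hypothesis Rmin : forall Q : {set T}, Q \proper V -> spans_edge Q ->
  pot k G c R <= pot k G c Q.
Hypotheses (Rlow : pot k G c R <= C_I k) (tk : (t <= k./2)%N).
Hypotheses (Rt : pot k G c R <= 3 * t%:Z) (tR : t = 0%N \/ 3 * t%:Z <= pot k G c R + 2).

Let r := pot k G c R.

(** Otherwise R and its complement could be colored separately: the edges inside R and the remaining
    ones would both be proper parts of the edge set, and the two colorings would not interact. *)
Lemma boundary_edge : exists x y, [/\ x \in R, y \in V, y \notin R & adj G x y].
Proof.
apply: NNPP => nob.
have noadj x y : x \in R -> y \notin R -> ~~ adj G x y.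
  move=> xR yR; apply/negP => xy; apply: nob; exists x, y; split=> //.
  by have [] := adj_vertices xy.
have [RV' [v0 v0V v0R]] := properP RV.
have [u0 vu0] := critical_neighbor (ltnW k2) hc G_critical v0V.
have u0R : u0 \notin R.
  by apply/negP => u0R; have := noadj _ _ u0R v0R; rewrite adj_sym vu0.
pose E1 := [set A in edges G | A \subset R]; pose E2 := [set A in edges G | ~~ (A \subset R)].
have sub1 : E1 \subset edges G by apply/subsetP => A; rewrite inE => /andP [].
have sub2 : E2 \subset edges G by apply/subsetP => A; rewrite inE => /andP [].
have p1 : E1 \proper edges G.
  apply/properP; split=> //; exists [set v0; u0]; first exact: vu0.
  by rewrite inE pair_in (negPf v0R) andbF.
have p2 : E2 \proper edges G.
  have /existsP [A /andP [AG AR]] := Redge.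
  by apply/properP; split=> //; exists A => //; rewrite inE AR andbF.
have [F1 [FV1 hit1 noI1 hF1 sf1]] := colorable_del G_critical p1.
have [F2 [FV2 hit2 noI2 hF2 sf2]] := colorable_del G_critical p2.
apply: (proj1 G_critical); exists ((F1 :&: R) :|: (F2 :\: R)).
have memF u : (u \in (F1 :&: R) :|: (F2 :\: R)) = if u \in R then u \in F1 else u \in F2.
  by rewrite !inE; case: (u \in R); rewrite ?andbT ?andbF ?orbF.
split.
- by apply/subsetP => u; rewrite memF; case: ifP => _; [move/(subsetP FV1)|move/(subsetP FV2)].
- move=> u v uv; rewrite !memF.
  have [uR|uR] := boolP (u \in R); have [vR|vR] := boolP (v \in R).
  + by apply: hit1; rewrite adj_sub // inE pair_in uR vR !andbT; exact: uv.
  + by have := noadj _ _ uR vR; rewrite uv.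
  + by have := noadj _ _ vR uR; rewrite adj_sym uv.
  + by apply: hit2; rewrite adj_sub // inE pair_in (negPf uR) !andbT; exact: uv.
- by move=> u uV cu; rewrite memF; case: ifP => _; [apply: noI1|apply: noI2].
- by move=> u j uV cu; rewrite memF; case: ifP => _; [apply: hF1 cu|apply: hF2 cu].
apply: small_forest_disjoint; first exact: adj_sym.
- apply: (sub_small_forest sf1) => //; first exact: subsetIl.
  by move=> u v /setIP [_ uR] /setIP [_ vR] uv; rewrite adj_sub // inE pair_in uR vR !andbT; exact: uv.
- apply: (sub_small_forest sf2) => //; first exact: subsetDl.
  by move=> u v /setDP [_ uR] /setDP [_ vR] uv; rewrite adj_sub // inE pair_in (negPf uR) !andbT; exact: uv.
move=> u v /setIP [_ uR] /setDP [_ vR]; split; last exact: noadj.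
by apply: contraNneq vR => <-.
Qed.

Lemma proper_low_absurd (Q : {set T}) : Q \proper V -> spans_edge Q -> pot k G c Q <= r - 1 -> False.
Proof. by move=> QV Qe Ql; have := Rmin QV Qe; rewrite -/r; move: Ql; clear; lia. Qed.

Lemma full_low_absurd (Q : {set T}) : Q = V -> pot k G c Q <= -3 -> False.
Proof. by move=> ->; move: Gpot; rewrite -/V; clear; lia. Qed.

(* The boundary vertex [x] can take [t] more fake neighbors.  Otherwise it is
   precolored F with [coef (c x) < r]; its outer neighbor cannot be F, as the
   pair would have potential below [r], and forcing it to be I is harmless. *)
Lemma boundary_inc_valid x y : x \in R -> y \notin R -> adj G x y -> inc_valid k t (c x).
Proof.
move=> xR yR xy; have [xV yV] := adj_vertices xy; have xney := adj_neq xy.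
have exy : [set x; y] \in edges G := xy.
case cx: (c x) => [//|i|//] /=; rewrite leqNgt; apply/negP => it.
have ik : (1 <= i <= k)%N by have := hc xV; rewrite cx.
have t1 : 3 * t%:Z <= r + 2.
  by case: tR => // t0; move: it ik; rewrite t0; clear; lia.
have r1 : 1 <= r by move: it ik t1; clear; lia.
have coefi : coef k (PF i) <= r - 1.
  by apply: coef_overflow tk it t1; case/andP: ik.
have rE : r <= C_E k - 3 by apply: le_trans Rlow (C_I_le_E k2).
have pE := properD1_edges xy.
case cy: (c y) => [a|a|]; last exact: (no_forced_edge G_critical xy cx cy).
  have nc := force_I_uncolorable G_critical xy cx cy.
  have [W [WV nbW yW potW HW]] := upd_reduction0 k2 hc G_critical IH pE (isT : valid_precolor k PI) nc.
  rewrite cy coef_U_I in potW HW.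
  have eW : spans_edge W.
    have [u uW yu] := nbW y yW; apply: spans_edge_adj yW uW.
    by move: yu; rewrite in_setD1 => /andP [].
  (* If x is in W, the recovered edge xy cancels the price of turning [PU a] into [PI]. If not, x is
     added together with xy, which leaves at most [coef k (PF i) - 3], below r. *)
  have [xW|xW] := boolP (x \in W).
    have low : pot k G c W <= -3.
      rewrite -[W]setU0.
      apply: le_trans (HW set0 [:: [set x; y]] (disjoint_set0r W) isT _) _.
        by rewrite /= setU0 pair_in xW yW exy setD11.
      by rewrite big_set0 /=; clear; lia.
    have [WVe|WVe] := eqVneq W V; first exact: full_low_absurd WVe low.
    apply: (proper_low_absurd _ eW); first by rewrite properEneq WVe WV.
    by move: low r1; clear; lia.
  have dW : [disjoint W & [set x]] by rewrite disjoint_sym disjoints1.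
  have eQ : spans_edge (W :|: [set x]).
    by apply: (spans_edge_adj xy); rewrite !inE ?yW ?eqxx ?orbT.
  have low : pot k G c (W :|: [set x]) <= -3 - 3 * a%:Z + coef k (PF i).
    apply: le_trans (HW [set x] [:: [set x; y]] dW isT _) _.
      by rewrite /= exy setD11 pair_in !inE yW eqxx orbT.
    by rewrite big_set1 cx /=; clear; lia.
  have [QV|QV] := eqVneq (W :|: [set x]) V; last first.
    apply: (proper_low_absurd _ eQ); first by rewrite properEneq QV subUset WV sub1set xV.
    by move: low coefi; clear; lia.
  (* Now W and x make up V. A second neighbor of x supplies another recovered edge; without one, x
     is isolated in R, and minimality of r against [R :\ x] forces [coef k (c x) <= 0]. *)
  have [[u uy xu]|nou] := classic (exists2 u, u != y & adj G x u).
    have uW : u \in W.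
      have : u \in W :|: [set x] by rewrite QV; have [] := adj_vertices xu.
      by rewrite !inE eq_sym (negPf (adj_neq xu)) orbF.
    have ne : [set x; y] != [set x; u].
      apply: contraNneq uy => E.
      have : u \in [set x; y] by rewrite E !inE eqxx orbT.
      by rewrite !inE eq_sym (negPf (adj_neq xu)).
    have low2 : pot k G c (W :|: [set x]) <= -3 - 3 * a%:Z + coef k (PF i) - C_E k.
      have uL : uniq [:: [set x; y]; [set x; u]] by rewrite /= inE ne.
      apply: le_trans (HW [set x] [:: [set x; y]; [set x; u]] dW uL _) _.
        have exu : [set x; u] \in edges G := xu.
        by rewrite /= exy exu setD11 !pair_in !inE yW uW eqxx !orbT (negPf xW) /= andbF.
      by rewrite big_set1 cx /=; clear; lia.
    apply: full_low_absurd QV _.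
    by move: low2 coefi rE; clear; lia.
  have nx u : u \in R -> ~~ adj G x u.
    move=> uR; apply/negP => xu; apply: nou; exists u => //.
    by apply: contraNneq yR => <-.
  have eR1 : spans_edge (R :\ x).
    have /existsP [A /andP [AG AR]] := Redge; have [u [v [E uv]]] := edge_adj AG.
    move: AR; rewrite E pair_in => /andP [uR vR]; apply: (spans_edge_adj uv).
      rewrite !inE uR andbT; apply/eqP => ux; rewrite ux in uv.
      by have := nx v vR; rewrite uv.
    rewrite !inE vR andbT; apply/eqP => vx; rewrite vx adj_sym in uv.
    by have := nx u uR; rewrite uv.
  have RxV : R :\ x \proper V.
    by apply: sub_proper_trans RV; apply: subD1set.
  have := Rmin RxV eR1; rewrite (pot_setD1 k c xR nx) cx => h.
  apply: full_low_absurd QV _.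
  by move: low h; clear; lia.
have ak : (1 <= a <= k)%N by have := hc yV; rewrite cy.
apply: (@proper_low_absurd [set x; y]).
(* The pair is not all of V, because R misses y and still spans an edge. *)
- rewrite properEneq pair_in xV yV !andbT; apply/eqP => E.
  have /existsP [A /andP [AG AR]] := Redge; have [u [v [EA uv]]] := edge_adj AG.
  move: AR; rewrite EA pair_in => /andP [uR vR].
  have ux z : z \in R -> z = x.
    move=> zR; have : z \in [set x; y] by rewrite E (subsetP (proper_sub RV)).
    by rewrite !inE => /orP [] /eqP // zy; move: yR; rewrite -zy zR.
  by move: uv; rewrite (ux u uR) (ux v vR) adj_irr.
- by apply: (spans_edge_adj xy); rewrite !inE eqxx ?orbT.
have := @pot_le_edges T k G c k2 [set x; y] [:: [set x; y]] isT.
rewrite /= subxx exy => /(_ isT); rewrite big_setU1 ?inE //= big_set1 cx cy.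
have := @coef_F_le k a k2.
by case/andP: ak => -> -> /(_ isT isT); move: coefi; clear; lia.
Qed.

Let inner := [set A in edges G | A \subset R].
Let outer := [set A in edges G | ~~ (A \subset R)].

Let inner_sub : inner \subset edges G.
Proof. by apply/subsetP => A; rewrite inE => /andP []. Qed.

Let outer_sub : outer \subset edges G.
Proof. by apply/subsetP => A; rewrite inE => /andP []. Qed.

Let outer_proper : outer \proper edges G.
Proof.
have /existsP [A /andP [AG AR]] := Redge.
by apply/properP; split=> //; exists A => //; rewrite inE AR andbF.
Qed.

(** A failure would give a set inside R of potential at most -3 + 3t <= r - 1, against the
    minimality of r. For t = 0 the precoloring does not change and criticality applies. *)
Lemma colorable_inner x y : x \in R -> y \notin R -> adj G x y ->
  colorable k (mkgraph V inner) (upd c x (inc k t (c x))).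
Proof.
move=> xR yR xy; have [xV yV] := adj_vertices xy.
have iv := boundary_inc_valid xR yR xy.
have vi := valid_inc (hc xV) iv.
have p1 : inner \proper edges G.
  apply/properP; split=> //; exists [set x; y]; first exact: xy.
  by rewrite inE pair_in (negPf yR) !andbF.
apply: NNPP => nc.
have [W [WV nbW xW potW _]] := upd_reduction0 k2 hc G_critical IH p1 vi nc.
have WR : W \subset R.
  apply/subsetP => v vW; have [u uW] := nbW v vW.
  by rewrite inE pair_in => /and3P [].
have WpV : W \proper V by apply: sub_proper_trans WR RV.
have eW : spans_edge W.
  have [u uW xu] := nbW x xW; apply: spans_edge_adj xW uW.
  by move: xu; rewrite inE => /andP [].
have ci := coef_inc k2 (hc xV) iv.
case: tR => t0; last first.
  apply: (proper_low_absurd WpV eW); move: potW ci t0; rewrite -/r; clear; lia.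
case: nc; apply: (@eq_colorable _ k _ c).
  by move=> v vV; rewrite /upd; case: eqP => // ->; rewrite t0 (inc0 (hc xV)).
exact: colorable_del.
Qed.

Section Outer.
Variables (x y : T) (F1 : {set T}).
Hypotheses (xR : x \in R) (yR : y \notin R) (xy : adj G x y).
Hypothesis F1_good : good k (mkgraph V inner) (upd c x (inc k t (c x))) F1.

(* The coloring [F1] of [R] becomes part of the precoloring; only [x] may
   have neighbors colored F outside [R]. *)
Let c2 v := if v \in R then
    if v \in F1 then PF (if v == x then k - t else k)%N else PI
  else c v.

Let memF F v : good k (mkgraph V outer) c2 F -> v \in R -> (v \in F) = (v \in F1).
Proof.
move=> [FV hit noI hF sf] vR; have vV : v \in V by apply: (subsetP (proper_sub RV)).
case: (boolP (v \in F1)) => vF1.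
  by apply: (hF _ (if v == x then k - t else k)%N) => //; rewrite /c2 vR vF1.
by apply: negbTE; apply: (noI v vV); rewrite /c2 vR (negPf vF1).
Qed.

(** A coloring of the outer graph could be glued to [F1]. A vertex of R colored F other than x has
    weight k, hence no neighbor colored F outside R, so the two colorings meet at x only; there the
    weights [w x + t] and [k - t] add up to [k + w x], as gluing requires. *)
Lemma outer_uncolorable : ~ colorable k (mkgraph V outer) c2.
Proof.
move=> [F gF]; have memF' v := @memF F v gF; apply: (proj1 G_critical).
have [FV hit noI hF sf] := gF; have [FV1 hit1 noI1 hF1 sf1] := F1_good.
have innerE u v : u \in R -> v \in R -> adj G u v -> adj (mkgraph V inner) u v.
  by move=> uR vR uv; rewrite adj_sub // inE pair_in uR vR !andbT; exact: uv.
have outerE u v : (u \notin R) || (v \notin R) -> adj G u v -> adj (mkgraph V outer) u v.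
  by move=> h uv; rewrite adj_sub // inE pair_in negb_and h !andbT; exact: uv.
have tk' : (t <= k)%N by have := half_double_odd k; move: tk; clear; lia.
have notPI v : v \in F1 -> v \in R -> c v != PI.
  move=> vF vR; apply/eqP => cv; have vV := subsetP (proper_sub RV) _ vR.
  have := noI1 v vV; rewrite /upd; case: eqP => [E|_].
    by rewrite -E cv vF => /(_ erefl).
  by rewrite cv vF => /(_ erefl).
have cross u v : u \in F -> u \in R -> v \in F -> v \notin R -> adj G u v -> u = x.
  move=> uF uR vF vR uv; apply/eqP/negPn/negP => ux.
  have := small_forest_pair sf uF vF (adj_neq uv).
  rewrite outerE ?vR ?orbT // => /(_ isT).
  rewrite /c2 uR -memF' // uF (negPf ux) (negPf vR) /= => h.
  have vV := subsetP FV _ vF.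
  have := hc vV; have := noI v vV; rewrite /c2 (negPf vR) vF.
  case: (c v) h => [j|j|] /=; [|by move=> h _ /andP [j1 _]; move: h j1; clear; lia|by move=> _ /(_ erefl)].
  by clear; lia.
exists F; split=> //.
- move=> u v uv; have [uR|uR] := boolP (u \in R); last first.
    by apply: hit; rewrite outerE // uR.
  have [vR|vR] := boolP (v \in R); last first.
    by apply: hit; rewrite outerE // vR orbT.
  by rewrite !memF' //; apply: hit1; apply: innerE.
- move=> u uV cu; have [uR|uR] := boolP (u \in R).
    by rewrite memF' //; apply/negP => uF1; have := notPI u uF1 uR; rewrite cu.
  by apply: noI => //; rewrite /c2 (negPf uR).
- move=> u j uV cu; have [uR|uR] := boolP (u \in R).
    rewrite memF' //; case: (eqVneq u x) => ux.
      by apply: (hF1 _ (j + t)%N) => //; rewrite /upd ux eqxx -ux cu.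
    by apply: (hF1 _ j) => //; rewrite /upd (negPf ux).
  by apply: (hF _ j) => //; rewrite /c2 (negPf uR).
have sA : small_forest k (adj G) (fun u => weight (upd c x (inc k t (c x)) u)) (F :&: R).
  apply: (sub_small_forest sf1) => //.
    by apply/subsetP => u /setIP [uF uR]; rewrite -memF'.
  by move=> u v /setIP [_ uR] /setIP [_ vR]; apply: innerE.
have wA : {in F :&: R, forall u, (weight (c u) <= weight (upd c x (inc k t (c x)) u))%N}.
  move=> u /setIP [uF uR]; rewrite /upd; case: eqP => // E.
  rewrite weight_inc ?E ?leq_addr //; last by rewrite -E notPI // -memF'.
  apply/eqP => E'; have uV := subsetP FV _ uF.
  have := noI1 u uV; rewrite /upd E eqxx E' => /(_ erefl).
  by rewrite -E -memF' // uF.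
have sB (B : {set T}) : B \subset F -> {in B &, forall u v, (u \notin R) || (v \notin R) || (u == v)} ->
    small_forest k (adj G) (fun u => weight (c2 u)) B.
  move=> BF hB; apply: (sub_small_forest sf) => // u v uB vB uv.
  by apply: outerE => //; have := hB u v uB vB; rewrite (negPf (adj_neq uv)) orbF.
have [xF|xF] := boolP (x \in F).
  have -> : F = (F :&: R) :|: (x |: F :\: R).
    apply/setP => u; rewrite !inE; have [->|_] := eqVneq u x; first by rewrite xF xR.
    by case: (u \in F); case: (u \in R).
  apply: (@small_forest_glue _ _ _ _ _ _ _ _ x (@adj_sym _ G) sA).
  - apply: sB; first by rewrite subUset sub1set xF subsetDl.
    move=> u v; rewrite !inE => /orP [/eqP ->|/andP [-> //]] /orP [/eqP ->|/andP [-> _]].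
      by rewrite eqxx orbT.
    by rewrite orbT.
  - by rewrite !inE xF xR eqxx.
  - by move=> u /setIP [_ uR]; rewrite !inE uR /= orbF => /eqP.
  - move=> u v /setIP [uF uR]; rewrite !inE => /orP [/eqP ->|/andP [vR vF] uv]; first by right.
    by left; apply: cross uv.
  - exact: wA.
  - move=> u; rewrite !inE => /orP [/eqP ->|/andP [uR uF]]; last by rewrite /c2 (negPf uR).
    have xF1 : x \in F1 by rewrite -memF'.
    have xA : x \in F :&: R by rewrite inE xF xR.
    have := small_forest_set1 sA xA; rewrite /upd eqxx weight_inc ?notPI //.
      by rewrite /c2 xR xF1 eqxx /=; clear; lia.
    apply/eqP => E'; have := noI1 x (subsetP FV _ xF); rewrite /upd eqxx E' => /(_ erefl).
    by rewrite xF1.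
  have xF1 : x \in F1 by rewrite -memF'.
  rewrite /upd eqxx weight_inc ?notPI //.
    by rewrite /c2 xR xF1 eqxx /=; move: tk'; clear; lia.
  apply/eqP => E'; have := noI1 x (subsetP FV _ xF); rewrite /upd eqxx E' => /(_ erefl).
  by rewrite xF1.
rewrite -(setID F R); apply: small_forest_disjoint; first exact: adj_sym.
- exact: (sub_small_forest sA).
- apply: (@sub_small_forest _ _ _ _ _ _ (F :\: R) (F :\: R) (sB (F :\: R) _ _)) => //.
  + exact: subsetDl.
  + by move=> u v /setDP [_ ->].
  + by move=> u /setDP [_ uR]; rewrite /c2 (negPf uR).
move=> u v /setIP [uF uR] /setDP [vF vR]; split; first by apply: contraNneq vR => <-.
by apply: contraNN xF => uv; rewrite -(cross u v).
Qed.

(** Joining R to W raises the bound -3 by r and lowers it by the coefficients that [c2] has on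
    [W :&: R]. These are nonnegative, so the union has potential below r and must be V. *)
Lemma outer_absurd : False.
Proof.
have [xV yV] := adj_vertices xy.
have RsV := proper_sub RV.
have tk' : (t < k)%N.
  by apply: leq_ltn_trans tk _; have := half_double_odd k; move: k2; clear; lia.
have vc2 : {in V, forall v, valid_precolor k (c2 v)}.
  move=> v vV; rewrite /c2; case: ifP => _; last exact: hc.
  case: ifP => // _ /=; case: ifP => _; last by rewrite leqnn (ltnW k2).
  by rewrite subn_gt0 tk' leq_subr.
have [W [WV nbW _ HW]] := reduction k2 G_critical IH outer_proper vc2 outer_uncolorable.
have Q_eq : W :|: (R :\: W) = W :|: R.
  by apply/setP => u; rewrite !inE; case: (u \in W).
have dW : [disjoint W & R :\: W].
  by rewrite -setI_eq0; apply/eqP/setP => u; rewrite !inE; case: (u \in W).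
have sum_eq : \sum_(v in W) (coef k (c v) - coef k (c2 v)) + \sum_(v in R :\: W) coef k (c v) =
    \sum_(v in R) coef k (c v) - \sum_(v in W :&: R) coef k (c2 v).
  rewrite (big_setID R) /= [X in _ + X + _]big1 ?addr0; last first.
    by move=> v /setDP [_ vR]; rewrite /c2 (negPf vR) subrr.
  by rewrite sumrB [in RHS](big_setID W) /= setIC addrAC.
have c2_ge0 v : v \in W :&: R -> 0 <= coef k (c2 v).
  by move=> /setIP [/(subsetP WV) vV _]; apply: coef_ge0 => //; apply: vc2.
have eQ : spans_edge (W :|: R).
  have /existsP [A /andP [AG AR]] := Redge; apply/existsP; exists A.
  by rewrite AG (subset_trans AR) // subsetUr.
have inner_all : all (fun A : {set T} => [&& A \in edges G, A \subset W :|: R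
    & ~~ ((A \in outer) && (A \subset W))]) (enum inner).
  apply/allP => A; rewrite mem_enum inE => /andP [AG AR].
  by rewrite AG (subset_trans AR (subsetUr _ _)) inE AR andbF.
have size_inner : size (enum inner) = #|inner| by rewrite cardE.
have rE : r = \sum_(v in R) coef k (c v) - C_E k * #|inner|%:Z by [].
have low : pot k G c (W :|: R) <= -3 + r - \sum_(v in W :&: R) coef k (c2 v).
  have := HW (R :\: W) (enum inner) dW (enum_uniq _).
  rewrite Q_eq size_inner => /(_ inner_all) h; apply: le_trans h _.
  by rewrite rE -[X in X - _]addrA sum_eq; clear; lia.
have sum_ge0 : 0 <= \sum_(v in W :&: R) coef k (c2 v) by apply: sumr_ge0.
have [QV|QV] := eqVneq (W :|: R) V; last first.
  apply: (proper_low_absurd _ eQ); first by rewrite properEneq QV subUset WV.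
  by apply: le_trans low _; move: sum_ge0; clear; lia.
apply: (full_low_absurd QV).
(* If x lies in W, its coefficient under [c2] alone pays for r, whether x was recorded as
   [PF (k - t)] or as [PI]. *)
have [xW|xW] := boolP (x \in W).
  apply: le_trans low _.
  have xWR : x \in W :&: R by rewrite inE xW xR.
  rewrite -addrA gerDl subr_le0 (bigD1 x) //=; apply: ler_wpDr.
    by apply: sumr_ge0 => v /andP [/c2_ge0].
  rewrite /c2 xR eqxx; case: ifP => _; last exact: Rlow.
  exact: coef_hub.
(* If x is outside W, the edge xy is counted neither in W nor in R and pays [C_E k], which is at
   least r + 3. *)
have yW : y \in W.
  have : y \in W :|: R by rewrite QV.
  by rewrite inE (negPf yR) orbF.
have := HW (R :\: W) ([set x; y] :: enum inner) dW.
have nin : [set x; y] \notin enum inner by rewrite mem_enum inE pair_in (negPf yR) !andbF.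
have exy : [set x; y] \in edges G := xy.
rewrite /= nin enum_uniq Q_eq size_inner inner_all exy !pair_in !inE (negPf xW) yW xR /=.
rewrite !andbF => /(_ isT isT) h; apply: le_trans h _.
rewrite -[X in X - _]addrA sum_eq.
have h1 : r <= C_E k - 3 := le_trans Rlow (C_I_le_E k2).
move: h1 sum_ge0; rewrite rE [#|inner|.+1%:Z]intS mulrDr mulr1.
set a := \sum_(v in R) _; set b := \sum_(v in _) _; set e := C_E k * _.
by clear; lia.
Qed.

End Outer.

Lemma minimal_absurd : False.
Proof.
have [x [y [xR yV yR xy]]] := boundary_edge.
have [F1 gF1] := colorable_inner xR yR xy.
exact: outer_absurd xR yR xy gF1.
Qed.

End Minimal.

Lemma gap (R : {set T}) : R \proper V -> spans_edge R -> C_I k < pot k G c R.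
Proof.
move=> RV Re; rewrite ltNge; apply/negP => Rlow.
pose P (Q : {set T}) := (Q \proper V) && spans_edge Q.
have PR : P R by rewrite /P RV.
pose Q := [arg min_(Q < R | P Q) pot k G c Q]%O.
have [/andP [QV Qe] Qmin] : P Q /\ forall Q', P Q' -> pot k G c Q <= pot k G c Q'.
  by rewrite /Q; case: arg_minP => // Q0 PQ0 h.
have Qlow : pot k G c Q <= C_I k by apply: le_trans (Qmin R PR) Rlow.
have [t [tk Qt tQ]] := ceil_third k2 Qlow.
apply: (@minimal_absurd Q t) => // Q' Q'V Q'e.
by apply: Qmin; rewrite /P Q'V.
Qed.

End Gap.

(** * Reducible configurations *)

(** An equality while [j.+1 <= k./2]. Forcing a vertex to F after the inductive -3 thus ends exactly
    at the threshold of the gap lemma. *)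
Lemma coef_U_F k j : (2 <= k)%N -> (j < k)%N ->
  coef k (PU j) - coef k (PF j.+1) <= C_I k + 3.
Proof. by move=> k2 jk; coef_lia k. Qed.

Lemma coef_F_F k i j : (i <= k)%N -> (j <= k./2)%N -> (k < i + j)%N ->
  coef k (PF i) - 3 * j%:Z <= -3.
Proof. by move=> ik jk ij; coef_lia k. Qed.

Lemma coef_F_small k j : (j <= k./2)%N -> coef k (PF j) = C_E k - 3 * j%:Z.
Proof. by rewrite /coef => ->. Qed.

(** Leaf and isolated vertex in one statement: if x is not in F, then v is isolated and the reserve
    at x is not drawn on. *)
Lemma small_forest_add (T : finType) k (e : rel T) w0 w (F : {set T}) v x :
  symmetric e -> irreflexive e -> small_forest k e w0 F -> v \notin F ->
  {in F, forall u, e v u -> u = x} ->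
  {in F, forall u, (w u + (u == x) * w v <= w0 u)%N} -> (w v <= k)%N ->
  small_forest k e w (v |: F).
Proof.
move=> es ei sf vF Hv Hw wv; have [xF|xF] := boolP (x \in F).
  exact: small_forest_leaf Hw.
apply: small_forest_isolated => //.
  by apply: (sub_small_forest sf) => // u /Hw; apply: leq_trans; apply: leq_addr.
by move=> u uF; apply: contraNN xF => vu; rewrite -(Hv u uF vu).
Qed.

Section Reducible.
Variables (T : finType) (k : nat) (G : graph T) (c : T -> precolor).
Hypotheses (k2 : (2 <= k)%N) (hc : precoloring k G c).
Hypothesis G_critical : critical k G c.
Hypothesis IH : forall (H : graph T) c', (#|edges H| < #|edges G|)%N ->
  precoloring k H c' -> critical k H c' -> pot k H c' (vertices H) <= -3.
Hypothesis Gpot : -3 < pot k G c (vertices G).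

Let V := vertices G.

Lemma gap_absurd (Q : {set T}) v : Q \subset V -> v \in V -> v \notin Q ->
  spans_edge G Q -> pot k G c Q <= C_I k -> False.
Proof.
move=> QV vV vQ eQ; apply/negP; rewrite -ltNge.
apply: (gap k2 hc G_critical IH Gpot) => //.
by rewrite properE QV; apply/subsetPn; exists v.
Qed.

Lemma low_absurd (Q : {set T}) : Q \subset V -> spans_edge G Q ->
  pot k G c Q <= -3 -> False.
Proof.
move=> QV eQ low; have [QE|QE] := eqVneq Q V; first exact: full_low_absurd Gpot _ QE low.
have QV' : Q \proper V by rewrite properEneq QE.
have := gap k2 hc G_critical IH Gpot QV' eQ.
have : 0 <= coef k PI by apply: coef_ge0.
by rewrite /coef; move: low; clear; lia.
Qed.

(** Vertices of D are removed by deleting their edges only. They stay behind as isolated vertices,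
    which a critical subgraph never contains. *)
Definition avoid (D : {set T}) := [set A in edges G | [disjoint A & D]].

Lemma avoid_sub (D : {set T}) : avoid D \subset edges G.
Proof. by apply/subsetP => A; rewrite inE => /andP []. Qed.

Lemma avoid_proper (D : {set T}) u v : adj G u v -> u \in D -> avoid D \proper edges G.
Proof.
move=> uv uD; apply/properP; split; first exact: avoid_sub.
exists [set u; v]; first exact: uv.
rewrite inE negb_and; apply/orP; right; apply/negP => dis.
by have := disjointFr dis (set21 u v); rewrite uD.
Qed.

Lemma pair_avoid (D : {set T}) u v : ([set u; v] \in avoid D) = [&& adj G u v, u \notin D & v \notin D].
Proof.
rewrite inE -/(adj G u v); congr (_ && _).
by rewrite disjoints_subset pair_in !inE.
Qed.

Lemma adj_avoid (D : {set T}) u v :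
  adj (mkgraph V (avoid D)) u v = [&& adj G u v, u \notin D & v \notin D].
Proof. by rewrite adj_sub ?avoid_sub // pair_avoid. Qed.

Definition compatible (c' : T -> precolor) u :=
  (c u = PI -> c' u = PI) /\ (forall j, c u = PF j -> exists j', c' u = PF j').

(* Recoloring only the vertices of [D], with [X] colored F. *)
Lemma extend_coloring (D X F : {set T}) c' :
  good k (mkgraph V (avoid D)) c' F -> X \subset D -> D \subset V ->
  (forall u, u \in V -> u \notin D -> compatible c' u) ->
  (forall u v, u \in D -> adj G u v -> (u \in X) || (v \in F :\: D) || (v \in X)) ->
  (forall u, u \in D -> c u = PI -> u \notin X) ->
  (forall u j, u \in D -> c u = PF j -> u \in X) ->
  small_forest k (adj G) (fun u => weight (c u)) (X :|: F :\: D) ->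
  colorable k G c.
Proof.
move=> [FV hit noI hF _] XD DV comp hitD noID hFD sf; exists (X :|: F :\: D); split=> //.
- by rewrite subUset (subset_trans XD DV) (subset_trans (subsetDl _ _) FV).
- move=> u v uv; rewrite !in_setU.
  have [uD|uD] := boolP (u \in D).
    by have /orP [/orP [->|->]|->] := hitD u v uD uv; rewrite ?orbT.
  have [vD|vD] := boolP (v \in D).
    rewrite adj_sym in uv.
    by have /orP [/orP [->|->]|->] := hitD v u vD uv; rewrite ?orbT.
  have := hit u v; rewrite adj_avoid uv uD vD => /(_ isT).
  by rewrite !inE uD vD => /orP [->|->]; rewrite ?orbT.
- move=> u uV cu; rewrite !inE; have [uD|uD] := boolP (u \in D).
    by rewrite (negPf (noID u uD cu)).
  rewrite (contraNF (subsetP XD u) uD) /=; apply: noI => //.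
  by have [h _] := comp u uV uD; apply: h.
- move=> u j uV cu; rewrite !inE; have [uD|uD] := boolP (u \in D).
    by rewrite (hFD u j).
  have [_ h] := comp u uV uD; have [j' cj'] := h j cu.
  by rewrite (hF u j') ?orbT.
Qed.

Lemma small_forest_avoid (D F : {set T}) c' w :
  good k (mkgraph V (avoid D)) c' F -> {in F, forall u, (w u <= weight (c' u))%N} ->
  small_forest k (adj G) w (F :\: D).
Proof.
move=> [FV hit noI hF sf] hw; apply: (sub_small_forest sf); first exact: subsetDl.
  by move=> u v /setDP [_ uD] /setDP [_ vD] uv; rewrite adj_avoid uv uD vD.
by move=> u /setDP [uF _]; apply: hw.
Qed.

Definition incs (n : T -> nat) u := inc k (n u) (c u).

Lemma incs_compatible n u : compatible (incs n) u.
Proof.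
by rewrite /compatible /incs; split=> [->|j ->] //; exists (j + n u)%N.
Qed.

Lemma small_forest_incs (D F : {set T}) n :
  good k (mkgraph V (avoid D)) (incs n) F ->
  small_forest k (adj G) (fun u => weight (c u) + n u)%N (F :\: D).
Proof.
move=> gF; apply: (small_forest_avoid gF) => u uF.
have [FV _ noI _ _] := gF; have uV := subsetP FV _ uF.
have nI : incs n u != PI by apply: contraTneq uF => /(noI _ uV).
rewrite /incs weight_inc //; apply: contraNneq nI => cu.
by rewrite /incs cu.
Qed.

(** Each new fake neighbor is priced at 3 by [coef_inc]. The set W avoids D because each of its
    vertices keeps a neighbor. *)
Lemma incs_reduction (D : {set T}) n u0 v0 :
  adj G u0 v0 -> u0 \in D -> {in V, forall v, inc_valid k (n v) (c v)} ->
  ~ colorable k (mkgraph V (avoid D)) (incs n) ->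
  exists W : {set T},
  [/\ W \subset V, [disjoint W & D],
      exists2 v, v \in W & n v != 0%N, spans_edge G W
    & forall (X : {set T}) (L : seq {set T}), X \subset D -> uniq L ->
        all (fun A => [&& A \in edges G, A \subset W :|: X & ~~ [disjoint A & D]]) L ->
        pot k G c (W :|: X) <= -3 + 3 * (\sum_(v in W) n v)%N%:Z
                                + \sum_(v in X) coef k (c v) - C_E k * (size L)%:Z].
Proof.
move=> uv u0D iv nc.
have vi : {in V, forall v, valid_precolor k (incs n v)}.
  by move=> v vV; apply: valid_inc; [apply: hc|apply: iv].
have [W [WV nbW [v vW cv] HW]] := reduction k2 G_critical IH (avoid_proper uv u0D) vi nc.
have dWD : [disjoint W & D].
  rewrite disjoints_subset; apply/subsetP => z zW; have [z' _] := nbW z zW.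
  by rewrite pair_avoid inE => /and3P [].
exists W; split=> //.
- exists v => //; apply: contraNneq cv => nv.
  by rewrite /incs nv (inc0 (hc (subsetP WV _ vW))).
- have [v' v'W] := nbW v vW; rewrite pair_avoid => /andP [vv' _].
  exact: spans_edge_adj vv' vW v'W.
move=> X L XD uL aL.
have dWX : [disjoint W & X] by apply: disjointWr dWD.
apply: le_trans (HW X L dWX uL _) _.
  apply/allP => A /(allP aL) /and3P [-> -> nd] /=.
  by rewrite inE (negPf nd) andbF.
rewrite lerD2r lerD2r lerD2l -[(\sum_(v in W) n v)%N%:Z]natz natr_sum mulr_sumr.
apply: ler_sum => z /(subsetP WV) zV.
by rewrite [(n z)%:R]natz; exact: coef_inc k2 (hc zV) (iv z zV).
Qed.

(** A neighbor in class I would give a pair of potential 2 C_I - C_E = -3, and an F neighbor is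
    excluded by [no_forced_edge]. A neighbor in U is forced to F by v anyway, so the edge can be
    replaced by this precoloring at the price in [coef_U_F]. *)
Lemma no_I v : v \in V -> c v <> PI.
Proof.
move=> vV cv; have [w vw] := critical_neighbor (ltnW k2) hc G_critical vV.
have [_ wV] := adj_vertices vw; have nvw := adj_neq vw.
have evw : [set v; w] \in edges G := vw.
case cw: (c w) => [j|j|]; last first.
- apply: (@low_absurd [set v; w]); first by rewrite pair_in vV wV.
    by apply: (spans_edge_adj vw); rewrite !inE eqxx ?orbT.
  apply: le_trans (@pot_le_edges T k G c k2 _ [:: [set v; w]] isT _) _.
    by rewrite /= subxx evw.
  rewrite big_setU1 ?inE //= big_set1 cv cw /coef.
  by have := C_IE k; clear; lia.
- by rewrite adj_sym in vw; apply: (no_forced_edge G_critical vw cw cv).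
have jk : (j < k)%N by have := hc wV; rewrite cw.
have pE := properD1_edges vw.
have nc : ~ colorable k (mkgraph V (edges G :\ [set v; w])) (upd c w (PF j.+1)).
  move=> [F [FV hit noI hF sf]]; apply: (proj1 G_critical).
  have [sE _] := andP pE.
  have wF : w \in F by apply: (hF w j.+1) => //; rewrite /upd eqxx.
  have vF : v \notin F by apply: noI => //; rewrite /upd (negPf nvw).
  exists F; split=> //.
  - move=> x y xy; have [E|nE] := eqVneq [set x; y] [set v; w].
      have : w \in [set x; y] by rewrite E !inE eqxx orbT.
      by rewrite !inE => /orP [] /eqP <-; rewrite wF ?orbT.
    by apply: hit; rewrite adj_sub // in_setD1 nE.
  - move=> u uV cu; apply: noI => //; rewrite /upd; case: eqP => // E.
    by rewrite E cw in cu.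
  - move=> u i uV cu; apply: (hF u i) => //; rewrite /upd; case: eqP => // E.
    by rewrite E cw in cu.
  apply: (sub_small_forest sf) => // [x y xF yF xy|u uF].
    rewrite adj_sub // in_setD1 andbC; apply/andP; split=> //.
    apply: contraNneq vF => E.
    have : v \in [set x; y] by rewrite E !inE eqxx.
    by rewrite !inE => /orP [] /eqP ->.
  by rewrite /upd; case: eqP => // ->; rewrite cw.
have vp : valid_precolor k (PF j.+1) by [].
have [W [WV nbW wW potW HW]] := upd_reduction0 k2 hc G_critical IH pE vp nc.
have cd := coef_U_F k2 jk; rewrite cw in potW HW.
have eW : spans_edge G W.
  have [u uW wu] := nbW w wW; apply: spans_edge_adj wW uW.
  by move: wu; rewrite in_setD1 => /andP [].
have [vW|vW] := boolP (v \in W); last first.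
  by apply: (gap_absurd WV vV vW eW); move: potW cd; clear; lia.
apply: (low_absurd WV eW); rewrite -[W]setU0.
apply: le_trans (HW set0 [:: [set v; w]] (disjoint_set0r W) isT _) _.
  by rewrite /= setU0 pair_in wW vW evw setD11.
by rewrite big_set0 /=; move: cd (C_I_le_E k2); clear; lia.
Qed.

(* Otherwise [v] could be absorbed into its only neighbor as [j] fake neighbors. *)
Lemma small_F_two_neighbors v w j : c v = PF j -> (j <= k./2)%N -> adj G v w ->
  exists2 u, u != w & adj G v u.
Proof.
move=> cv jk vw; apply: NNPP => nou.
have nb u : adj G v u -> u = w.
  by move=> vu; apply/eqP/negPn/negP => uw; apply: nou; exists u.
have [vV wV] := adj_vertices vw; have nvw := adj_neq vw.
have evw : [set v; w] \in edges G := vw.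
have j1 : (1 <= j <= k)%N by have := hc vV; rewrite cv.
(* If w cannot take j more fake neighbors, it is precolored F and the pair v, w already has
   potential at most -3. *)
have [iv|niv] := boolP (inc_valid k j (c w)); last first.
  case cw: (c w) niv => [//|i|//] /=; rewrite -ltnNge => ij.
  have ik : (i <= k)%N by have := hc wV; rewrite cw => /andP [].
  apply: (@low_absurd [set v; w]); first by rewrite pair_in vV wV.
    by apply: (spans_edge_adj vw); rewrite !inE eqxx ?orbT.
  apply: le_trans (@pot_le_edges T k G c k2 _ [:: [set v; w]] isT _) _.
    by rewrite /= subxx evw.
  rewrite big_setU1 ?inE //= big_set1 cv cw coef_F_small //.
  by have := coef_F_F ik jk ij; clear; lia.
pose n u := ((u == w) * j)%N.
have nv : {in V, forall u, inc_valid k (n u) (c u)}.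
  move=> u uV; rewrite /n; case: eqP => [->|_]; rewrite ?mul1n // mul0n.
  by have := hc uV; case: (c u) => //= i; rewrite addn0 => /andP [].
have vD : v \in [set v] by rewrite inE.
have nc : ~ colorable k (mkgraph V (avoid [set v])) (incs n).
  move=> [F gF]; apply: (proj1 G_critical).
  apply: (extend_coloring (X := [set v]) gF) => //.
  - by rewrite sub1set.
  - by move=> u _ _; apply: incs_compatible.
  - by move=> u u' uv _; rewrite uv.
  - by move=> u; rewrite inE => /eqP ->; rewrite cv.
  apply: (small_forest_add (x := w) (@adj_sym _ G) (@adj_irr _ G) (small_forest_incs gF)).
  - by rewrite !inE eqxx.
  - by move=> u _; apply: nb.
  - by move=> u _; rewrite /n cv.
  by rewrite cv; case/andP: j1.
have [W [WV dW [x xW nx] eW HW]] := incs_reduction vw vD nv nc.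
have xw : x = w by apply: contraNeq nx; rewrite /n => /negPf ->; rewrite mul0n.
rewrite xw in xW.
apply: (@low_absurd (W :|: [set v])).
- by rewrite subUset WV sub1set.
- by apply: (spans_edge_adj vw); rewrite !inE ?eqxx ?xW ?orbT.
apply: le_trans (HW [set v] [:: [set v; w]] (subxx _) isT _) _.
  rewrite /= evw pair_in !inE eqxx xW orbT /= andbT.
  by apply/negP => dis; have := disjointFr dis (set21 v w); rewrite inE eqxx.
rewrite big_set1 cv coef_F_small // (bigD1 w) //= big1 => [|u /andP [_ /negPf uw]]; last first.
  by rewrite /n uw.
by rewrite /n eqxx /=; clear; lia.
Qed.

(** A vertex of U with a single neighbor can always take the color opposite to that of the
    neighbor. *)
Lemma U_two_neighbors v w j : c v = PU j -> adj G v w -> exists2 u, u != w & adj G v u.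
Proof.
move=> cv vw; apply: NNPP => nou.
have nb u : adj G v u -> u = w.
  by move=> vu; apply/eqP/negPn/negP => uw; apply: nou; exists u.
have [vV wV] := adj_vertices vw.
have vD : v \in [set v] by rewrite inE.
have [F gF] := colorable_del G_critical (avoid_proper vw vD).
apply: (proj1 G_critical).
have comp u : u \in V -> u \notin [set v] -> compatible c u.
  by move=> _ _; split=> // i; exists i.
have sf : small_forest k (adj G) (fun u => weight (c u)) (F :\: [set v]).
  exact: small_forest_avoid gF _.
have [wF|wF] := boolP (w \in F).
  apply: (extend_coloring (X := set0) gF) => //; rewrite ?sub0set ?sub1set ?set0U //.
  - move=> u u' /set1P -> /nb ->; rewrite !inE wF andbT eq_sym.
    by rewrite (adj_neq vw) orbT.
  - by move=> u _ _; rewrite inE.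
  - by move=> u i /set1P ->; rewrite cv.
apply: (extend_coloring (X := [set v]) gF) => //; rewrite ?sub1set //.
- by move=> u u' -> _.
- by move=> u /set1P ->; rewrite cv.
apply: small_forest_isolated => //; [exact: adj_sym|exact: adj_irr| |].
  by move=> u; rewrite !inE => /andP [_ uF]; apply: contraNN wF => /nb <-.
by rewrite cv; have := hc vV; rewrite cv.
Qed.

(* Forcing the second neighbor to be F lets [v] be colored I. *)
Lemma degree2_no_F v x y j i : c v = PU j -> adj G v x -> adj G v y -> x != y ->
  (forall u, adj G v u -> u = x \/ u = y) -> c x <> PF i.
Proof.
move=> cv vx vy xy nb cx.
have [vV xV] := adj_vertices vx; have [_ yV] := adj_vertices vy.
have vD : v \in [set v] by rewrite inE.
have bothF c' F : good k (mkgraph V (avoid [set v])) c' F ->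
    (forall u, u \in V -> u \notin [set v] -> compatible c' u) ->
    {in F, forall u, (weight (c u) <= weight (c' u))%N} ->
    x \in F -> y \in F -> colorable k G c.
  move=> gF comp hw xF yF.
  apply: (extend_coloring (X := set0) gF) => //; rewrite ?sub0set ?sub1set ?set0U //.
  - move=> u u' /set1P -> vu'; rewrite !inE eq_sym (adj_neq vu') /=.
    by case: (nb u' vu') => ->; rewrite ?xF ?yF ?orbT.
  - by move=> u _ _; rewrite inE.
  - by move=> u i' /set1P ->; rewrite cv.
  exact: small_forest_avoid gF hw.
case cy: (c y) => [a|a|]; last exact: (no_I yV cy).
  have ak : (a < k)%N by have := hc yV; rewrite cy.
  have vp : valid_precolor k (PF a.+1) by [].
  have nc : ~ colorable k (mkgraph V (avoid [set v])) (upd c y (PF a.+1)).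
    move=> [F gF]; apply: (proj1 G_critical); have [FV hit noI hF sf] := gF.
    apply: (bothF _ _ gF).
    - move=> u uV _; rewrite /compatible /upd; case: eqP => [->|_]; last by split=> // j'; exists j'.
      by rewrite cy; split.
    - by move=> u _; rewrite /upd; case: eqP => // ->; rewrite cy.
    - by apply: (hF x i) => //; rewrite /upd (negPf xy).
    - by apply: (hF y a.+1) => //; rewrite /upd eqxx.
  have [W [WV nbW yW potW _]] := upd_reduction0 k2 hc G_critical IH (avoid_proper vx vD) vp nc.
  have vW : v \notin W.
    by apply/negP => /nbW [u _]; rewrite pair_avoid inE eqxx /= andbF.
  have eW : spans_edge G W.
    have [u uW]:= nbW y yW; rewrite pair_avoid => /andP [yu _].
    exact: spans_edge_adj yu yW uW.
  apply: (gap_absurd WV vV vW eW); rewrite cy in potW.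
  by move: potW (coef_U_F k2 ak); clear; lia.
have [F gF] := colorable_del G_critical (avoid_proper vx vD).
apply: (proj1 G_critical); have [FV hit noI hF sf] := gF.
apply: (bothF _ _ gF) => //; first by move=> u _ _; split=> // i'; exists i'.
- exact: hF cx.
- exact: hF cy.
Qed.

Lemma degree2_neighbors_U v x y j : c v = PU j -> adj G v x -> adj G v y -> x != y ->
  (forall u, adj G v u -> u = x \/ u = y) -> exists i, c x = PU i.
Proof.
move=> cv vx vy xy nb; have [_ xV] := adj_vertices vx.
case cx: (c x) => [i|i|]; first by exists i.
- by case: (degree2_no_F cv vx vy xy nb cx).
- by case: (no_I xV cx).
Qed.

End Reducible.

(** With m = [k./2], the left side exceeds -3 by 3j - 3m + 5 - [odd k]: negative up to j = m - 2,
    positive at j = m - 1. The latter value is the class of the special vertices. *)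
Lemma two_incs_low k j : (j.+2 <= k./2)%N ->
  -3 + 3 * (j.+1 + j.+1)%N%:Z + coef k (PU j) - C_E k * 2 <= -3.
Proof. by move=> jk; coef_lia k. Qed.

Lemma one_inc_low k j : (j <= k./2)%N -> -3 + 3 * j%:Z <= C_I k.
Proof. by rewrite C_I_half; move=> jk; case: (odd k); lia. Qed.

(** * Vertices of degree two and special vertices *)

Section DegreeTwo.
Variables (T : finType) (k : nat) (G : graph T) (c : T -> precolor).
Hypotheses (k2 : (2 <= k)%N) (hc : precoloring k G c).
Hypothesis G_critical : critical k G c.
Hypothesis IH : forall (H : graph T) c', (#|edges H| < #|edges G|)%N ->
  precoloring k H c' -> critical k H c' -> pot k H c' (vertices H) <= -3.
Hypothesis Gpot : -3 < pot k G c (vertices G).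

Let V := vertices G.

Definition neighbors2 v x y :=
  [/\ adj G v x, adj G v y, x != y & forall u, adj G v u -> u = x \/ u = y].

Lemma neighbors2C v x y : neighbors2 v x y -> neighbors2 v y x.
Proof.
move=> [vx vy xy nb]; split=> //; first by rewrite eq_sym.
by move=> u /nb []; [right|left].
Qed.

Lemma neighbors2_U v x y j : c v = PU j -> neighbors2 v x y -> exists i, c x = PU i.
Proof.
move=> cv [vx vy xy nb].
exact: (degree2_neighbors_U k2 hc G_critical IH Gpot cv vx vy xy nb).
Qed.

Lemma inc_valid_U (n : T -> nat) : (forall u, n u = 0%N \/ exists i, c u = PU i) ->
  {in V, forall u, inc_valid k (n u) (c u)}.
Proof.
move=> h u uV; have := hc uV; case: (h u) => [->|[i ->] //].
by case: (c u) => //= i /andP []; rewrite addn0.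
Qed.

Lemma extend_U (D X F : {set T}) n :
  good k (mkgraph V (avoid G D)) (incs k c n) F -> X \subset D -> D \subset V ->
  (forall u, u \in D -> exists j, c u = PU j) ->
  (forall u v, u \in D -> adj G u v -> (u \in X) || (v \in F :\: D) || (v \in X)) ->
  small_forest k (adj G) (fun u => weight (c u)) (X :|: F :\: D) -> False.
Proof.
move=> gF XD DV DU hitD sf; apply: (proj1 G_critical).
apply: (extend_coloring (X := X) gF) => //.
- by move=> u _ _; apply: incs_compatible.
- by move=> u uD cu; have [j cj] := DU u uD; rewrite cj in cu.
- by move=> u i uD cu; have [j cj] := DU u uD; rewrite cj in cu.
Qed.

Lemma weight_U v j : v \in V -> c v = PU j -> (weight (c v) <= k)%N.
Proof. by move=> vV cv; have := hc vV; rewrite cv. Qed.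

Lemma not_disjoint (A D : {set T}) u : u \in A -> u \in D -> ~~ [disjoint A & D].
Proof. by move=> uA uD; apply/negP => dis; have := disjointFr dis uA; rewrite uD. Qed.

(* Reserving the weight of [v] at both neighbors lets [v] be colored. *)
Lemma degree2_large v x y j : c v = PU j -> neighbors2 v x y -> (k./2 <= j.+1)%N.
Proof.
move=> cv nb2; rewrite leqNgt; apply/negP => jk.
have [i cx] := neighbors2_U cv nb2; have [i' cy] := neighbors2_U cv (neighbors2C nb2).
have [vx vy xy nb] := nb2.
have [vV xV] := adj_vertices vx; have [_ yV] := adj_vertices vy.
have vD : v \in [set v] by rewrite inE.
pose n u := (((u == x) || (u == y)) * j.+1)%N.
have nv : {in V, forall u, inc_valid k (n u) (c u)}.
  apply: inc_valid_U => u; rewrite /n; case: (u =P x) => [->|_]; first by right; exists i.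
  by case: (u =P y) => [->|_]; [right; exists i'|left; rewrite mul0n].
have nx : n x = j.+1 by rewrite /n eqxx mul1n.
have ny : n y = j.+1 by rewrite /n eqxx orbT mul1n.
have nc : ~ colorable k (mkgraph V (avoid G [set v])) (incs k c n).
  move=> [F gF]; have sf := small_forest_incs gF.
  have sf0 : small_forest k (adj G) (fun u => weight (c u)) (F :\: [set v]).
    by apply: (sub_small_forest sf) => // u _; apply: leq_addr.
  have DU u : u \in [set v] -> exists j, c u = PU j by move=> /set1P ->; exists j.
  have VF : v \notin F :\: [set v] by rewrite !inE eqxx.
  have add z : adj G v z -> n z = j.+1 ->
      (forall u, u \in F -> adj G v u -> u = z) -> False.
    move=> vz nz hz.
    apply: (extend_U (X := [set v]) gF) => //; rewrite ?sub1set //.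
      by move=> u u' -> _.
    apply: (small_forest_add (x := z) (@adj_sym _ G) (@adj_irr _ G) sf VF).
    - by move=> u /setDP [uF _]; apply: hz.
    - move=> u _; rewrite leq_add2l cv; case: eqP => [->|]; last by rewrite mul0n.
      by rewrite nz mul1n.
    exact: weight_U cv.
  have [xF|xF] := boolP (x \in F); last first.
    apply: (add y vy ny) => u uF /nb [ux|//].
    by rewrite -ux uF in xF.
  have [yF|yF] := boolP (y \in F); last first.
    apply: (add x vx nx) => u uF /nb [//|uy].
    by rewrite -uy uF in yF.
  apply: (extend_U (X := set0) gF) => //; rewrite ?sub0set ?sub1set ?set0U //.
  move=> u u' /set1P -> vu'; rewrite !inE eq_sym (adj_neq vu') /=.
  by case: (nb u' vu') => ->; rewrite ?xF ?yF ?orbT.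
have [W [WV dW [u uW nu] eW HW]] := incs_reduction k2 hc G_critical IH vx vD nv nc.
have vW : v \notin W.
  by apply/negP => vW; have := disjointFr dW vW; rewrite vD.
have potW : pot k G c W <= -3 + 3 * (\sum_(v in W) n v)%N%:Z.
  rewrite -[W in X in X <= _]setU0.
  apply: le_trans (HW set0 [::] (sub0set _) isT isT) _.
  by rewrite big_set0 /=; clear; lia.
(* If both reserves fall in W, then v and its two edges are put back; a single reserve stays within
   the gap. *)
have [/andP [xW yW]|nboth] := boolP ((x \in W) && (y \in W)).
  have sum : (\sum_(v in W) n v = j.+1 + j.+1)%N.
    rewrite (bigD1 x) //= (bigD1 y) ?yW //=; last by rewrite eq_sym.
    rewrite nx ny addnA big1 ?addn0 // => z /andP [/andP [_ /negPf zx] /negPf zy].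
    by rewrite /n zx zy.
  apply: (@low_absurd _ _ _ _ k2 hc G_critical IH Gpot (W :|: [set v])).
  - by rewrite subUset WV sub1set.
  - by apply: (spans_edge_adj vx); rewrite !inE ?eqxx ?xW ?orbT.
  have ne : [set v; x] != [set v; y].
    apply: contraNneq xy => E; have : x \in [set v; y] by rewrite -E !inE eqxx orbT.
    by rewrite !inE eq_sym (negPf (adj_neq vx)).
  have uL : uniq [:: [set v; x]; [set v; y]] by rewrite /= inE ne.
  apply: le_trans (HW [set v] [:: [set v; x]; [set v; y]] (subxx _) uL _) _.
    have evx : [set v; x] \in edges G := vx; have evy : [set v; y] \in edges G := vy.
    rewrite /= evx evy !pair_in !inE eqxx xW yW !orbT /= andbT.
    by rewrite !(@not_disjoint _ _ v) // !inE eqxx.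
  by rewrite big_set1 cv sum; exact: two_incs_low.
have sum : (\sum_(v in W) n v <= j.+1)%N.
  have [xW|xW] := boolP (x \in W).
    have yW : y \notin W by rewrite xW in nboth.
    rewrite (bigD1 x) //= nx big1 ?addn0 // => z /andP [zW /negPf zx].
    rewrite /n zx /=; case: eqP => // zy; by rewrite -zy zW in yW.
  have h z : z \in W -> z != y -> n z = 0%N.
    move=> zW /negPf zy; rewrite /n zy orbF; case: eqP => // zx.
    by rewrite -zx zW in xW.
  have [yW|yW] := boolP (y \in W).
    by rewrite (bigD1 y) //= ny big1 ?addn0 // => z /andP [zW zy]; apply: h.
  rewrite big1 // => z zW; apply: h => //.
  by apply: contraNneq yW => <-.
apply: (gap_absurd k2 hc G_critical IH Gpot WV vV vW eW).
apply: le_trans potW _; apply: le_trans (@one_inc_low k j.+1 (ltnW jk)).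
by move: sum; clear; lia.
Qed.

(* A vertex of degree 2 and weight about [k / 2]: the only vertices that can
   raise the potential in the discharging argument. *)
Definition special v := [&& v \in V, c v == PU (k./2).-1 & #|[set u | adj G v u]| == 2%N].

Lemma degree2P v : #|[set u | adj G v u]| = 2%N -> exists x y, neighbors2 v x y.
Proof.
move=> /eqP/cards2P [x [y [xy E]]]; exists x, y.
have mem u : adj G v u = (u == x) || (u == y) by rewrite -in_set2 -E inE.
split=> //; try by rewrite mem eqxx ?orbT.
by move=> u; rewrite mem => /orP [] /eqP; [left|right].
Qed.

Lemma specialP v : special v -> [/\ v \in V, c v = PU (k./2).-1 & exists x y, neighbors2 v x y].
Proof. by move=> /and3P [vV /eqP cv /eqP /degree2P]. Qed.

Lemma weight_special v : special v -> weight (c v) = k./2.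
Proof. by move=> /specialP [_ -> _] /=; rewrite prednK // half_gt0. Qed.

Lemma special_neighbors v z : special v -> adj G v z -> exists x, neighbors2 v z x.
Proof.
move=> /specialP [_ _ [x [y nb2]]] vz; have [_ _ _ nb] := nb2.
by case: (nb z vz) => ->; [exists y|exists x; apply: neighbors2C].
Qed.

(* Reserving the weight of [v] at its other neighbor [x] is enough. *)
Lemma special_degree2 v u i : special v -> adj G v u -> c u = PU i ->
  #|[set z | adj G u z]| = 2%N -> (k < k./2 + i.+1)%N.
Proof.
move=> sv vu cu du; rewrite ltnNge; apply/negP => ik.
have [vV cv _] := specialP sv; have wv := weight_special sv.
have [x nbv] := special_neighbors sv vu; have [_ vx ux nv] := nbv.
have uv : adj G u v by rewrite adj_sym.
have [y nbu] : exists y, neighbors2 u v y.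
  have [a [b nab]] := degree2P du; have [_ _ _ nb] := nab.
  by case: (nb v uv) => ->; [exists b|exists a; apply: neighbors2C].
have [_ uy vy nu] := nbu.
have [_ xV] := adj_vertices vx; have [_ uV] := adj_vertices vu.
have [i' cx] := neighbors2_U cv (neighbors2C nbv).
pose D := [set v; u].
have vD : v \in D by rewrite !inE eqxx.
have uD : u \in D by rewrite !inE eqxx orbT.
have DV : D \subset V by rewrite pair_in vV uV.
pose n z := ((z == x) * k./2)%N.
have nval : {in V, forall u, inc_valid k (n u) (c u)}.
  apply: inc_valid_U => z; rewrite /n; case: eqP => [->|_]; first by right; exists i'.
  by left; rewrite mul0n.
have nc : ~ colorable k (mkgraph V (avoid G D)) (incs k c n).
  move=> [F gF]; have sf := small_forest_incs gF.
  have sf0 : small_forest k (adj G) (fun u => weight (c u)) (F :\: D).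
    by apply: (sub_small_forest sf) => // z _; apply: leq_addr.
  have DU z : z \in D -> exists j, c z = PU j.
    by rewrite !inE => /orP [] /eqP ->; [exists (k./2).-1|exists i].
  have nvu : v != u := adj_neq vu.
  have xD : x \notin D by rewrite !inE negb_or eq_sym (adj_neq vx) eq_sym ux.
  have yD : y \notin D by rewrite !inE negb_or eq_sym vy eq_sym (adj_neq uy).
  have vF0 : v \notin F :\: D by rewrite inE vD.
  have uF0 : u \notin F :\: D by rewrite inE uD.
  have wu : (weight (c u) <= k)%N by apply: weight_U cu.
  have wvk : (weight (c v) <= k)%N by apply: weight_U cv.
  (* If y is F, color v with F on the reserve at x, and u with I. If only x is F, then v gets I and
     u becomes an isolated F vertex. If neither is F, then v and u form a component of weight at
     most k. *)
  have [yF|yF] := boolP (y \in F).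
    apply: (extend_U (X := [set v]) gF) => //; rewrite ?sub1set //.
      move=> a b; rewrite !inE => /orP [/eqP ->|/eqP -> /nu [->|->]]; rewrite ?eqxx ?orbT //.
      by have := yD; rewrite !inE => ->; rewrite yF orbT.
    apply: (small_forest_add (x := x) (@adj_sym _ G) (@adj_irr _ G) sf vF0) => //.
      by move=> z /setDP [_ zD] /nv [zu|//]; rewrite zu uD in zD.
    by move=> z _; rewrite leq_add2l /n wv.
  have [xF|xF] := boolP (x \in F).
    apply: (extend_U (X := [set u]) gF) => //; rewrite ?sub1set //.
      move=> a b; rewrite !inE => /orP [/eqP -> /nv [->|->]|/eqP ->]; rewrite ?eqxx ?orbT //.
      by have := xD; rewrite !inE => ->; rewrite xF !orbT.
    apply: small_forest_isolated => //; [exact: adj_sym|exact: adj_irr|].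
    move=> z /setDP [zF zD]; apply/negP => /nu [zv|zy]; first by rewrite zv vD in zD.
    by rewrite -zy zF in yF.
  apply: (extend_U (X := D) gF) => //; first by move=> a b ->.
  rewrite /D -setUA.
  apply: (small_forest_add (x := u) (w0 := fun z => weight (c z) + (z == u) * k./2)%N
           (@adj_sym _ G) (@adj_irr _ G)) => //.
  - apply: small_forest_isolated; [exact: adj_sym|exact: adj_irr| | |].
    + apply: (sub_small_forest sf0) => // z /setDP [_ zD].
      case: eqP => [zu|_]; last by rewrite mul0n addn0.
      by rewrite zu uD in zD.
    + move=> z /setDP [zF zD]; apply/negP => /nu [zv|zy]; first by rewrite zv vD in zD.
      by rewrite -zy zF in yF.
    + by rewrite eqxx mul1n cu /= addnC.
  - by rewrite !inE negb_or nvu negb_and eqxx.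
  - move=> z; rewrite in_setU1 => /orP [/eqP -> //|/setDP [zF zD] /nv [//|zx]].
    by rewrite -zx zF in xF.
  - by move=> z _; rewrite wv.
have [W [WV dW [z zW nz] eW HW]] := incs_reduction k2 hc G_critical IH vu vD nval nc.
have vW : v \notin W.
  by apply/negP => vW; have := disjointFr dW vW; rewrite vD.
have zx : z = x by apply: contraNeq nz; rewrite /n => /negPf ->; rewrite mul0n.
apply: (gap_absurd k2 hc G_critical IH Gpot WV vV vW eW).
apply: le_trans (@one_inc_low k k./2 (leqnn _)).
rewrite -[W in X in X <= _]setU0.
apply: le_trans (HW set0 [::] (sub0set _) isT isT) _.
rewrite big_set0 (bigD1 z) //= big1 => [|z' /andP [_ z'z]]; last first.
  by rewrite /n -zx (negPf z'z).
by rewrite /n zx eqxx addn0 mul1n; clear; lia.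
Qed.

(** Two adjacent special vertices have total weight 2m <= k, contrary to [special_degree2]. *)
Lemma special_nonadjacent v u : special v -> special u -> ~~ adj G v u.
Proof.
move=> sv su; apply/negP => vu; have [uV cu _] := specialP su.
have du : #|[set z | adj G u z]| = 2%N by case/and3P: su => _ _ /eqP.
have := special_degree2 sv vu cu du.
by rewrite prednK ?half_gt0 //; have := half_double_odd k; clear; lia.
Qed.

End DegreeTwo.

(** In fact an equality. The four edges join z to its two special neighbors and each of these to its
    other neighbor. *)
Lemma odd_triple_coef k : (2 <= k)%N -> odd k ->
  -3 + 3 * (k./2 + k./2)%N%:Z
  + (coef k (PU 0) + (coef k (PU (k./2).-1) + coef k (PU (k./2).-1))) - C_E k * 4 <= C_I k.
Proof.
move=> k2 ok; rewrite /coef C_I_half !C_U_half C_E_half.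
by have := half_double_odd k; rewrite ok; lia.
Qed.

(** * Two special neighbors of a vertex of degree three, for odd k *)

Section OddTriple.
Variables (T : finType) (k : nat) (G : graph T) (c : T -> precolor).
Hypotheses (k2 : (2 <= k)%N) (hc : precoloring k G c).
Hypothesis G_critical : critical k G c.
Hypothesis IH : forall (H : graph T) c', (#|edges H| < #|edges G|)%N ->
  precoloring k H c' -> critical k H c' -> pot k H c' (vertices H) <= -3.
Hypothesis Gpot : -3 < pot k G c (vertices G).

Let V := vertices G.

(* With [k = 2m + 1], the star formed by [z] and its two special neighbors
   has total weight exactly [k]. *)
Lemma odd_two_specials z a b : odd k -> c z = PU 0 -> #|[set u | adj G z u]| = 3%N ->
  special k G c a -> special k G c b -> a != b -> adj G z a -> adj G z b -> False.
Proof.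
move=> ok cz dz sa sb ab za zb.
have wa := weight_special k2 sa; have wb := weight_special k2 sb.
have [zV aV] := adj_vertices za; have [_ bV] := adj_vertices zb.
have [d [zd da db nz]] : exists d, [/\ adj G z d, d != a, d != b &
    forall u, adj G z u -> [\/ u = a, u = b | u = d]].
  have aN : a \in [set u | adj G z u] by rewrite inE.
  have bN : b \in [set u | adj G z u] :\ a by rewrite !inE eq_sym ab.
  have : #|[set u | adj G z u] :\ a :\ b| == 1%N.
    by move: dz; rewrite (cardsD1 a) aN (cardsD1 b (_ :\ a)) bN => - [/eqP].
  move=> /cards1P [d E].
  have mem u : (u \in [set u | adj G z u] :\ a :\ b) = (u == d) by rewrite E inE.
  have := mem d; rewrite eqxx !inE => /and3P [db da zd]; exists d; split=> // u zu.
  have [->|ua] := eqVneq u a; first by constructor 1.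
  have [->|ub] := eqVneq u b; first by constructor 2.
  by constructor 3; apply/eqP; rewrite -mem !inE ub ua.
have az : adj G a z by rewrite adj_sym.
have bz : adj G b z by rewrite adj_sym.
have [x nba] := special_neighbors sa az; have [y nbb] := special_neighbors sb bz.
have [_ ax zx na] := nba; have [_ by_ zy nb] := nbb.
have [_ ca _] := specialP sa; have [_ cb _] := specialP sb.
have [i cx] := neighbors2_U k2 hc G_critical IH Gpot ca (neighbors2C nba).
have [i' cy] := neighbors2_U k2 hc G_critical IH Gpot cb (neighbors2C nbb).
have [_ xV] := adj_vertices ax; have [_ yV] := adj_vertices by_.
have nab : ~~ adj G a b := special_nonadjacent k2 hc G_critical IH Gpot sa sb.
pose D := [set z; a; b].
have zD : z \in D by rewrite !inE eqxx.
have aD : a \in D by rewrite !inE eqxx orbT.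
have bD : b \in D by rewrite !inE eqxx !orbT.
have DV : D \subset V by rewrite !subUset !sub1set zV aV bV.
have xb : x != b by apply: contraNneq nab => <-.
have ya : y != a by apply: contraNneq nab => <-; rewrite adj_sym.
have xD : x \notin D.
  by rewrite !inE !negb_or eq_sym zx eq_sym (adj_neq ax) xb.
have yD : y \notin D.
  by rewrite !inE !negb_or eq_sym zy ya eq_sym (adj_neq by_).
have dD : d \notin D by rewrite !inE !negb_or eq_sym (adj_neq zd) da db.
(* A sum, because x and y may coincide; the two reserves then add up. *)
pose n u := ((u == x) * k./2 + (u == y) * k./2)%N.
have nval : {in V, forall u, inc_valid k (n u) (c u)}.
  apply: inc_valid_U => // u; rewrite /n.
  have [->|_] := eqVneq u x; first by right; exists i.
  have [->|_] := eqVneq u y; first by right; exists i'.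
  by left; rewrite !mul0n.
have nc : ~ colorable k (mkgraph V (avoid G D)) (incs k c n).
  move=> [F gF]; have sf := small_forest_incs gF.
  have sf0 : small_forest k (adj G) (fun u => weight (c u)) (F :\: D).
    by apply: (sub_small_forest sf) => // u _; apply: leq_addr.
  have DU u : u \in D -> exists j, c u = PU j.
    rewrite !inE -orbA => /or3P [] /eqP ->; first by exists 0%N.
      by exists (k./2).-1.
    by exists (k./2).-1.
  have es : symmetric (adj G) := @adj_sym _ G.
  have ei : irreflexive (adj G) := @adj_irr _ G.
  have wak : (weight (c a) <= k)%N by apply: (weight_U hc) ca.
  have wbk : (weight (c b) <= k)%N by apply: (weight_U hc) cb.
  have inF u : u \in F :\: D -> (u \in F) /\ (u != z /\ u != a /\ u != b).
    by rewrite !inE !negb_or -!andbA => /and4P [-> -> -> ->].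
  (* If the third neighbor d of z is F, then z is colored I, and a and b are colored F on the
     reserves at x and y. *)
  have [dF|dF] := boolP (d \in F).
    have sfb : small_forest k (adj G) (fun u => weight (c u) + (u == x) * k./2)%N
        (b |: F :\: D).
      apply: (small_forest_add (x := y) es ei sf).
      - by rewrite inE bD.
      - by move=> u /inF [_ [uz _]] /nb [uz'|//]; rewrite uz' eqxx in uz.
      - by move=> u _; rewrite (eq_sym b x) (negPf xb) addn0 wb /n addnA.
      - by rewrite (eq_sym b x) (negPf xb) addn0.
    apply: (@extend_U _ _ _ _ G_critical D [set a; b] F n gF) => //.
    - by rewrite pair_in aD bD.
    - move=> u v; rewrite !inE -orbA => /or3P [] /eqP ->; rewrite ?eqxx ?orbT //.
      move=> /nz [->|->|->]; rewrite ?eqxx ?orbT //.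
      by move: dD; rewrite !inE => ->; rewrite dF orbT.
    rewrite -setUA.
    apply: (small_forest_add (x := x) es ei sfb) => //.
    - by rewrite !inE (negPf ab) eqxx !orbT.
    - move=> u; rewrite in_setU1 => /orP [/eqP ->|]; first by move=> h; rewrite h in nab.
      by move=> /inF [_ [uz _]] /na [uz'|//]; rewrite uz' eqxx in uz.
    - by move=> u _; rewrite wa.
  (* Otherwise z is colored F with room 2m for a and b, each of which is colored F only if its other
     neighbor is I. *)
  pose m := k./2.
  have sfz : small_forest k (adj G) (fun u => weight (c u) + (u == z) * (m + m))%N
      (z |: F :\: D).
    apply: small_forest_isolated => //.
    - apply: (sub_small_forest sf0) => // u /inF [_ [/negPf uz _]].
      by rewrite uz mul0n addn0.
    - move=> u /inF [uF [_ [ua ub]]]; apply/negP => /nz [E|E|E].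
      + by rewrite E eqxx in ua.
      + by rewrite E eqxx in ub.
      + by rewrite -E uF in dF.
    - rewrite eqxx mul1n cz /= /m.
      by have := half_double_odd k; rewrite ok; clear; lia.
  pose A := if x \in F then set0 else [set a].
  pose B := if y \in F then set0 else [set b].
  have zm u : (u == z) && (u \in F :\: D) = false.
    by apply/negP => /andP [/eqP -> ]; rewrite inE zD.
  have sfa : small_forest k (adj G) (fun u => weight (c u) + (u == z) * m)%N
      (A :|: (z |: F :\: D)).
    rewrite /A; case: ifP => xF.
      rewrite set0U; apply: (sub_small_forest sfz) => // u _.
      by rewrite leq_add2l leq_mul2l leq_addl orbT.
    apply: (small_forest_add (x := z) es ei sfz).
    - by rewrite !inE (eq_sym a z) (negPf (adj_neq za)) eqxx orbT.
    - move=> u; rewrite in_setU1 => /orP [/eqP //|/inF [uF _]] /na [//|ux].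
      by rewrite -ux uF in xF.
    - move=> u _; rewrite wa (eq_sym a z) (negPf (adj_neq za)) mul0n addn0 -/m.
      by clear; lia.
    - by rewrite (eq_sym a z) (negPf (adj_neq za)) addn0.
  have sfab : small_forest k (adj G) (fun u => weight (c u))
      (B :|: (A :|: (z |: F :\: D))).
    rewrite /B; case: ifP => yF.
      rewrite set0U; apply: (sub_small_forest sfa) => // u _; exact: leq_addr.
    apply: (small_forest_add (x := z) es ei sfa) => //.
    - rewrite !inE (eq_sym b z) (negPf (adj_neq zb)) eqxx !orbT orbF.
      by rewrite /A; case: ifP; rewrite !inE // eq_sym (negPf ab).
    - move=> u; rewrite !in_setU => /orP [uA|/orP [|]].
      + have ua : u = a by move: uA; rewrite /A; case: ifP => _; rewrite inE // => /eqP.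
        by rewrite ua adj_sym (negPf nab).
      + by rewrite inE => /eqP.
      + by move=> /inF [uF _] /nb [//|uy]; rewrite -uy uF in yF.
    - by move=> u _; rewrite wb.
  have XE : B :|: (A :|: (z |: F :\: D)) = (B :|: (A :|: [set z])) :|: F :\: D.
    by rewrite !setUA.
  rewrite XE in sfab.
  have Xz : z \in B :|: (A :|: [set z]) by rewrite !inE eqxx !orbT.
  have Xa : x \notin F -> a \in B :|: (A :|: [set z]).
    by move=> /negPf xF; rewrite /A xF !inE eqxx !orbT.
  have Xb : y \notin F -> b \in B :|: (A :|: [set z]).
    by move=> /negPf yF; rewrite /B yF !inE eqxx.
  apply: (@extend_U _ _ _ _ G_critical D _ F n gF _ _ _ _ sfab) => //.
  - rewrite !subUset sub1set zD andbT /A /B.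
    by case: ifP => _; case: ifP => _; rewrite ?sub0set ?sub1set ?aD ?bD.
  - move=> u v uD; have : [|| u == z, u == a | u == b] by move: uD; rewrite !inE -orbA.
    move=> /or3P [] /eqP ->; first by rewrite Xz.
      have [xF|/Xa -> //] := boolP (x \in F).
      by move=> /na [->|->]; rewrite ?Xz ?orbT // in_setD xD xF orbT.
    have [yF|/Xb -> //] := boolP (y \in F).
    by move=> /nb [->|->]; rewrite ?Xz ?orbT // in_setD yD yF orbT.
have [W [WV dW [u uW nu] eW HW]] := incs_reduction k2 hc G_critical IH za zD nval nc.
have notW v : v \in D -> v \notin W.
  by move=> vD; apply/negP => vW; have := disjointFr dW vW; rewrite vD.
have zW := notW z zD; have aW := notW a aD; have bW := notW b bD.
have sumE (v0 : T) : (\sum_(v in W) ((v == v0) * k./2) = (v0 \in W) * k./2)%N.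
  have [v0W|v0W] := boolP (v0 \in W).
    by rewrite (bigD1 v0) //= eqxx big1 ?addn0 // => v /andP [_ /negPf ->]; rewrite mul0n.
  rewrite mul0n big1 // => v vW; case: eqP => [E|_]; last by rewrite mul0n.
  by rewrite -E vW in v0W.
have sum : (\sum_(v in W) n v = (x \in W) * k./2 + (y \in W) * k./2)%N.
  by rewrite big_split /= !sumE.
have [/andP [xW yW]|nboth] := boolP ((x \in W) && (y \in W)); last first.
  apply: (gap_absurd k2 hc G_critical IH Gpot WV zV zW eW).
  apply: le_trans (@one_inc_low k k./2 (leqnn _)).
  rewrite -[W in X in X <= _]setU0.
  apply: le_trans (HW set0 [::] (sub0set _) isT isT) _.
  rewrite big_set0 sum; move: nboth.
  by case: (x \in W); case: (y \in W) => //= _; rewrite ?mul0n ?mul1n ?addn0 ?add0n; clear; lia.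
rewrite xW yW !mul1n in sum.
have sumD : \sum_(v in D) coef k (c v) =
    coef k (PU 0) + (coef k (PU (k./2).-1) + coef k (PU (k./2).-1)).
  have -> : D = z |: (a |: [set b]) by rewrite /D setUA.
  rewrite big_setU1 ?big_setU1 ?big_set1 ?cz ?ca ?cb ?inE //.
  by rewrite negb_or !(adj_neq za, adj_neq zb).
have low := odd_triple_coef k2 ok.
have eza : [set a; z] \in edges G := az; have ezb : [set b; z] \in edges G := bz.
have eax : [set a; x] \in edges G := ax; have eby : [set b; y] \in edges G := by_.
have ezd : [set z; d] \in edges G := zd.
have memQ v : v \in D -> v \in W :|: D by rewrite (in_setU v W D) => ->; rewrite orbT.
have memW v : v \in W -> v \in W :|: D by rewrite (in_setU v W D) => ->.
have QV : W :|: D \subset V by rewrite subUset WV DV.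
have eQ : spans_edge G (W :|: D) by apply: (spans_edge_adj za); apply: memQ.
have notE (u1 u2 v1 v2 : T) : u1 != v1 -> u1 != v2 -> [set u1; u2] != [set v1; v2].
  move=> h1 h2; apply: contraNneq h1 => E.
  have : u1 \in [set v1; v2] by rewrite -E !inE eqxx.
  by rewrite !inE (negPf h2) orbF.
have notE2 (u1 u2 v1 v2 : T) : u2 != v1 -> u2 != v2 -> [set u1; u2] != [set v1; v2].
  by rewrite [[set u1; u2]]setUC; apply: notE.
have xz : x != z by rewrite eq_sym. have xa : x != a by rewrite eq_sym (adj_neq ax).
have yz : y != z by rewrite eq_sym. have yb : y != b by rewrite eq_sym (adj_neq by_).
have az' := adj_neq az; have bz' := adj_neq bz; have ba : b != a by rewrite eq_sym.
have ay : a != y by rewrite eq_sym.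
have bx : b != x by rewrite eq_sym.
pose L := [:: [set a; z]; [set b; z]; [set a; x]; [set b; y]].
have za' := adj_neq za; have zb' := adj_neq zb.
have uL : uniq L.
  rewrite /= !inE !negb_or !andbT -!andbA; apply/and5P; split; last apply/andP; try split.
  - exact: notE.
  - exact: notE2.
  - exact: notE.
  - exact: notE.
  - exact: notE2.
  - exact: notE.
have nd (s t : T) : s \in D -> ~~ [disjoint [set s; t] & D].
  by move=> sD; apply: not_disjoint sD; rewrite !inE eqxx.
have allL : all (fun A => [&& A \in edges G, A \subset W :|: D & ~~ [disjoint A & D]]) L.
  rewrite /L /= eza ezb eax eby !pair_in (memQ a aD) (memQ z zD) (memQ b bD) (memW x xW) (memW y yW) /= !andbT.
  by rewrite (nd a z aD) (nd b z bD) (nd a x aD) (nd b y bD).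
(* If d is missing, the bound [C_I k] is enough; otherwise zd is a fifth recovered edge. *)
have [dW'|dW'] := boolP (d \in W); last first.
  have dQ : d \notin W :|: D by rewrite inE negb_or dW' dD.
  have [_ dV] := adj_vertices zd.
  apply: (gap_absurd k2 hc G_critical IH Gpot QV dV dQ eQ).
  apply: le_trans (HW D L (subxx _) uL allL) _.
  by rewrite sumD sum; apply: low.
apply: (low_absurd k2 hc G_critical IH Gpot QV eQ).
have uL' : uniq ([set z; d] :: L).
  rewrite cons_uniq uL andbT /L !inE !negb_or.
  have dz' : d != z by rewrite eq_sym (adj_neq zd).
  by rewrite (notE2 z d a z) ?(notE2 z d b z) ?(notE z d a x) ?(notE z d b y).
have allL' : all (fun A => [&& A \in edges G, A \subset W :|: D & ~~ [disjoint A & D]])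
    ([set z; d] :: L).
  apply/andP; split; last exact: allL.
  by rewrite ezd pair_in (memQ z zD) (memW d dW') /= nd.
apply: le_trans (HW D _ (subxx _) uL' allL') _.
rewrite sumD sum; move: low (C_I_le_E k2).
rewrite [size _]/=; set X := coef k (PU 0) + _; move: X; clear; move=> X; lia.
Qed.

End OddTriple.

(** * Discharging and the final coloring *)

(** Twice the surplus of a special vertex; half of it goes to each neighbor, hence the factor
    [1 + odd k] in [cost]. *)
Lemma coef_special k : (2 <= k)%N ->
  2 * coef k (PU (k./2).-1) - C_E k * 2 = 2 * (1 + (odd k)%:Z).
Proof. by move=> k2; coef_lia k. Qed.

Lemma C_E_gt k : (2 <= k)%N -> 4 <= C_E k - 1 /\ (odd k -> 7 <= C_E k).
Proof.
move=> k2; rewrite C_E_half; have := half_double_odd k; case: (odd k); lia.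
Qed.

(** Attained at [j = k./2.+1] and [d = 1]. For even k this exceeds the total 4; for odd k the raised
    coefficient leaves only 3, and cost 3 has to be excluded separately. *)
Lemma cost_F k j d : (2 <= k)%N -> (j <= k)%N -> (1 <= d)%N -> ((j <= k./2)%N -> (2 <= d)%N) ->
  (1 <= j)%N ->
  (if odd k then 3 else 5) <= C_E k * d%:Z - 2 * coef k (PF j).
Proof.
move=> k2 jk d1 d2 j1; have E0 := C_E_ge0 k2.
have h1 : C_E k * 1 <= C_E k * d%:Z by rewrite ler_wpM2l // lez_nat.
have h2 : (j <= k./2)%N -> C_E k * 2 <= C_E k * d%:Z.
  by move=> /d2 d2'; rewrite ler_wpM2l // lez_nat.
move: h1 h2; move: (C_E k * d%:Z) => x; clear d1 d2 d E0; coef_lia k.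
Qed.

(** With t nonspecial neighbors, w equals (C_E - 1)(d - 3) + 6j + t. Degree 3 with j = 0 is the
    neutral case; the third alternative occurs only for d = 4 and k = 2. *)
Lemma cost_U_even k j d t : (2 <= k)%N -> ~~ odd k -> (2 <= d)%N -> (d = 2%N -> (k./2 <= j)%N) ->
  (t <= d)%N -> let w := C_E k * d%:Z - 2 * coef k (PU j) - (d - t)%N%:Z in
  t%:Z <= w /\ (w <= 4 -> [\/ [/\ j = 0%N, d = 3%N & w = t%:Z],
    [/\ j = k./2, d = 2%N & w = 2 + t%:Z] | [/\ j = 0%N, t = 0%N & w = 4]]).
Proof.
move=> k2 ok d2 dj td w; have [E4 _] := C_E_gt k2.
have wE : w = (C_E k - 1) * (d%:Z - 3) + 6 * j%:Z + t%:Z.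
  have := C_UE k j; rewrite /w /coef => h.
  have -> : (d - t)%N%:Z = d%:Z - t%:Z by rewrite subzn.
  by move: (C_U k j) (C_E k) h => U E; clear; nia.
have kE := half_double_odd k; have EE := C_E_half k; rewrite (negPf ok) in kE EE.
clearbody w; have [d_eq2|d_ne2] := eqVneq d 2%N.
  have jm := dj d_eq2; subst d; clear dj E4; split; first by lia.
  by move=> w4; constructor 2; split; lia.
have [d_eq3|d_ne3] := eqVneq d 3%N.
  subst d; clear dj E4; split; first by lia.
  by move=> w4; constructor 1; split; lia.
have d4 : (1 : int) <= d%:Z - 3 by lia.
have h : (C_E k - 1) * 1 <= (C_E k - 1) * (d%:Z - 3).
  by rewrite ler_wpM2l //; lia.
move: wE h; move: ((C_E k - 1) * (d%:Z - 3)) => x wE h.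
clear dj EE; split; first by lia.
by move=> w4; constructor 3; split; lia.
Qed.

(** Here w equals (C_E - 2)(d - 3) - 3 + 6j + 2t. At d = 3, j = 0 it is positive only for t >= 2,
    which [odd_two_specials] provides; at d = 2 a special neighbor forces j > m. The third
    alternative occurs only for d = 4 and k = 3. *)
Lemma cost_U_odd k j d t : (2 <= k)%N -> odd k -> (2 <= d)%N -> (d = 2%N -> (k./2 <= j)%N) ->
  (t <= d)%N -> (d = 2%N -> (d - t)%N != 0%N -> (k < k./2 + j.+1)%N) ->
  (d = 3%N -> j = 0%N -> (d - t <= 1)%N) ->
  let w := C_E k * d%:Z - 2 * coef k (PU j) - 2 * (d - t)%N%:Z in
  1 <= w /\ (w <= 2 -> [\/ [/\ j = 0%N, (d - t)%N = 1%N, t = 2%N & w = 1],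
    [/\ j = k./2, (d - t)%N = 0%N, t = 2%N & w = 2] | [/\ j = 0%N, t = 0%N & w = 2]]).
Proof.
move=> k2 ok d2 dj td ds d3 w; have [_ /(_ ok) E7] := C_E_gt k2.
have wE : w = (C_E k - 2) * (d%:Z - 3) - 3 + 6 * j%:Z + 2 * t%:Z.
  have := C_UE k j; rewrite /w /coef => h.
  have -> : (d - t)%N%:Z = d%:Z - t%:Z by rewrite subzn.
  by move: (C_U k j) (C_E k) h => U E; clear; nia.
have kE := half_double_odd k; have EE := C_E_half k; rewrite ok in kE EE.
clearbody w; have [d_eq2|d_ne2] := eqVneq d 2%N.
  have jm := dj d_eq2; have ds2 := ds d_eq2; subst d; clear dj ds d3 E7.
  have [st|st] := eqVneq (2 - t)%N 0%N.
    by split; [lia|move=> w2; constructor 2; split; lia].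
  by have := ds2 st; clear ds2 => js; split; [lia|move=> w2; exfalso; lia].
have [d_eq3|d_ne3] := eqVneq d 3%N.
  have js := d3 d_eq3; subst d; clear dj ds d3 E7.
  case: j wE js => [|j] wE js; last by split; [lia|move=> w2; exfalso; lia].
  have := js erefl; clear js => js.
  by split; [lia|move=> w2; constructor 1; split; lia].
clear dj ds d3.
have d4 : (1 : int) <= d%:Z - 3 by lia.
have h : (C_E k - 2) * 1 <= (C_E k - 2) * (d%:Z - 3).
  by rewrite ler_wpM2l //; lia.
move: wE h; move: ((C_E k - 2) * (d%:Z - 3)) => x wE h.
clear EE; split; first by lia.
by move=> w4; constructor 3; split; lia.
Qed.

Lemma sum_Posz (I : finType) (A : {set I}) (f : I -> nat) :
  \sum_(i in A) (f i)%:Z = (\sum_(i in A) f i)%N%:Z.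
Proof. by rewrite -[RHS]natz natr_sum; apply: eq_bigr => i _; rewrite natz. Qed.

Section Discharging.
Variables (T : finType) (k : nat) (G : graph T) (c : T -> precolor).
Hypotheses (k2 : (2 <= k)%N) (hc : precoloring k G c).
Hypothesis G_critical : critical k G c.
Hypothesis IH : forall (H : graph T) c', (#|edges H| < #|edges G|)%N ->
  precoloring k H c' -> critical k H c' -> pot k H c' (vertices H) <= -3.
Hypothesis Gpot : -3 < pot k G c (vertices G).

Let V := vertices G.
Let nb v := [set u | adj G v u].
Let S := [set v | special k G c v].
Let N := V :\: S.

Lemma nb_sym u v : (u \in nb v) = (v \in nb u).
Proof. by rewrite !inE adj_sym. Qed.

Lemma S_sub_V : S \subset V.
Proof. by apply/subsetP => v; rewrite inE => /specialP []. Qed.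

Lemma degree_edges v : #|nb v| = #|[set A in edges G | v \in A]|.
Proof.
have inj : {in nb v &, injective (fun u => [set v; u])}.
  move=> a b; rewrite !inE => va vb E.
  have : a \in [set v; b] by rewrite -E !inE eqxx orbT.
  by rewrite !inE eq_sym (negPf (adj_neq va)) => /eqP.
rewrite -(card_in_imset inj); apply: eq_card => A; rewrite inE.
apply/imsetP/andP => [[u]|[AG vA]].
  by rewrite inE => vu ->; rewrite !inE eqxx.
have [x [y [E xy]]] := edge_adj AG; move: vA; rewrite E !inE => /orP [] /eqP ->.
  by exists y; rewrite // inE.
by exists x; rewrite ?inE 1?adj_sym // setUC.
Qed.

Lemma handshake : (\sum_(v in V) #|nb v| = 2 * #|edges G|)%N.
Proof.
under eq_bigr => v _ do rewrite degree_edges -sum1_card.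
rewrite (exchange_big_dep (mem (edges G))) /= => [|v A _]; last by rewrite inE => /andP [].
rewrite mulnC -sum_nat_const; apply: eq_bigr => A AG.
rewrite -(card_edge AG) -sum1_card; apply: eq_bigl => v; rewrite inE AG /=.
by case vA: (v \in A); rewrite ?andbF // andbT (subsetP (proj1 (edgesP AG))).
Qed.

Let s v := #|nb v :&: S|.
Let n v := #|nb v :&: N|.

Lemma degree_split v : #|nb v| = (s v + n v)%N.
Proof.
rewrite -(cardsID S (nb v)) /s /n; congr (_ + _)%N; apply: eq_card => u.
rewrite !inE; case vu: (adj G v u); rewrite ?andbF //= andbT.
by have [_ ->] := adj_vertices vu; rewrite andbT.
Qed.

Lemma nb_special u : u \in S -> nb u \subset N.
Proof.
rewrite inE => su; apply/subsetP => v; rewrite inE => uv.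
have [_ vV] := adj_vertices uv; rewrite !inE vV andbT; apply/negP => sv.
by have := special_nonadjacent k2 hc G_critical IH Gpot su sv; rewrite uv.
Qed.

Lemma special_degree u : u \in S -> #|nb u| = 2%N.
Proof. by rewrite inE => /and3P [_ _ /eqP]. Qed.

Lemma sum_special : (\sum_(v in N) s v = 2 * #|S|)%N.
Proof.
rewrite mulnC -sum_nat_const /s.
under eq_bigr => v _ do rewrite -sum1_card.
rewrite (exchange_big_dep (mem S)) /= => [|v u _]; last by rewrite inE => /andP [].
apply: eq_bigr => u uS; rewrite -(special_degree uS) -sum1_card; apply: eq_bigl => v.
rewrite in_setI nb_sym uS andbT; case: (boolP (v \in nb u)) => [vu|]; rewrite ?andbF // andbT.
exact: (subsetP (nb_special uS)).
Qed.

(* Twice the negated contribution of [v] to the potential, after every special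
   vertex has passed its surplus to its two neighbors. *)
Definition cost v : int :=
  C_E k * #|nb v|%:Z - 2 * coef k (c v) - (1 + (odd k)%:Z) * (s v)%:Z.

Lemma total_cost : \sum_(v in N) cost v <= 4.
Proof.
have sumV : \sum_(v in V) (C_E k * #|nb v|%:Z - 2 * coef k (c v)) = - (2 * pot k G c V).
  rewrite sumrB -!mulr_sumr /pot.
  have -> : \sum_(v in V) (#|nb v|%:Z) = 2 * #|edges G|%:Z.
    by rewrite sum_Posz handshake PoszM.
  have -> : [set A in edges G | A \subset vertices G] = edges G.
    by apply/setP => A; rewrite inE; case AG: (A \in edges G) => //=; case/edgesP: AG => ->.
  move: (\sum_(v in V) _) #|edges G|%:Z (C_E k) => a e E; clear; nia.
have sumS : \sum_(v in S) (C_E k * #|nb v|%:Z - 2 * coef k (c v)) =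
    - (2 * (1 + (odd k)%:Z)) * #|S|%:Z.
  rewrite (eq_bigr (fun=> - (2 * (1 + (odd k)%:Z)))).
    by rewrite sumr_const -[#|S|%:Z]natz mulr_natr.
  move=> v vS; rewrite (special_degree vS).
  have [_ cv _] : [/\ v \in V, c v = PU (k./2).-1 & exists x y, neighbors2 G v x y].
    by apply: (@specialP _ k); rewrite inE in vS.
  by rewrite cv -(coef_special k2) opprB.
rewrite (big_setID S) /= (setIidPr S_sub_V) sumS -/N in sumV.
rewrite /cost sumrB -mulr_sumr.
have -> : \sum_(v in N) (s v)%:Z = 2 * #|S|%:Z.
  by rewrite sum_Posz sum_special PoszM.
(* The potential is an integer above -3, hence at least -2; this is the origin of the total 4. *)
move: sumV Gpot; rewrite -/V.
move: (\sum_(v in N) _) #|S|%:Z (pot k G c V) => a b p; clear.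
by case: (odd k); lia.
Qed.

Lemma degree_gt0 v : v \in V -> (0 < #|nb v|)%N.
Proof.
move=> vV; have [u vu] := critical_neighbor (ltnW k2) hc G_critical vV.
by apply/card_gt0P; exists u; rewrite inE.
Qed.

Lemma degree_gt1 v : v \in V ->
  (forall w, adj G v w -> exists2 u, u != w & adj G v u) -> (1 < #|nb v|)%N.
Proof.
move=> vV h; have [w vw] := critical_neighbor (ltnW k2) hc G_critical vV.
have [u uw vu] := h w vw; apply/card_gt1P; exists u, w; split=> //; by rewrite inE.
Qed.

Lemma F_no_special v j : v \in V -> c v = PF j -> s v = 0%N.
Proof.
move=> vV cv; apply: eq_card0 => u; rewrite in_setI !inE; apply/negP => /andP [vu su].
have uv : adj G u v by rewrite adj_sym.
have [_ cu _] := specialP su; have [x nbu] := special_neighbors su uv.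
have [i] := neighbors2_U k2 hc G_critical IH Gpot cu nbu.
by rewrite cv.
Qed.

Lemma F_cost v j : v \in V -> c v = PF j -> (if odd k then 3 else 5) <= cost v.
Proof.
move=> vV cv; rewrite /cost (F_no_special vV cv) mulr0 subr0 cv.
have /andP [j1 jk] : (1 <= j <= k)%N by have := hc vV; rewrite cv.
apply: cost_F => //; first exact: degree_gt0.
move=> jm; apply: degree_gt1 => // w vw.
exact: (small_F_two_neighbors k2 hc G_critical IH Gpot cv jm vw).
Qed.

Lemma U_facts v j : v \in N -> c v = PU j ->
  [/\ (2 <= #|nb v|)%N, #|nb v| = 2%N -> (k./2 <= j)%N,
      #|nb v| = 2%N -> s v != 0%N -> (k < k./2 + j.+1)%N
    & odd k -> #|nb v| = 3%N -> j = 0%N -> (s v <= 1)%N].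
Proof.
move=> /setDP [vV vS] cv; split.
- by apply: degree_gt1 => // w; apply: (U_two_neighbors hc G_critical cv).
- move=> d2; have [x [y nb2]] := degree2P d2.
  have := degree2_large k2 hc G_critical IH Gpot cv nb2.
  rewrite leq_eqVlt => /orP [/eqP E|]; last by rewrite ltnS.
  by case/negP: vS; rewrite inE /special -/V vV cv E eqxx -/(nb v) d2.
- move=> d2; rewrite -lt0n => /card_gt0P [u]; rewrite in_setI !inE => /andP [vu su].
  have uv : adj G u v by rewrite adj_sym.
  exact: (special_degree2 k2 hc G_critical IH Gpot su uv cv d2).
move=> ok d3 j0; rewrite leqNgt; apply/negP => /card_gt1P [a [b []]].
rewrite !in_setI !inE => /andP [va sa] /andP [vb sb] ab.
by rewrite j0 in cv; apply: (odd_two_specials k2 hc G_critical IH Gpot ok cv d3 sa sb ab).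
Qed.

Lemma N_cases v : v \in N -> (exists j, c v = PU j) \/ (exists j, c v = PF j).
Proof.
move=> /setDP [vV _]; case cv: (c v) => [j|j|]; [by left; exists j|by right; exists j|].
by case: (no_I k2 hc G_critical IH Gpot vV cv).
Qed.

Lemma s_degree v : s v = (#|nb v| - n v)%N.
Proof. by rewrite degree_split addnK. Qed.

Lemma n_le_degree v : (n v <= #|nb v|)%N.
Proof. by rewrite degree_split leq_addl. Qed.

Lemma even_cost v : ~~ odd k -> v \in N -> (0 <= cost v) /\ (cost v <= 4 ->
  (n v)%:Z <= cost v /\
  [\/ [/\ c v = PU 0, #|nb v| = 3%N & cost v = (n v)%:Z],
      [/\ c v = PU k./2, #|nb v| = 2%N & cost v = 2 + (n v)%:Z]
    | [/\ c v = PU 0, n v = 0%N & cost v = 4]]).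
Proof.
move=> ok vN; case: (N_cases vN) => [[j cv]|[j cv]]; last first.
  have vV : v \in V by case/setDP: vN.
  have := F_cost vV cv; rewrite (negPf ok); move: (cost v) => x; clear.
  by split; [lia|move=> h; exfalso; lia].
have [d2 dj _ _] := U_facts vN cv.
have := cost_U_even k2 ok d2 dj (n_le_degree v).
have -> : C_E k * #|nb v|%:Z - 2 * coef k (PU j) - (#|nb v| - n v)%N%:Z = cost v.
  by rewrite /cost cv (negPf ok) addr0 mul1r s_degree.
move=> /= [h1 h2]; split; first by apply: le_trans h1.
move=> h4; split=> //; case: (h2 h4) => [[j0 d3 w]|[jm d2' w]|[j0 t0 w]].
- by constructor 1; rewrite cv j0.
- by constructor 2; rewrite cv jm.
- by constructor 3; rewrite cv j0.
Qed.

Lemma odd_cost v : odd k -> v \in N -> 1 <= cost v /\ (cost v <= 2 ->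
  [\/ [/\ c v = PU 0, s v = 1%N, n v = 2%N & cost v = 1],
      [/\ c v = PU k./2, s v = 0%N, n v = 2%N & cost v = 2]
    | [/\ c v = PU 0, n v = 0%N & cost v = 2]]).
Proof.
move=> ok vN; case: (N_cases vN) => [[j cv]|[j cv]]; last first.
  have vV : v \in V by case/setDP: vN.
  have := F_cost vV cv; rewrite ok; move: (cost v) => x; clear.
  by split; [lia|move=> h; exfalso; lia].
have [d2 dj ds d3] := U_facts vN cv; have {}d3 := d3 ok.
rewrite s_degree in ds d3.
have := cost_U_odd k2 ok d2 dj (n_le_degree v) ds d3.
have -> : C_E k * #|nb v|%:Z - 2 * coef k (PU j) - 2 * (#|nb v| - n v)%N%:Z = cost v.
  by rewrite /cost cv ok s_degree.
move=> /= [h1 h2]; split=> //.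
move=> h4; case: (h2 h4) => [[j0 s1 t2 w]|[jm s0 t2 w]|[j0 t0 w]].
- by constructor 1; rewrite cv j0 s_degree.
- by constructor 2; rewrite cv jm s_degree.
- by constructor 3; rewrite cv j0.
Qed.

Lemma cost_ge0 v : v \in N -> 0 <= cost v.
Proof.
move=> vN; have [ok|ok] := boolP (odd k); last by have [] := even_cost ok vN.
by have [h _] := odd_cost ok vN; apply: le_trans h.
Qed.

Lemma cost_seq (L : seq T) : uniq L -> {subset L <= N} -> \sum_(v <- L) cost v <= 4.
Proof.
move=> uL LN; apply: le_trans total_cost; rewrite big_uniq //=.
rewrite [leRHS](bigID (mem L)) /=.
rewrite [X in _ <= X + _](eq_bigl (mem L)) => [|v]; last first.
  by rewrite /= andb_idl // => /LN.
by rewrite lerDl sumr_ge0 // => v /andP [/cost_ge0].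
Qed.

(* The colorings that finish the proof: [J] is a set of nonspecial vertices
   colored I, and a special vertex is colored I exactly when both of its
   neighbors are colored F. *)
Lemma color_by_J (J : {set T}) : J \subset N ->
  {in N, forall v, exists j, c v = PU j} ->
  {in J &, forall u v, ~~ adj G u v} ->
  let A v := nb v :&: (N :\: J) in
  let B v := [set u in nb v :&: S | nb u :&: J != set0] in
  {in N :\: J, forall v,
     (weight (c v) + \sum_(u in A v) weight (c u) + k./2 * #|B v| <= k)%N} ->
  {in N :\: J &, forall u v, adj G u v ->
     (#|A u| + #|B u| <= 1)%N || (#|A v| + #|B v| <= 1)%N} ->
  False.
Proof.
move=> JN NU Jind A B hw hd; apply: (proj1 G_critical).
pose FS := [set u in S | nb u :&: J != set0].
pose F := (N :\: J) :|: FS.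
have SU u : u \in S -> c u = PU (k./2).-1 by rewrite inE => /specialP [].
have NS u : u \in N -> u \notin S by case/setDP.
have VU u : u \in V -> exists j, c u = PU j.
  move=> uV; have [uS|uS] := boolP (u \in S); first by exists (k./2).-1; apply: SU.
  by apply: NU; rewrite in_setD uS.
have FV : F \subset V.
  apply/subsetP => u; rewrite inE => /orP [/setDP [/setDP [] //]|].
  by rewrite inE => /andP [/(subsetP S_sub_V)].
have nbFS u v : u \in FS -> adj G u v -> v \in F -> v \in nb u :&: (N :\: J).
  rewrite inE => /andP [uS _] uv vF.
  have vN : v \in N by apply: (subsetP (nb_special uS)); rewrite inE.
  move: vF; rewrite in_setU => /orP [vNJ|]; first by rewrite in_setI vNJ andbT inE.
  by rewrite inE => /andP [vS]; have := NS v vN; rewrite vS.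
(* A special vertex colored F has a neighbor in J, so at most one neighbor in F: it is a leaf. *)
have cardFS u : u \in FS -> (#|[set v in F | adj G u v]| <= 1)%N.
  move=> uFS; have := uFS; rewrite inE => /andP [uS /set0Pn [w /setIP [wu wJ]]].
  apply: (@leq_trans #|nb u :\ w|); last by have := cardsD1 w (nb u); rewrite wu special_degree //; case=> ->.
  apply: subset_leq_card; apply/subsetP => v; rewrite inE => /andP [vF uv].
  have /setIP [vnb /setDP [_ vJ]] := nbFS u v uFS uv vF.
  by rewrite in_setD1 vnb andbT; apply: contraNneq vJ => ->.
have nbNJ v : v \in N :\: J -> [set u in F | adj G v u] = A v :|: B v.
  move=> vNJ; apply/setP => u.
  have -> : (u \in A v :|: B v) = (u \in nb v) && (u \in F).
    by rewrite in_setU in_setI [u \in B v]inE in_setI in_setU [u \in FS]inE -andbA -andb_orr.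
  by rewrite inE [u \in nb v]inE andbC.
have AB v : [disjoint A v & B v].
  rewrite -setI_eq0; apply/eqP/setP => u; rewrite in_set0; apply/negP.
  move=> /setIP [/setIP [_ /setDP [uN _]]]; rewrite inE => /andP [/setIP [_ uS] _].
  by have := NS u uN; rewrite uS.
exists F; split=> //.
- move=> u v uv; have [uV vV] := adj_vertices uv.
  apply/negPn/negP; rewrite negb_or => /andP [uF vF].
  have inJ w : w \in V -> w \notin F -> w \notin S -> w \in J.
    move=> wV; rewrite /F in_setU negb_or => /andP [+ _] wS.
    by rewrite in_setD [w \in N]in_setD wV wS !andbT negbK.
  have noJ w z : w \in S -> w \notin F -> adj G w z -> z \notin J.
    move=> wS; rewrite /F in_setU negb_or => /andP [_]; rewrite inE wS negbK => /eqP E wz.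
    apply/negP => zJ; have : z \in nb w :&: J by rewrite in_setI zJ andbT inE.
    by rewrite E inE.
  have vu : adj G v u by rewrite adj_sym.
  have [uS|uS] := boolP (u \in S); have [vS|vS] := boolP (v \in S).
  + by have := subsetP (nb_special uS) v; rewrite inE => /(_ uv) /NS; rewrite vS.
  + by have := noJ u v uS uF uv; rewrite inJ.
  + by have := noJ v u vS vF vu; rewrite inJ.
  + by have := Jind u v (inJ _ uV uF uS) (inJ _ vV vF vS); rewrite uv.
- by move=> u uV cu; have [j cj] := VU u uV; rewrite cj in cu.
- by move=> u i uV cu; have [j cj] := VU u uV; rewrite cj in cu.
have wS u : u \in S -> weight (c u) = k./2.
  by rewrite inE => /(weight_special k2).
have sumF v : v \in N :\: J -> (\sum_(u in F | adj G v u) weight (c u) =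
    \sum_(u in A v) weight (c u) + k./2 * #|B v|)%N.
  move=> vNJ; rewrite -sum1_card big_distrr /=.
  rewrite [X in (_ + X)%N](eq_bigr (fun u => weight (c u))) => [|u]; last first.
    by rewrite inE => /andP [/setIP [_ uS] _]; rewrite wS // muln1.
  rewrite -bigU ?AB //=; apply: eq_bigl => u.
  by have := congr1 (fun X : {set T} => u \in X) (nbNJ v vNJ); rewrite /= in_set in_setU => ->.
apply: small_forest_star; [exact: adj_sym|exact: adj_irr| |].
  move=> u v uF vF uv.
  have [uFS|uFS] := boolP (u \in FS); first by rewrite cardFS.
  have [vFS|vFS] := boolP (v \in FS); first by rewrite (cardFS v) ?orbT.
  have uNJ : u \in N :\: J by move: uF; rewrite in_setU (negPf uFS) orbF.
  have vNJ : v \in N :\: J by move: vF; rewrite in_setU (negPf vFS) orbF.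
  rewrite !nbNJ // !cardsU (disjoint_setI0 (AB u)) (disjoint_setI0 (AB v)) !cards0 !subn0.
  exact: hd.
move=> u; rewrite in_setU => /orP [uNJ|uFS].
  by rewrite sumF // addnA; apply: hw.
have uS : u \in S by move: uFS; rewrite inE => /andP [].
have [v vu|none] := pickP [pred v | (v \in F) && adj G u v]; last first.
  by rewrite big_pred0 // addn0 wS //; have := half_double_odd k; clear; lia.
have [vF uv] := andP vu.
have /setIP [_ vNJ] := nbFS u v uFS uv vF.
rewrite (big_pred1 v) => [|w]; last first.
  apply/idP/eqP => [wu|->//].
  by apply: (card_le1_eqP (cardFS u uFS)); rewrite inE.
have B0 : (0 < #|B v|)%N.
  apply/card_gt0P; exists u; move: uFS; rewrite !inE => /andP [-> ->].
  by rewrite adj_sym uv.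
(* The pair u, v is part of the star at v, because u is counted in [B v]. *)
rewrite wS // addnC; apply: leq_trans (hw v vNJ).
by apply: leq_add; [apply: leq_addr|apply: leq_pmulr].
Qed.

Lemma N_neighbor u v : u \in N -> adj G u v -> v \in N -> (0 < n u)%N.
Proof. by move=> uN uv vN; apply/card_gt0P; exists v; rewrite in_setI vN andbT inE. Qed.

(** Either some vertex z meets all edges between nonspecial vertices and J is just z, or these edges
    form a matching of [PU 0] vertices and J can be empty. *)
Lemma even_absurd : ~~ odd k -> False.
Proof.
move=> ok; have m0 : (0 < k./2)%N by rewrite half_gt0.
have kE := half_double_odd k; rewrite (negPf ok) addn0 in kE.
have ev v : v \in N -> (n v)%:Z <= cost v /\
  [\/ [/\ c v = PU 0, #|nb v| = 3%N & cost v = (n v)%:Z],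
      [/\ c v = PU k./2, #|nb v| = 2%N & cost v = 2 + (n v)%:Z]
    | [/\ c v = PU 0, n v = 0%N & cost v = 4]].
  move=> vN; apply: (proj2 (even_cost ok vN)).
  have := @cost_seq [:: v]; rewrite big_seq1; apply=> // u; rewrite inE => /eqP ->; exact: vN.
have NU : {in N, forall v, exists j, c v = PU j}.
  by move=> v /ev [_ [[-> _ _]|[-> _ _]|[-> _ _]]]; [exists 0%N|exists k./2|exists 0%N].
have [z /andP [zN Pz]|noz] :=
    pickP [pred z | (z \in N) && ((1 < n z)%N || ((0 < n z)%N && (c z == PU k./2)))].
  have z4 : 4 <= cost z + (n z)%:Z.
    have [_ [[cz dz wz]|[cz dz wz]|[cz nz wz]]] := ev z zN; rewrite wz; move: Pz; rewrite cz.
    + have -> : (PU 0 == PU k./2) = false by apply/eqP => - [E]; rewrite -E in m0.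
      by rewrite andbF orbF; clear; lia.
    + by clear; lia.
    + by rewrite nz.
  (* Each neighbor of z in N costs at least 1. With [z4] this exhausts the total 4, so every other v
     costs exactly [adj G z v]. *)
  have sum : cost z + \sum_(v in N :\ z) (cost v - (adj G z v)%:Z) + (n z)%:Z <= 4.
    apply: le_trans total_cost; rewrite (big_setD1 z zN) /= -addrA lerD2l sumrB.
    suff -> : \sum_(v in N :\ z) (adj G z v)%:Z = (n z)%:Z by rewrite subrK.
    rewrite sum_Posz (eq_bigr (fun v => if adj G z v then 1 else 0)%N) => [|v _]; last by case: adj.
    rewrite -big_mkcondr sum1dep_card; congr Posz; apply: eq_card => v.
    rewrite inE in_setD1 in_setI [v \in nb z]inE.
    by case zv: (adj G z v); rewrite ?andbF //= andbT eq_sym (adj_neq zv).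
  have term0 v : v \in N :\ z -> 0 <= cost v - (adj G z v)%:Z.
    move=> /setD1P [vz vN]; have [h _] := ev v vN; rewrite subr_ge0; apply: le_trans h.
    case zv: (adj G z v) => //; rewrite lez_nat.
    by apply: (N_neighbor vN (v := z)) => //; rewrite adj_sym.
  have cost1 v : v \in N -> v != z -> cost v = (adj G z v)%:Z.
    move=> vN vz; have vD : v \in N :\ z by rewrite in_setD1 vz vN.
    rewrite (big_setD1 v vD) /= in sum.
    have : 0 <= \sum_(u in (N :\ z) :\ v) (cost u - (adj G z u)%:Z).
      by apply: sumr_ge0 => u /setD1P [_ /term0].
    have := term0 v vD; move: sum z4; set x := \sum_(u in _) _.
    by move: x (cost v) (cost z) (adj G z v) (n z) => a b d e f; clear; lia.
  have others v : v \in N -> v != z -> c v = PU 0 /\ n v = adj G z v.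
    move=> vN vz; have := cost1 v vN vz; have [_ [[cv dv wv]|[cv dv wv]|[cv nv wv]]] := ev v vN.
    + by rewrite wv => - [->].
    + by rewrite wv; case: (adj G z v); move: (n v) => a; clear; lia.
    + by rewrite wv; case: (adj G z v).
  (* The special vertices colored F will be neighbors of z. There is at most one, and it fits next
     to a [PU 0] vertex since 1 + m <= k. *)
  have sz : (s z <= 1)%N.
    have : 0 <= \sum_(v in N :\ z) (cost v - (adj G z v)%:Z) by apply: sumr_ge0.
    rewrite s_degree; move: sum z4; set x := \sum_(u in _) _; move: x => x.
    have [_ [[_ -> ->]|[_ -> ->]|[_ nz ->]]] := ev z zN; last by move: Pz; rewrite nz.
      by move: (n z) => a; clear; lia.
    by move: (n z) => a; clear; lia.
  have noadj u v : u \in N :\: [set z] -> v \in N :\: [set z] -> ~~ adj G u v.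
    move=> /setDP [uN uz] /setDP [vN vz]; rewrite !in_set1 in uz vz.
    apply/negP => uv; have [_ nu] := others u uN uz.
    have := N_neighbor uN uv vN; rewrite nu; case zu: (adj G z u) => // _.
    suff : (1 < n u)%N by rewrite nu zu.
    apply/card_gt1P; exists v, z; split=> //; rewrite in_setI ?vN ?zN andbT inE //.
    by rewrite adj_sym.
  apply: (@color_by_J [set z]) => //.
  - by rewrite sub1set.
  - by move=> u v /set1P -> /set1P ->; rewrite adj_irr.
  - move=> v vD; have /setDP [vN vz] := vD; rewrite in_set1 in vz.
    have [cv _] := others v vN vz.
    rewrite big_pred0 => [|u]; last first.
      rewrite in_setI; apply/negP => /andP [+ uD]; rewrite inE.
      by apply/negP; apply: noadj.
    have : (#|[set u in nb v :&: S | nb u :&: [set z] != set0]| <= s z)%N.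
      apply: subset_leq_card; apply/subsetP => u; rewrite inE => /andP [/setIP [_ uS]].
      move=> /set0Pn [w /setIP [wu /set1P wz]]; rewrite in_setI uS andbT nb_sym.
      by rewrite -wz.
    move: #|_| => b bz; rewrite cv [X in (_ <= X)%N]kE /=.
    by move: bz sz m0; move: (s z) (k./2) => a m; clear; nia.
  - by move=> u v uD vD uv; have := noadj u v uD vD; rewrite uv.
have n1 v : v \in N -> (n v <= 1)%N.
  by move=> vN; have := noz v; rewrite /= vN /= => /negbT; rewrite negb_or -leqNgt => /andP [].
have c1 v : v \in N -> (0 < n v)%N -> c v = PU 0.
  move=> vN nv; have := noz v; rewrite /= vN nv /= => /negbT; rewrite negb_or => /andP [_ /eqP cv].
  by have [_ [[-> _ _]|[cv' _ _]|[-> _ _]]] := ev v vN.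
apply: (@color_by_J set0) => //.
- exact: sub0set.
- by move=> u v; rewrite inE.
- move=> v; rewrite setD0 => vN.
  have -> : [set u in nb v :&: S | nb u :&: set0 != set0] = set0.
    by apply/setP => u; rewrite !inE setI0 eqxx andbF.
  rewrite cards0 muln0 addn0.
  have [nv|nv] := posnP (n v).
    rewrite (cards0_eq nv) big_set0 addn0 [X in (_ <= X)%N]kE.
    have [_ [[-> _ _]|[-> _ _]|[-> _ _]]] := ev v vN; move: m0 => /=; clear; lia.
  have /cards1P [u E] : n v == 1%N by rewrite eqn_leq n1.
  have /setIP [vu uN] : u \in nb v :&: N by rewrite E inE.
  rewrite E big_set1 (c1 v vN nv) (c1 u uN) ?[X in (_ <= X)%N]kE /=; first by move: m0; clear; lia.
  by apply: (N_neighbor uN _ vN); move: vu; rewrite inE adj_sym.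
move=> u v; rewrite setD0 => uN vN _.
have -> : [set u0 in nb u :&: S | nb u0 :&: set0 != set0] = set0.
  by apply/setP => u0; rewrite !inE setI0 eqxx andbF.
by rewrite cards0 addn0 n1.
Qed.

Lemma odd_absurd : odd k -> False.
Proof.
move=> ok; have m0 : (0 < k./2)%N by rewrite half_gt0.
have kE := half_double_odd k; rewrite ok in kE.
have cost1 v : v \in N -> 1 <= cost v by move=> vN; have [] := odd_cost ok vN.
have sumL (L : seq T) : uniq L -> all (fun v => v \in N) L -> \sum_(v <- L) cost v <= 4.
  by move=> uL /allP LN; apply: cost_seq.
have two v : n v = 2%N -> exists a b, [/\ a != b, adj G v a, adj G v b, a \in N & b \in N].
  move=> nv; have /eqP/cards2P [a [b [ab E]]] := nv; exists a, b.
  have /setIP [va aN] : a \in nb v :&: N by rewrite E !inE eqxx.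
  have /setIP [vb bN] : b \in nb v :&: N by rewrite E !inE eqxx orbT.
  by split=> //; [rewrite inE in va|rewrite inE in vb].
(* Cost 3 at v leaves room for at most one other vertex, of cost 1, which would have two nonspecial
   neighbors. So v would be alone in N; but v has a neighbor, and a special neighbor has two
   neighbors in N. *)
have cost2 v : v \in N -> cost v <= 2.
  move=> vN; rewrite leNgt; apply/negP => v3.
  have only w : w \in N -> w = v.
    move=> wN; apply/eqP/negPn/negP => wv.
    have := sumL [:: v; w]; rewrite /= vN wN inE eq_sym wv !big_cons big_nil => /(_ isT isT) h.
    have w2 : cost w <= 2 by move: h v3; move: (cost v) (cost w) => a b; clear; lia.
    have [nw|nw] : n w = 2%N \/ cost w = 2.
      by have [_ /(_ w2) [[_ _ -> _]|[_ _ -> _]|[_ _ ->]]] := odd_cost ok wN; [left|left|right].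
      have [a [b [ab wa wb aN bN]]] := two w nw.
      have [u [uN wu uv]] : exists u, [/\ u \in N, adj G w u & u != v].
        have [av|av] := eqVneq a v; last by exists a.
        by exists b; split=> //; rewrite eq_sym -av.
      have := sumL [:: v; w; u]; rewrite /= vN wN uN !inE !negb_or (eq_sym v w) wv (eq_sym v u) uv (adj_neq wu).
      rewrite !big_cons big_nil => /(_ isT isT); have := cost1 w wN; have := cost1 u uN.
      by move: v3; move: (cost v) (cost w) (cost u) => x y z; clear; lia.
    by move: h v3; rewrite nw; move: (cost v) => x; clear; lia.
  have vV : v \in V by case/setDP: vN.
  have [u vu] := critical_neighbor (ltnW k2) hc G_critical vV.
  have [_ uV] := adj_vertices vu.
  have [uS|uS] := boolP (u \in S); last first.
    have uN : u \in N by rewrite in_setD uS.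
    by have := adj_neq vu; rewrite (only u uN) eqxx.
  have /eqP/cards2P [a [b [ab E]]] := special_degree uS.
  have aN : a \in N by apply: (subsetP (nb_special uS)); rewrite E !inE eqxx.
  have bN : b \in N by apply: (subsetP (nb_special uS)); rewrite E !inE eqxx orbT.
  by move: ab; rewrite (only a aN) (only b bN) eqxx.
have ov v (vN : v \in N) := proj2 (odd_cost ok vN) (cost2 v vN).
have NU : {in N, forall v, exists j, c v = PU j}.
  by move=> v /ov [[-> _ _ _]|[-> _ _ _]|[-> _ _]]; [exists 0%N|exists k./2|exists 0%N].
have [w /andP [wN nw]|now] := pickP [pred w | (w \in N) && (n w != 0%N)]; last first.
  have n0 v : v \in N -> n v = 0%N.
    by move=> vN; have := now v; rewrite /= vN /= => /eqP.
  apply: (@color_by_J set0) => //.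
  - exact: sub0set.
  - by move=> u v; rewrite inE.
  - move=> v; rewrite setD0 => vN.
    have -> : [set u in nb v :&: S | nb u :&: set0 != set0] = set0.
      by apply/setP => u; rewrite !inE setI0 eqxx andbF.
    rewrite cards0 muln0 addn0 (cards0_eq (n0 v vN)) big_set0 addn0.
    case: (ov v vN) => [[_ _ h _]|[_ _ h _]|[-> _ _]]; try by rewrite n0 in h.
    exact: ltnW.
  - move=> u v; rewrite setD0 => uN vN uv.
    by have := N_neighbor uN uv vN; rewrite n0.
(* A vertex without nonspecial neighbors costs 2; with w and two neighbors of w the total would be
   at least 5. *)
have n2 v : v \in N -> n v = 2%N.
  move=> vN; case: (ov v vN) => [[_ _ -> _]|[_ _ -> _]|[_ nv wv]] //.
  have nw2 : n w = 2%N by case: (ov w wN) => [[_ _ -> _]|[_ _ -> _]|[_ nw0 _]] //; rewrite nw0 in nw.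
  have [a [b [ab wa wb aN bN]]] := two w nw2.
  have vw : v != w by apply: contraNneq nw => <-; rewrite nv.
  have ne u : u \in N -> adj G w u -> v != u.
    move=> uN wu; apply/eqP => E; rewrite -E adj_sym in wu.
    by have := N_neighbor vN wu wN; rewrite nv.
  have := sumL [:: v; w; a; b].
  rewrite /= vN wN aN bN !inE !negb_or vw ab (ne a aN wa) (ne b bN wb) (adj_neq wa) (adj_neq wb).
  rewrite !big_cons big_nil wv => /(_ isT isT).
  have := cost1 w wN; have := cost1 a aN; have := cost1 b bN.
  by move: (cost w) (cost a) (cost b) => x y z; clear; lia.
(* The vertex p is one of class [PU k./2] if there is one, and w otherwise. Another vertex of cost
   2, together with p and a further neighbor of p, would bring the total to 5. *)
have [p [pN hp]] : exists p, p \in N /\ forall v, v \in N -> v != p -> c v = PU 0 /\ s v = 1%N.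
  have [p /andP [pN /eqP cp]|nop] := pickP [pred p | (p \in N) && (c p == PU k./2)]; last first.
    exists w; split=> // v vN _; case: (ov v vN) => [[-> -> _ _] //|[cv _ _ _]|[_ nv _]].
      by have := nop v; rewrite /= vN cv eqxx.
    by have := n2 v vN; rewrite nv.
  have PU0 : PU 0 <> PU k./2 by move=> [E]; rewrite -E in m0.
  have wp : cost p = 2.
    by case: (ov p pN) => [[cp' _ _ _]|[_ _ _ -> //]|[_ _ -> //]]; rewrite cp' in cp.
  exists p; split=> // v vN vp; case: (ov v vN) => [[-> -> _ _] //|[_ _ _ wv]|[_ nv _]]; last first.
    by have := n2 v vN; rewrite nv.
  have [a [b [ab pa pb aN bN]]] := two p (n2 p pN).
  have [u [uN pu uv]] : exists u, [/\ u \in N, adj G p u & u != v].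
    have [av|av] := eqVneq a v; last by exists a.
    by exists b; split=> //; rewrite eq_sym -av.
  have := sumL [:: v; p; u]; rewrite /= vN pN uN !inE !negb_or vp (eq_sym v u) uv (adj_neq pu).
  rewrite !big_cons big_nil wp wv => /(_ isT isT); have := cost1 u uN.
  by move: (cost u) => x; clear; lia.
have [z1 [z2 [z12 pz1 pz2 z1N z2N]]] := two p (n2 p pN).
have nbp : nb p :&: N = [set z1; z2].
  apply/esym/eqP; rewrite eqEcard cards2 z12 -/(n p) n2 // leqnn andbT.
  by apply/subsetP => u /set2P [] ->; rewrite in_setI ?z1N ?z2N andbT inE.
(* Only z1 and z2 remain colored F among the nonspecial vertices. An edge inside J would give, with
   p, z1 and z2, five vertices of cost at least 1. *)
pose J := N :\: nb p.
have NJ v : (v \in N :\: J) = (v \in [set z1; z2]).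
  by rewrite -nbp in_setD in_setD in_setI; case: (v \in N); case: (v \in nb p).
have pJ : p \in J by rewrite in_setD pN andbT inE adj_irr.
have Jz v z : v \in J -> z \in [set z1; z2] -> v != z.
  by move=> vJ; rewrite -NJ in_setD => /andP [zJ _]; apply: contraNneq zJ => <-.
have np_adj v : v \in J -> ~~ adj G p v by rewrite in_setD inE => /andP [].
have Jind : {in J &, forall u v, ~~ adj G u v}.
  move=> u v uJ vJ; apply/negP => uv.
  have up : u != p by apply: contraTneq uv => ->; apply: np_adj.
  have vp : v != p by apply: contraTneq uv => ->; rewrite adj_sym; apply: np_adj.
  have uN : u \in N by case/setDP: uJ. have vN : v \in N by case/setDP: vJ.
  have := sumL [:: p; u; v; z1; z2].
  rewrite /= pN uN vN z1N z2N !inE !negb_or (eq_sym p u) up (eq_sym p v) vp (adj_neq pz1) (adj_neq pz2).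
  rewrite (adj_neq uv) (Jz u z1 uJ (set21 _ _)) (Jz u z2 uJ (set22 _ _)) (Jz v z1 vJ (set21 _ _)).
  rewrite (Jz v z2 vJ (set22 _ _)) z12 !big_cons big_nil => /(_ isT isT).
  have := cost1 p pN; have := cost1 u uN; have := cost1 v vN; have := cost1 z1 z1N; have := cost1 z2 z2N.
  by move: (cost p) (cost u) (cost v) (cost z1) (cost z2) => a b d e f; clear; lia.
have zprop z : z \in [set z1; z2] -> [/\ z \in N, adj G p z, z != p & c z = PU 0 /\ s z = 1%N].
  rewrite -nbp => /setIP [zp zN]; rewrite inE in zp.
  have zp' : z != p by rewrite eq_sym (adj_neq zp).
  by split=> //; apply: hp.
have Acard v : v \in [set z1; z2] -> (#|nb v :&: (N :\: J)| <= 1)%N.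
  move=> vz; apply: (@leq_trans #|[set z1; z2] :\ v|).
    apply: subset_leq_card; apply/subsetP => u /setIP [vu]; rewrite NJ in_setD1 => ->.
    by rewrite inE in vu; rewrite eq_sym (adj_neq vu).
  by have := cardsD1 v [set z1; z2]; rewrite vz cards2 z12 add1n => - [<-].
have Bcard v : v \in [set z1; z2] -> (#|[set u in nb v :&: S | nb u :&: J != set0]| <= 1)%N.
  move=> vz; have [_ _ _ [_ <-]] := zprop v vz.
  by apply: subset_leq_card; apply/subsetP => u; rewrite inE => /andP [].
apply: (@color_by_J J) => //.
- exact: subsetDl.
- move=> v; rewrite NJ => vz; have [vN _ _ [cv _]] := zprop v vz.
  have hA : (\sum_(u in nb v :&: (N :\: J)) weight (c u) <= 1)%N.
    rewrite (eq_bigr (fun=> 1%N)) => [|u /setIP [_]]; first by rewrite sum1_card Acard.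
    by rewrite NJ => /zprop [_ _ _ [->]].
  move: hA (Bcard v vz); rewrite cv [X in (_ <= X)%N -> _]/=.
  move: (\sum_(u in _) _)%N #|[set u in nb v :&: S | _]| => a b a1 b1.
  rewrite [X in (_ <= X)%N]kE /=; move: a1 b1 m0; move: (k./2) => m; clear; nia.
move=> u v; rewrite !NJ => uz vz uv.
(* The special vertex a is F because of some x in J. If x were not p, its two nonspecial neighbors
   would be z1 and z2, giving [z1'] the three nonspecial neighbors p, [z2'] and x. *)
have disj z1' z2' : z1' \in [set z1; z2] -> z2' \in [set z1; z2] -> adj G z1' z2' ->
    forall a, a \in [set u in nb z1' :&: S | nb u :&: J != set0] -> a \in nb p.
  move=> az bz abz a; rewrite inE => /andP [/setIP [_ aS] /set0Pn [x /setIP [xa xJ]]].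
  have [E|xp] := eqVneq x p; first by rewrite nb_sym -E.
  have xN : x \in N by case/setDP: xJ.
  have [b1 [b2 [b12 xb1 xb2 b1N b2N]]] := two x (n2 x xN).
  have bz' b : b \in N -> adj G x b -> b \in [set z1; z2].
    move=> bN xb; rewrite -NJ in_setD bN andbT; apply/negP => bJ.
    by have := Jind x b xJ bJ; rewrite xb.
  have xz : adj G x z1'.
    have zE z : z \in [set z1; z2] -> z != z1' -> z = z2'.
      move: az bz (adj_neq abz); rewrite !inE.
      by move=> /orP [] /eqP -> /orP [] /eqP -> h /orP [] /eqP -> //; rewrite eqxx in h *.
    have [<- //|b1z] := eqVneq b1 z1'.
    have [<- //|b2z] := eqVneq b2 z1'.
    by case/eqP: b12; rewrite (zE b1 (bz' b1 b1N xb1) b1z) (zE b2 (bz' b2 b2N xb2) b2z).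
  have [z1N' pz1' z1p' _] := zprop z1' az; have [z2N' _ z2p' _] := zprop z2' bz.
  have : (#|[set p; z2'; x]| <= n z1')%N.
    apply: subset_leq_card; apply/subsetP => y; rewrite in_setU in_set2 in_set1 -orbA.
    move=> /or3P [] /eqP ->; rewrite in_setI ?pN ?z2N' ?xN andbT inE //.
      by rewrite adj_sym.
    by rewrite adj_sym.
  rewrite n2 // setUC cardsU1 cards2 !inE (eq_sym p z2') z2p' (negPf xp).
  by rewrite (negPf (Jz x z2' xJ bz)).
have [[_ up _ _] [_ vp _ _]] := (zprop u uz, zprop v vz).
rewrite -[_ || _]negbK negb_or -!ltnNge; apply/negP => /andP [hu hv].
have /card_gt0P [a aB] : (0 < #|[set u0 in nb u :&: S | nb u0 :&: J != set0]|)%N.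
  by move: hu (Acard u uz); move: #|_| #|_| => x y; clear; lia.
have /card_gt0P [b bB] : (0 < #|[set u0 in nb v :&: S | nb u0 :&: J != set0]|)%N.
  by move: hv (Acard v vz); move: #|_| #|_| => x y; clear; lia.
have vu : adj G v u by rewrite adj_sym.
have ap := disj u v uz vz uv a aB; have bp := disj v u vz uz vu b bB.
move: aB bB; rewrite !in_set => /andP [/andP [ua sa] _] /andP [/andP [vb sb] _].
have sp : (s p <= 1)%N.
  by case: (ov p pN) => [[_ -> _ _]|[_ -> _ _]|[_ np0 _]] //; have := n2 p pN; rewrite np0.
(* Since p has at most one special neighbor, a single special vertex would be adjacent to u, v and
   p, but special vertices have degree 2. *)
have ab : a = b by apply: (card_le1_eqP sp); rewrite in_setI ?ap ?bp inE.
rewrite -ab in vb.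
have aS : a \in S by rewrite inE.
have : (#|[set u; v; p]| <= #|nb a|)%N.
  apply: subset_leq_card; apply/subsetP => y; rewrite in_setU in_set2 in_set1 -orbA.
  by move=> /or3P [] /eqP ->; rewrite nb_sym // inE.
rewrite (special_degree aS) setUC cardsU1 cards2 !inE (adj_neq uv).
by rewrite (negPf (adj_neq up)) (negPf (adj_neq vp)).
Qed.

End Discharging.

(** * The induction on edges and the return to [rho] *)

Theorem critical_pot (T : finType) k (G : graph T) c : (2 <= k)%N ->
  precoloring k G c -> critical k G c -> pot k G c (vertices G) <= -3.
Proof.
move=> k2; have [e] := ubnP #|edges G|; elim: e G c => // e IH G c Ge hc crit.
have IHG (H : graph T) c' : (#|edges H| < #|edges G|)%N -> precoloring k H c' ->
    critical k H c' -> pot k H c' (vertices H) <= -3.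
  by move=> HG; apply: IH; apply: leq_trans HG _; rewrite -ltnS.
rewrite leNgt; apply/negP => Gpot.
have [ok|ok] := boolP (odd k).
  exact: (odd_absurd k2 hc crit IHG Gpot ok).
exact: (even_absurd k2 hc crit IHG Gpot ok).
Qed.

Lemma IF_critical_critical (T : finType) k (G : graph T) c :
  precoloring k G c -> IF_critical k G c -> critical k G c.
Proof.
move=> hc [ncol sub _]; split=> [col|H HG]; first by apply: ncol; apply/colorableP.
have hcH : precoloring k H c.
  by move=> v vH; apply: hc; case/andP: HG => /andP [/subsetP HV _] _; apply: HV.
by apply/(colorableP hcH); apply: sub.
Qed.

Lemma sum_class (T : finType) (G : graph T) (c : T -> precolor) (f : nat -> int)
    (P : nat -> precolor) a b :
  \sum_(a <= j < b) f j * #|precolor_class G c (P j) :&: vertices G|%:Z =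
  \sum_(v in vertices G) \sum_(a <= j < b | c v == P j) f j.
Proof.
under [RHS]eq_bigr => v _ do rewrite big_mkcond /=.
rewrite exchange_big /=; apply: eq_bigr => j _.
rewrite -big_mkcondr sumr_const -[_%:Z]natz mulr_natr; congr (_ *+ _); apply: eq_card => v.
by rewrite !inE [RHS]unfold_in andbAC andbb.
Qed.

(** Since [coef] dominates [C_F], the bound obtained for [pot] is the stronger one. *)
Lemma rho_le_pot (T : finType) k (G : graph T) c : precoloring k G c ->
  rho k G c (vertices G) <= pot k G c (vertices G).
Proof.
move=> hc; rewrite /rho /pot.
have -> : [set A in edges G | A \subset vertices G] = edges (induced G (vertices G)) by [].
rewrite lerD2r (sum_class G c (C_U k) PU) (sum_class G c (C_F k) PF).
have -> : C_I k * #|precolor_class G c PI :&: vertices G|%:Z =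
    \sum_(v in vertices G) (if c v == PI then C_I k else 0).
  rewrite -big_mkcondr sumr_const -[_%:Z]natz mulr_natr; congr (_ *+ _); apply: eq_card => v.
  by rewrite !inE [RHS]unfold_in andbAC andbb.
rewrite -!big_split /=; apply: ler_sum => v vV; have := hc v vV.
have one (f : nat -> int) a b j : (a <= j < b)%N -> \sum_(a <= i < b | j == i) f i = f j.
  move=> jab; rewrite (big_rem j) ?mem_index_iota //= eqxx big1_seq ?addr0 // => i /andP [/eqP <-].
  by rewrite mem_rem_uniqF ?iota_uniq.
case: (c v) => [j|j|] /= vj.
- rewrite (eq_bigl (fun i => j == i)) // one // big_pred0 // addr0 addr0.
  exact: lexx.
- rewrite big_pred0 // (eq_bigl (fun i => j == i)) // one // add0r addr0.
  by apply: C_F_le_coef; case/andP: vj.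
- by rewrite !big_pred0 // !add0r; apply: lexx.
Qed.

Theorem mainTheorem2 (k : nat) (hk : (2 <= k)%N) (T : finType) (G : graph T)
    (c : T -> precolor) (hc : precoloring k G c) (hG : IF_critical k G c) :
  rho k G c (vertices G) <= -3.
Proof.
apply: le_trans (rho_le_pot hc) _.
exact: critical_pot hk hc (IF_critical_critical hc hG).
Qed.
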